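(* Let $\{a_n\}_{n=1}^{\infty}$ be a sequence of positive integers satisfying $\limsup_{n\to\infty}\frac{1}{n}\log a_n=0$. Then there exist a Cantor set $\Sigma\subset\mathbb{R}$ of Lebesgue measure zero and a minimal subshift $(Y,\sigma)$, with $Y\subseteq\{0,1\}^{\mathbb{Z}}$, such that $$\limsup_{n\to\infty}\frac{P_Y(n)}{a_n}=\infty$$ and such that for every $y=(y_n)_{n\in\mathbb{Z}}\in Y$ the spectrum of the discrete Schrödinger operator $H_y\colon\ell^2(\mathbb{Z})\to\ell^2(\mathbb{Z})$ given by $$(H_yu)(n):=u(n-1)+u(n+1)+y_nu(n)$$ is exactly $\Sigma$.
   Context: The space $\{0,1\}^{\mathbb{Z}}$ carries the product topology, with $\{0,1\}\subset\mathbb{R}$, and $\sigma$ denotes the left shift, $(\sigma x)_n=x_{n+1}$. A subshift $(Y,\sigma)$ is a closed $\sigma$-invariant set $Y\subseteq\{0,1\}^{\mathbb{Z}}$ with the restriction of $\sigma$. $P_Y(n)$ is the number of words $w=(w_0,\dots,w_{n-1})\in\{0,1\}^n$ for which there is some $x\in Y$ with $x_j=w_j$ for $0\le j\le n-1$. A Cantor set is a nonempty compact, perfect, totally disconnected subset of $\mathbb{R}$. *)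

(* Defs.v *)
From HB Require Import structures.
From mathcomp Require Import all_boot all_order all_algebra.
From mathcomp Require Import all_classical all_reals all_analysis.
From mathcomp Require Import complex.
From mathcomp Require Import ring lra.
Set Implicit Arguments.
Unset Strict Implicit.
Unset Printing Implicit Defensive.
Import Order.TTheory GRing.Theory Num.Theory.
Import numFieldNormedType.Exports.
Local Open Scope classical_set_scope.
Local Open Scope ring_scope.
Local Open Scope complex_scope.

Definition cantor_set (R : realType) (A : set R) : Prop :=
  [/\ A !=set0, compact A, perfect_set A & totally_disconnected A].

Definition full_shift : topologicalType := prod_topology (fun _ : int => bool).

Definition shift (x : full_shift) : full_shift := fun n => x (n + 1).

Definition subshift (Y : set full_shift) : Prop :=
  closed Y /\ shift @` Y = Y.

Definition minimal_subshift (Y : set full_shift) : Prop :=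
  [/\ subshift Y, Y !=set0 &
      forall Z, subshift Z -> Z !=set0 -> Z `<=` Y -> Z = Y].

Definition complexity (Y : set full_shift) (n : nat) : nat :=
  #|[pred w : n.-tuple bool |
     `[< exists2 x, Y x & forall j : 'I_n, x j%:Z = tnth w j >]]|.

Lemma summable_le_lincomb (R : realType) (c d : R) (f g h : int -> R) :
  0 <= c -> 0 <= d -> (forall n, 0 <= g n) -> (forall n, 0 <= h n) ->
  (forall n, 0 <= f n <= c * g n + d * h n) ->
  summable [set: int] (EFin \o g) -> summable [set: int] (EFin \o h) ->
  summable [set: int] (EFin \o f).
Proof.
move=> c0 d0 g0 h0 fle.
have sumZ k (p : int -> R) : 0 <= k -> (forall n, 0 <= p n) ->
    summable [set: int] (EFin \o p) ->
    summable [set: int] (EFin \o (fun n => k * p n)).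
  move=> k0 p0; rewrite /summable => sp.
  apply: (@le_lt_trans _ _ (k%:E * \esum_(n in [set: int]) `|(EFin \o p) n|)%E).
    apply: ge_ereal_sup => _ [X [finX XI] <-].
    under eq_fsbigr do rewrite /= normrM (ger0_norm k0) EFinM.
    rewrite -ge0_mule_fsumr//.
    by apply: lee_wpmul2l => //; apply: ereal_sup_ubound; exists X.
  by rewrite lte_mul_pinfty.
move=> /(sumZ c _ c0 g0) sg /(sumZ d _ d0 h0) sh.
apply: le_lt_trans (summableD sg sh).
apply: le_esum => n _ /=; rewrite lee_fin.
have /andP[f0 fn] := fle n.
by rewrite !ger0_norm // addr_ge0 // mulr_ge0.
Qed.

(* [R[i]^o] is [R[i]] as a module over itself; [R[i]] alone is also a module
   over [R], and the linear structures below must be complex ones. *)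
Section Ell2.
Variable R : realType.

Definition square_summable : {pred int -> R[i]^o} :=
  fun u => `[< summable [set: int] (fun n => (Normc.normc (u n) ^+ 2)%:E) >].

Lemma square_summable_submod : submod_closed square_summable.
Proof.
have sq0 (v : int -> R[i]^o) n : 0 <= Normc.normc (v n) ^+ 2 by exact: sqr_ge0.
split=> [|a u v].
  apply/asboolP; rewrite /summable esum1 ?ltry// => n _.
  by rewrite Normc.normc0 expr0n abse0.
move=> /asboolP su /asboolP sv; apply/asboolP.
apply: (@summable_le_lincomb _ (2 * Normc.normc a ^+ 2) 2 _ _ _ _ _ (sq0 u) (sq0 v))
  => //.
  by rewrite mulr_ge0 // sqr_ge0.
move=> n; rewrite sq0 /=.
have normcge0 (z : R[i]) : 0 <= Normc.normc z by case: z => *; exact: sqrtr_ge0.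
have := le_normcD (a * u n) (v n); rewrite Normc.normcM => le1.
have le2 := normcge0 (a * u n + v n).
rewrite (_ : (a *: u + v) n = a * u n + v n) //.
apply: (@le_trans _ _ ((Normc.normc a * Normc.normc (u n) + Normc.normc (v n)) ^+ 2)).
  by rewrite lerXn2r // nnegrE // (le_trans le2).
have := sqr_ge0 (Normc.normc a * Normc.normc (u n) - Normc.normc (v n)).
nra.
Qed.

HB.instance Definition _ :=
  GRing.isSubmodClosed.Build _ _ square_summable square_summable_submod.

Record ell2 := Ell2 {
  ell2_fun :> int -> R[i]^o;
  _ : ell2_fun \in square_summable
}.

HB.instance Definition _ := [isSub for ell2_fun].
HB.instance Definition _ := [Choice of ell2 by <:].
HB.instance Definition _ := [SubChoice_isSubLmodule of ell2 by <:].

Definition ell2_norm (u : ell2) : R :=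
  Num.sqrt (fine (\esum_(n in [set: int]) (Normc.normc (u n) ^+ 2)%:E)).

Definition bounded_op (T : ell2 -> ell2) : Prop :=
  exists M : R, forall u, ell2_norm (T u) <= M * ell2_norm u.

Definition resolvent_set (T : {linear ell2 -> ell2}) : set R[i] :=
  [set z | exists S : {linear ell2 -> ell2},
     [/\ bounded_op S,
         forall u, S (T u - z *: u) = u &
         forall u, T (S u) - z *: S u = u]].

Definition spectrum (T : {linear ell2 -> ell2}) : set R[i] :=
  ~` resolvent_set T.

Definition schrodinger_fun (y : full_shift) (u : int -> R[i]^o) : int -> R[i]^o :=
  fun n => u (n - 1) + u (n + 1) + (y n)%:R * u n.

Lemma schrodinger_square_summable y u :
  u \in square_summable -> schrodinger_fun y u \in square_summable.
Proof.
move=> su.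
have tr k : (fun n => u (n + k)) \in square_summable.
  move/asboolP : su => su; apply/asboolP; move: su; rewrite /summable.
  rewrite (@reindex_esum _ _ _ [set: int] [set: int] (fun n => n + k)) //.
  split=> // [m n _ _ /addIr//|n _].
  by exists (n - k) => //; rewrite subrK.
have yu : (fun n => (y n)%:R * u n) \in square_summable.
  have sq0 n : 0 <= Normc.normc (u n) ^+ 2 by exact: sqr_ge0.
  move/asboolP : su => su; apply/asboolP.
  apply: (@summable_le_lincomb _ 1 0 _ _ _ _ _ sq0 sq0) => // n.
  rewrite sqr_ge0 /= mul1r mul0r addr0.
  by case: (y n); rewrite ?mul1r// mul0r Normc.normc0 expr0n /= sqr_ge0.
exact: (rpredD (rpredD (tr (-1)) (tr 1)) yu).
Qed.

Definition schrodinger (y : full_shift) (u : ell2) : ell2 :=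
  Ell2 (schrodinger_square_summable y (valP u)).

Lemma schrodinger_is_linear y : linear (schrodinger y).
Proof.
move=> a u v; apply/val_inj/funext => n.
change (a * u (n - 1) + v (n - 1) + (a * u (n + 1) + v (n + 1)) +
        (y n)%:R * (a * u n + v n) =
        a * (u (n - 1) + u (n + 1) + (y n)%:R * u n) +
        (v (n - 1) + v (n + 1) + (y n)%:R * v n) :> R[i]).
ring.
Qed.

HB.instance Definition _ y :=
  GRing.isLinear.Build _ _ _ _ (schrodinger y) (schrodinger_is_linear y).

End Ell2.

Arguments schrodinger R y u : clear implicits.

(* Main.v *)
From HB Require Import structures.
From mathcomp Require Import all_boot all_order all_algebra.
From mathcomp Require Import all_classical all_reals all_analysis.
From mathcomp Require Import measurable_realfun complex.
Require Import Defs.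
From mathcomp Require Import ring lra zify.
Set Implicit Arguments.
Unset Strict Implicit.
Unset Printing Implicit Defensive.
Import Order.TTheory GRing.Theory Num.Theory.
Import numFieldNormedType.Exports.
Local Open Scope classical_set_scope.
Local Open Scope ring_scope.
Local Open Scope complex_scope.

(** The subshift is built from two words [s k], [t k] of equal length at each level
    [k].  The words of level [k + 1] are concatenations of those of level [k], and
    contain all concatenations of [N k] of them; the subshift consists of the
    sequences all of whose windows occur in some [s k].  Such a hierarchy gives a minimal
    subshift ([hierarchy_minimal]) with at least [2 ^ N k] words of length
    [N k * size (s k)] ([hierarchy_complexity]).  As the blocks of level [k] are known
    before [N k] is chosen and [a] grows subexponentially, [N k] can be taken so large
    that the ratio in the statement exceeds [k] ([subexp_scale]).

    Any such growth is compatible with a spectrum of measure zero, because long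
    words can be made hyperbolic at most energies ([stage]).  At all but countably many
    energies some concatenation of [s k] and [t k] has a transfer matrix with trace
    outside [-2, 2]: if neither word does, both matrices are elliptic and do not
    commute, and their group commutator has trace greater than [2]
    ([noncommuting_hyperbolic]).  Finitely many such concatenations serve all
    energies but a small set, and they, and any word that contains all concatenations
    of [N k] blocks, can be joined into one word [A] that is still hyperbolic at most
    energies, since powers of a hyperbolic word dominate whatever they are multiplied by, unless
    a nonzero polynomial in the energy vanishes ([join_words]).  The new words are
    [A^(n+1)] and [A^n D] for a word [D] other than [A] and of the same length.  For
    large [n] both transfer matrices increase one quadratic form
    ([hyperbolic_increases]); summing these gains along a concatenation bounds a
    finitely supported vector [v] by [(H - E) v] ([gains_not_apspec]).  So the set of
    energies in the spectrum of some potential that reads as a concatenation of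
    the new words has small measure, and the spectra of all sequences of the
    subshift lie in it ([spec_sub_blocks]).

    The spectrum is handled as the set [spec y] of the energies with finitely supported
    real approximate eigenvectors, and identified with the spectrum of the operator on
    square summable sequences by solving [((H - E)^2 + eta^2) u = g] with a Neumann
    series ([spectrum_spec]).  It depends on the windows of [y] only, hence is the same for all
    [y] ([spec_recurs]).  It is nonempty and compact, and null, hence totally
    disconnected.  It has no isolated points ([spec_no_isolated]): an isolated point
    would be an eigenvalue with an eigenvector near every approximate one, and by
    recurrence these can be centred at two distant places, whereas square summable
    eigenvectors for one energy are parallel, their Wronskian being zero. *)

(** * Matrices of determinant one and traces of their powers *)

(** Four scalars instead of a square matrix of size two: products then reduce by
    computation, and [ring] proves identities between entries over any ring, in
    particular over polynomials in the energy. *)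
Record mat2 (K : Type) := Mat2 { e11 : K; e12 : K; e21 : K; e22 : K }.

Section Mat2.
Variable K : comNzRingType.
Implicit Types A B C : mat2 K.

Definition mmul A B := Mat2
  (e11 A * e11 B + e12 A * e21 B) (e11 A * e12 B + e12 A * e22 B)
  (e21 A * e11 B + e22 A * e21 B) (e21 A * e12 B + e22 A * e22 B).
Definition mone : mat2 K := Mat2 1 0 0 1.
Definition mtr A := e11 A + e22 A.
Definition mdet A := e11 A * e22 A - e12 A * e21 A.
Definition mpow A n := iter n (mmul A) mone.

Lemma mat2P A B : e11 A = e11 B -> e12 A = e12 B -> e21 A = e21 B ->
  e22 A = e22 B -> A = B.
Proof. by case: A => a b c d; case: B => x y z t /= -> -> -> ->. Qed.

Lemma mmulA A B C : mmul A (mmul B C) = mmul (mmul A B) C.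
Proof. apply: mat2P => /=; ring. Qed.

Lemma mmul1 A : mmul mone A = A.
Proof. apply: mat2P => /=; ring. Qed.

Lemma mmulr1 A : mmul A mone = A.
Proof. apply: mat2P => /=; ring. Qed.

Lemma mdetM A B : mdet (mmul A B) = mdet A * mdet B.
Proof. rewrite /mdet /=; ring. Qed.

Lemma mdet1 : mdet mone = 1.
Proof. rewrite /mdet /=; ring. Qed.

Lemma mpowD A m n : mpow A (m + n) = mmul (mpow A m) (mpow A n).
Proof. by elim: m => [|m IH]; rewrite ?mmul1 //= IH mmulA. Qed.

Lemma mpow1 A : mpow A 1 = A.
Proof. exact: mmulr1. Qed.

Lemma mtr_pow0 A : mtr (mpow A 0) = 2.
Proof. rewrite /mtr /=; ring. Qed.

(** The Cayley-Hamilton theorem, in the form in which traces use it. *)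
Lemma mtr_pow_rec A X n : mdet A = 1 ->
  mtr (mmul X (mpow A n.+2)) =
  mtr A * mtr (mmul X (mpow A n.+1)) - mtr (mmul X (mpow A n)).
Proof.
rewrite /mpow !iterS; move: (iter n _ _) => {n} B.
case: A B X => [a b c d] [x y z w] [p q r s] /[dup] dA; rewrite /mdet /= => dA'.
suff -> : mtr (mmul (Mat2 p q r s) (Mat2 x y z w)) =
    (a * d - b * c) * mtr (mmul (Mat2 p q r s) (Mat2 x y z w)).
  by rewrite /mtr /=; ring.
by rewrite dA' mul1r.
Qed.

(** By the Cayley-Hamilton theorem the powers of a matrix of determinant [1] and
    trace [t] are combinations of the matrix itself and the identity; the
    coefficients are, up to sign and shift, Chebyshev polynomials of the second
    kind in [t / 2]. *)
Fixpoint cheb_pair (t : K) n : K * K :=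
  if n is n'.+1 then let: (a, b) := cheb_pair t n' in (a * t + b, - a)
  else (0, 1).
Definition cheb_al t n := (cheb_pair t n).1.
Definition cheb_be t n := (cheb_pair t n).2.

Lemma mpow_cheb A n : mdet A = 1 ->
  mpow A n = Mat2 (cheb_al (mtr A) n * e11 A + cheb_be (mtr A) n)
                  (cheb_al (mtr A) n * e12 A) (cheb_al (mtr A) n * e21 A)
                  (cheb_al (mtr A) n * e22 A + cheb_be (mtr A) n).
Proof.
move=> dA; elim: n => [|n IH]; first by apply: mat2P; rewrite /cheb_al /cheb_be /=; ring.
rewrite /mpow iterS -/(mpow A n) IH /cheb_al /cheb_be /=.
case: (cheb_pair _ n) => x y {IH} /=; case: A dA => a b c d; rewrite /mdet /= => dA.
have xd : - x = - x * (a * d - b * c) by rewrite dA mulr1.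
by apply: mat2P => /=; [rewrite xd | | | rewrite xd]; rewrite /mtr /=; ring.
Qed.
End Mat2.
Arguments mpow : simpl never.

(** The quadratic form preserved by the recurrence [u n.+2 = t * u n.+1 - u n] that
    the traces of [X Z^n] satisfy when [t] is the trace of [Z]. *)
Definition tquad (K : comNzRingType) (t x y : K) := x ^+ 2 + y ^+ 2 - t * x * y.

Section Traces.
Variable K : comNzRingType.
Implicit Types A X Z : mat2 K.

Lemma mtr_pow_cheb Z n : mdet Z = 1 ->
  mtr (mpow Z n) = cheb_al (mtr Z) n * mtr Z + 2 * cheb_be (mtr Z) n.
Proof. by move=> dZ; rewrite mpow_cheb //= /mtr /=; ring. Qed.

Lemma mtr_mul_pow_cheb X Z n : mdet Z = 1 ->
  mtr (mmul X (mpow Z n)) =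
  cheb_al (mtr Z) n * mtr (mmul X Z) + cheb_be (mtr Z) n * mtr X.
Proof. by move=> dZ; rewrite mpow_cheb //= /mtr /=; ring. Qed.

Lemma cheb_det t n :
  cheb_al t n ^+ 2 + cheb_al t n * cheb_be t n * t + cheb_be t n ^+ 2 = 1 :> K.
Proof.
rewrite /cheb_al /cheb_be; elim: n => [|n] /=; first by ring.
by case: (cheb_pair t n) => a b /= <-; ring.
Qed.

(** Replacing [Z] by [Z^n] multiplies the discriminant and, in [tquad_pow], the
    invariant by the same square: this is how ellipticity and lower bounds on the
    invariant pass to powers. *)
Lemma mtr_pow_disc Z n : mdet Z = 1 ->
  4 - mtr (mpow Z n) ^+ 2 = cheb_al (mtr Z) n ^+ 2 * (4 - mtr Z ^+ 2).
Proof.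
move=> dZ; rewrite mtr_pow_cheb //.
have := cheb_det (mtr Z) n; move: (cheb_al _ _) (cheb_be _ _) => a b; move: (mtr Z) => t h.
rewrite [X in X - _](_ : _ = 4 * (a ^+ 2 + a * b * t + b ^+ 2)); last by rewrite h mulr1.
ring.
Qed.

Lemma tquad_pow X Z n : mdet Z = 1 ->
  tquad (mtr (mpow Z n)) (mtr X) (mtr (mmul X (mpow Z n))) =
  cheb_al (mtr Z) n ^+ 2 * tquad (mtr Z) (mtr X) (mtr (mmul X Z)).
Proof.
move=> dZ; rewrite mtr_pow_cheb // mtr_mul_pow_cheb //.
have := cheb_det (mtr Z) n; move: (cheb_al _ _) (cheb_be _ _) => a b; move: (mtr Z) => t h.
move: (mtr X) (mtr (mmul X Z)) => x z; rewrite /tquad.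
rewrite [in LHS](_ : x ^+ 2 = x ^+ 2 * (a ^+ 2 + a * b * t + b ^+ 2)); last by rewrite h mulr1.
ring.
Qed.

Lemma tquad_shift X Z n : mdet Z = 1 ->
  tquad (mtr Z) (mtr (mmul X (mpow Z n))) (mtr (mmul X (mpow Z n.+1))) =
  tquad (mtr Z) (mtr X) (mtr (mmul X Z)).
Proof.
move=> dZ; elim: n => [|n <-]; first by rewrite mmulr1 mpow1.
by rewrite (mtr_pow_rec _ _ dZ) /tquad; ring.
Qed.

Lemma tquad_pow_shift X Z n j : mdet Z = 1 ->
  tquad (mtr (mpow Z j)) (mtr (mmul X (mpow Z n))) (mtr (mmul X (mpow Z (n + j)%N))) =
  tquad (mtr (mpow Z j)) (mtr X) (mtr (mmul X (mpow Z j))).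
Proof.
move=> dZ; rewrite mpowD mmulA !tquad_pow //; congr (_ * _).
by rewrite -mmulA -[X in mmul (mpow Z n) X]mpow1 -mpowD addn1 tquad_shift.
Qed.
End Traces.

Section RealTraces.
Variable R : realType.
Implicit Types A X Z : mat2 R.

Lemma expr_unbounded (r K : R) : 1 < r -> exists n, K < r ^+ n.
Proof.
move=> r1; have h : forall n, 1 + n%:R * (r - 1) <= r ^+ n.
  elim=> [|n IH]; first by rewrite mul0r addr0.
  rewrite exprS -natr1; have n0 : 0 <= n%:R :> R by [].
  have h1 : r * (1 + n%:R * (r - 1)) <= r * r ^+ n by rewrite ler_pM2l //; lra.
  by have h2 : 0 <= n%:R * (r - 1) * (r - 1); [rewrite !mulr_ge0 //; lra | lra].
have r0 : 0 < r - 1 by rewrite subr_gt0.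
have K0 : 0 <= `|K| / (r - 1) by rewrite divr_ge0 // ltW.
exists (Num.bound (`|K| / (r - 1))); apply: lt_le_trans (h _).
have := archi_boundP K0; rewrite ltr_pdivrMr // => h1.
by have := ler_norm K; lra.
Qed.

(** Either two consecutive terms grow, and then all later ones grow
    geometrically; or the sequence decreases for ever, hence geometrically to
    [0], and so does its invariant. *)
Lemma trace_rec_unbounded (t : R) (u : nat -> R) :
    (forall n, u n.+2 = t * u n.+1 - u n) -> 2 < `|t| ->
    tquad t (u 0) (u 1) != 0 ->
  forall K, exists n0, forall n, (n0 <= n)%N -> K < `|u n|.
Proof.
move=> urec t2 q0 K.
have qn n : tquad t (u n) (u n.+1) = tquad t (u 0) (u 1).
  by elim: n => // n <-; rewrite urec /tquad; ring.
pose r := `|t| - 1; have r1 : 1 < r by rewrite /r; lra.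
have lo n : `|t| * `|u n.+1| <= `|u n| + `|u n.+2|.
  rewrite -normrM (_ : t * u n.+1 = u n + u n.+2) ?ler_normD //.
  by rewrite urec; ring.
have [[n un]|no] := pselect (exists n, `|u n| <= `|u n.+1|).
  have g m : `|u (n + m)%N| <= `|u (n + m)%N.+1| /\ r ^+ m * `|u n.+1| <= `|u (n + m)%N.+1|.
    elim: m => [|m [IH1 IH2]]; first by split; [rewrite addn0|rewrite addn0 expr0 mul1r lexx].
    have h := lo (n + m)%N; rewrite addnS.
    have h2 : r * `|u (n + m)%N.+1| <= `|u (n + m)%N.+2| by rewrite /r; lra.
    split; first by have := normr_ge0 (u (n + m).+1); nra.
    by rewrite exprS -mulrA; apply: le_trans h2; rewrite ler_pM2l //; lra.
  have u0 : 0 < `|u n.+1|.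
    rewrite normr_gt0; apply: contra q0 => /eqP u1; rewrite -(qn n).
    move: un; rewrite u1 normr0 normr_le0 => /eqP ->.
    by apply/eqP; rewrite /tquad; ring.
  have [m rm] := expr_unbounded (K / `|u n.+1|) r1.
  exists (n + m)%N.+1 => k /subnKC <-; rewrite addSn -addnA.
  apply: lt_le_trans (proj2 (g _)).
  rewrite -ltr_pdivrMr //; apply: lt_le_trans rm _.
  by apply: ler_weXn2l; [lra | rewrite leq_addr].
exfalso.
have dec n : `|u n.+1| < `|u n|.
  by rewrite ltNge; apply/negP => h; apply: no; exists n.
have g n : r ^+ n * `|u n| <= `|u 0|.
  elim: n => [|n IH]; first by rewrite expr0 mul1r.
  apply: le_trans IH; rewrite exprSr -mulrA ler_pM2l ?exprn_gt0 //; last by lra.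
  by have := lo n; have := dec n.+1; rewrite /r; lra.
pose Q := `|tquad t (u 0) (u 1)|.
have Q0 : 0 < Q by rewrite normr_gt0.
pose c := 2 + `|t|.
have Qn n : Q <= c * `|u n| ^+ 2.
  rewrite /Q -(qn n) /tquad.
  have d := dec n; have d0 := normr_ge0 (u n.+1).
  rewrite (le_trans (ler_normB _ _)) // (le_trans (lerD (ler_normD _ _) (lexx _))) //.
  rewrite !normrX !normrM /c.
  have t0 := normr_ge0 t.
  have h1 : `|u n.+1| ^+ 2 <= `|u n| ^+ 2 by rewrite !expr2; nra.
  have h2 : `|t| * `|u n| * `|u n.+1| <= `|t| * `|u n| ^+ 2.
    by rewrite -mulrA expr2 ler_wpM2l // ler_wpM2l // ltW.
  by rewrite mulrDl; lra.
have [m rm] := expr_unbounded (c * `|u 0| ^+ 2 / Q) r1.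
have c0 : 0 < c by rewrite /c; lra.
have := g m; have := Qn m; have := normr_ge0 (u m); move: rm.
rewrite ltr_pdivrMr //.
have : 1 <= r ^+ m by rewrite exprn_ege1 // ltW.
have := normr_ge0 (u 0).
move: (r ^+ m) (`|u m|) (`|u 0|) => p x y y0 p1 h x0 h1 h2.
have h3 : p * (p * x ^+ 2) <= y ^+ 2 by rewrite mulrA -expr2 -exprMn lerXn2r // nnegrE; nra.
have h4 : p * Q <= c * (p * x ^+ 2) by rewrite [c * _]mulrCA ler_pM2l //; lra.
have h5 : p * x ^+ 2 <= y ^+ 2.
  by apply: le_trans h3; rewrite ler_peMl // mulr_ge0 ?sqr_ge0 //; lra.
by have : c * (p * x ^+ 2) <= c * y ^+ 2; [rewrite ler_pM2l | lra].
Qed.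

Lemma mtr_pow_unbounded X Z : mdet Z = 1 -> 2 < `|mtr Z| ->
    tquad (mtr Z) (mtr X) (mtr (mmul X Z)) != 0 ->
  forall K, exists n0, forall n, (n0 <= n)%N -> K < `|mtr (mmul X (mpow Z n))|.
Proof.
move=> dZ t2 q; apply: (trace_rec_unbounded _ t2) => [n|].
  exact: mtr_pow_rec.
by rewrite mmulr1 mpow1.
Qed.

Lemma norm_le2E (x : R) : (`|x| <= 2) = (0 <= 4 - x ^+ 2).
Proof.
rewrite -(real_normK (num_real x)); have := normr_ge0 x; move: `|x| => y y0.
by apply/idP/idP; nra.
Qed.

Lemma norm_lt2E (x : R) : (`|x| < 2) = (0 < 4 - x ^+ 2).
Proof.
rewrite -(real_normK (num_real x)); have := normr_ge0 x; move: `|x| => y y0.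
by apply/idP/idP; nra.
Qed.

Lemma mtr_pow_le2 Z n : mdet Z = 1 -> `|mtr Z| <= 2 -> `|mtr (mpow Z n)| <= 2.
Proof.
by move=> dZ; rewrite !norm_le2E mtr_pow_disc // => h; rewrite mulr_ge0 ?sqr_ge0.
Qed.

(** Two traces at distance [j] enter a definite form, whose value does not depend on
    [n] and is at least a multiple of the square of the trace of [X]. *)
Lemma small_traces_bound X Z n j : mdet Z = 1 -> `|mtr Z| <= 2 ->
  `|mtr (mmul X (mpow Z n))| <= 2 -> `|mtr (mmul X (mpow Z (n + j)%N))| <= 2 ->
  (1 - `|mtr (mpow Z j)| / 2) * mtr X ^+ 2 <= 16.
Proof.
move=> dZ z2 h1 h2; have := mtr_pow_le2 j dZ z2.
have := tquad_pow_shift X n j dZ; rewrite /tquad.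
move: (mtr X) (mtr (mmul X (mpow Z j))) h1 h2 (mtr (mpow Z j)) => x x'.
move: (mtr _) (mtr _) => u v u2 v2 y e y2.
have A : u ^+ 2 + v ^+ 2 - y * u * v <= 16.
  have := ler_norm (- (y * u * v)); rewrite normrN !normrM.
  have : `|y| * `|u| * `|v| <= 2 * 2 * 2.
    by rewrite !ler_pM // mulr_ge0.
  by move: u2 v2; rewrite !norm_le2E; lra.
have B : (1 - `|y| / 2) * (x ^+ 2 + x' ^+ 2) <= x ^+ 2 + x' ^+ 2 - y * x * x'.
  have : y * x * x' <= `|y| * (x ^+ 2 + x' ^+ 2) / 2.
    apply: le_trans (ler_norm _) _; rewrite -mulrA normrM -mulrA ler_wpM2l //.
    rewrite normrM -(real_normK (num_real x)) -(real_normK (num_real x')).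
    by have := sqr_ge0 (`|x| - `|x'|); lra.
  by lra.
have : 0 <= (1 - `|y| / 2) * x' ^+ 2 by rewrite mulr_ge0 ?sqr_ge0 //; lra.
by lra.
Qed.
End RealTraces.

(** * Elliptic matrices *)

Section Elliptic.
Variable R : realType.
Implicit Types A B : mat2 R.

Lemma dirichlet_approx (x : R) (K : nat) : (0 < K)%N ->
  exists (n : nat) (z : int), `|n.+1%:R * x - z%:~R| < K%:R^-1.
Proof.
move=> K0; have Kp : 0 < K%:R :> R by rewrite ltr0n.
pose fr (i : nat) := i%:R * x - (Num.floor (i%:R * x))%:~R.
have fr01 i : 0 <= fr i < 1.
  by have := floor_itv (i%:R * x); rewrite intrD /fr; lra.
pose box (i : 'I_K.+1) : 'I_K := insubd (Ordinal K0) (Num.trunc (K%:R * fr i)).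
have boxE i : box i = Num.trunc (K%:R * fr i) :> nat.
  rewrite val_insubd ifT //.
  have /andP[f0 f1] := fr01 i.
  have Kf : 0 <= K%:R * fr i by rewrite mulr_ge0 // ltW.
  rewrite -(ltr_nat R); apply: le_lt_trans (proj1 (andP (truncn_itv Kf))) _.
  by rewrite gtr_pMr.
have /injectivePn[i [j ij eqb]] : ~~ injectiveb box.
  by apply/injectiveP => /leq_card; rewrite !card_ord ltnn.
wlog lij : i j ij eqb / (i < j)%N.
  move=> W; have [h|h|h] := ltngtP i j; first exact: W ij eqb h.
    by apply: W (esym eqb) h; rewrite eq_sym.
  by rewrite (val_inj h) eqxx in ij.
exists (j - i.+1)%N, (Num.floor (j%:R * x) - Num.floor (i%:R * x)).
rewrite subnSK // natrB ?(ltnW lij) // intrB.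
rewrite (_ : _ - _ = fr j - fr i); last by rewrite /fr; ring.
have tr k : (box k)%:R <= K%:R * fr k < (box k).+1%:R.
  by rewrite boxE; apply: truncn_itv; rewrite mulr_ge0 ?(ltW Kp) //; case/andP: (fr01 k).
have := tr i; have := tr j; rewrite eqb -natr1 => h1 h2.
by rewrite -(ltr_pM2l Kp) divff ?gt_eqF // -{1}(gtr0_norm Kp) -normrM ltr_norml; lra.
Qed.

Lemma cos_periodic_int (a : R) (z : int) : cos (a + (pi *+ 2) *~ z) = cos a.
Proof.
case: z => n; first exact: periodicn (@cosD2pi R) _ _.
rewrite NegzE mulrNz -[RHS](congr1 cos (subrK (pi *+ 2 *+ n.+1) a)).
by rewrite (periodicn (@cosD2pi R)).
Qed.

Lemma mtr_pow_cos A th n : mdet A = 1 -> mtr A = 2 * cos th ->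
  mtr (mpow A n) = 2 * cos (n%:R * th).
Proof.
move=> dA tA.
suff : mtr (mpow A n) = 2 * cos (n%:R * th) /\
       mtr (mpow A n.+1) = 2 * cos (n.+1%:R * th) by case.
elim: n => [|n [IH1 IH2]]; first by rewrite mtr_pow0 mpow1 mul0r cos0 mul1r mulr1.
split => //; rewrite -(mmul1 (mpow A n.+2)) mtr_pow_rec // !mmul1 IH1 IH2 tA.
rewrite -!natr1 (_ : (n%:R + 1 + 1) * th = (n%:R + 1) * th + th); last by ring.
rewrite (_ : n%:R * th = (n%:R + 1) * th - th); last by ring.
rewrite cosB cosD; ring.
Qed.

(** The traces of the powers are [2 cos (n th)], and Dirichlet's theorem brings
    some multiple of [th] close to a multiple of the period. *)
Lemma elliptic_return A (eta : R) : mdet A = 1 -> `|mtr A| <= 2 -> 0 < eta ->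
  exists n, 2 - eta < mtr (mpow A n.+1).
Proof.
move=> dA tA eta0; pose th := acos (mtr A / 2).
have tAE : mtr A = 2 * cos th.
  rewrite /th acosK; first by field.
  by move: tA; rewrite ler_norml in_itv /=; lra.
have := @continuous_cos R 0 => /cvgr_dist_lt /(_ (eta / 2)).
rewrite cos0 divr_gt0 // => /(_ isT).
move=> /nbhs_ballP[d /= d0 dP].
have pi2 : 0 < pi *+ 2 :> R by rewrite pmulrn_lgt0 // pi_gt0.
have [K KP] : exists K, pi *+ 2 / d < K.+1%:R :> R.
  exists (Num.bound (pi *+ 2 / d)); apply: lt_le_trans (archi_boundP _) _.
    by rewrite divr_ge0 // ltW.
  by rewrite ler_nat.
have [n [z nz]] := dirichlet_approx (th / (pi *+ 2)) (ltn0Sn K).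
exists n; rewrite (mtr_pow_cos n.+1 dA tAE).
rewrite (_ : n.+1%:R * th = (n.+1%:R * th - (pi *+ 2) *~ z) + (pi *+ 2) *~ z); last by rewrite subrK.
rewrite cos_periodic_int; set w := n.+1%:R * th - _.
have : `|1 - cos w| < eta / 2.
  apply: dP; rewrite /ball /= sub0r normrN.
  have -> : w = (pi *+ 2) * (n.+1%:R * (th / (pi *+ 2)) - z%:~R).
    rewrite /w; move: (pi *+ 2) pi2 => p p0; rewrite mulrBr mulrzr; congr (_ - _).
    by rewrite mulrCA [p * _]mulrC divfK ?gt_eqF.
  rewrite normrM gtr0_norm // mulrC -ltr_pdivlMr //; apply: lt_trans nz _.
  by rewrite -[d / _]invf_div ltf_pV2 // posrE ?divr_gt0 ?ltr0n.
by rewrite ltr_norml; lra.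
Qed.

(** The discriminant of the power is small, whereas the one of the matrix is not:
    this leaves no room for the coefficient of the matrix, and the trace then
    determines the coefficient of the identity. *)
Lemma elliptic_return_cheb A (eta : R) : mdet A = 1 -> `|mtr A| < 2 -> 0 < eta ->
  exists n, `|cheb_al (mtr A) n.+1| <= eta /\ `|cheb_be (mtr A) n.+1 - 1| <= eta.
Proof.
move=> dA tA eta0; pose c := 4 - mtr A ^+ 2.
have c0 : 0 < c by rewrite -norm_lt2E.
pose e := Num.min eta (eta ^+ 2 * c / 16).
have e0 : 0 < e by rewrite lt_min eta0 divr_gt0 // mulr_gt0 // exprn_gt0.
have [n nP] := elliptic_return dA (ltW tA) e0.
exists n.
have y2 := mtr_pow_le2 n.+1 dA (ltW tA).
have := mtr_pow_disc n.+1 dA; have := mtr_pow_cheb n.+1 dA.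
move: (cheb_al _ _) (cheb_be _ _) => a b; rewrite -/c => yE yc.
have e1 : e <= eta by rewrite ge_min lexx.
have e2 : e <= eta ^+ 2 * c / 16 by rewrite ge_min lexx orbT.
have a2 : `|a| <= eta / 2.
  have : a ^+ 2 <= (eta / 2) ^+ 2.
    rewrite -(ler_pM2r c0) -yc.
    by move: y2; rewrite ler_norml => /andP[_ y2]; move: nP y2; move: (mtr (mpow _ _)) => y; nra.
  by rewrite -(real_normK (num_real a)) ler_sqr ?nnegrE //; lra.
split; first by lra.
have : `|a * mtr A| <= eta / 2 * 2 by rewrite normrM ler_pM // ltW.
by move: nP y2; rewrite yE !ler_norml; lra.
Qed.

(** The trace of the group commutator minus [2] is the opposite of the determinant
    of [AB - BA].  This is a traceless matrix orthogonal to [A] for the trace form;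
    on such matrices the determinant is negative definite, because the
    discriminant of [A] is negative. *)
Lemma commutator_trace_gt2 (a b c d e f g h : R) :
    a * d - b * c = 1 -> e * h - f * g = 1 -> `|a + d| < 2 ->
    mmul (Mat2 a b c d) (Mat2 e f g h) <> mmul (Mat2 e f g h) (Mat2 a b c d) ->
  2 < mtr (mmul (mmul (Mat2 a b c d) (Mat2 e f g h))
                (mmul (Mat2 d (- b) (- c) a) (Mat2 h (- f) (- g) e))).
Proof.
move=> dA dB tA nC; rewrite norm_lt2E in tA.
pose x := b * g - c * f; pose y := (a - d) * f - b * (e - h).
pose w := c * (e - h) - (a - d) * g.
have lin : (a - d) * x + b * w + c * y = 0 by rewrite /x /y /w; ring.
have -> : mtr (mmul (mmul (Mat2 a b c d) (Mat2 e f g h))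
                (mmul (Mat2 d (- b) (- c) a) (Mat2 h (- f) (- g) e))) =
          2 * ((a * d - b * c) * (e * h - f * g)) + (x ^+ 2 + y * w).
  by rewrite /x /y /w /mtr /=; ring.
rewrite dA dB !mulr1 ltrDl ltNge; apply/negP => le0.
have D : (a - d) ^+ 2 + 4 * (b * c) < 0.
  have -> : (a - d) ^+ 2 + 4 * (b * c) = (a + d) ^+ 2 - 4 * (a * d - b * c) by ring.
  by rewrite dA; lra.
have bc : b * c < 0 by have := sqr_ge0 (a - d); lra.
have key : 4 * (b * c) * (x ^+ 2 + y * w) =
    ((a - d) ^+ 2 + 4 * (b * c)) * x ^+ 2 - (b * w - c * y) ^+ 2.
  have e1 : (a - d) * x = - (b * w + c * y) by lra.
  have e2 : ((a - d) * x) ^+ 2 = (b * w + c * y) ^+ 2 by rewrite e1 sqrrN.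
  by clearbody x y w; lra.
have lhs : 0 <= 4 * (b * c) * (x ^+ 2 + y * w) by rewrite mulr_le0 //; lra.
have r1 : ((a - d) ^+ 2 + 4 * (b * c)) * x ^+ 2 <= 0 by rewrite mulr_le0_ge0 ?sqr_ge0 // ltW.
have r2 := sqr_ge0 (b * w - c * y).
have /eqP x0 : ((a - d) ^+ 2 + 4 * (b * c)) * x ^+ 2 == 0 by apply/eqP; lra.
have /eqP z0 : (b * w - c * y) ^+ 2 == 0 by apply/eqP; lra.
move: x0 z0 => /eqP; rewrite mulf_eq0 lt_eqF //= sqrf_eq0 => /eqP x0.
move=> /eqP; rewrite sqrf_eq0 => /eqP z0; rewrite x0 in lin.
have bw : b * w == 0 by apply/eqP; lra.
have cy : c * y == 0 by apply/eqP; lra.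
have b0 : b != 0 by apply: contraTneq bc => ->; rewrite mul0r ltxx.
have c0 : c != 0 by apply: contraTneq bc => ->; rewrite mulr0 ltxx.
move: bw cy; rewrite !mulf_eq0 (negPf b0) (negPf c0) /= => /eqP w0 /eqP y0.
by apply: nC; apply: mat2P => /=; move: x0 w0 y0; rewrite /x /w /y; lra.
Qed.

(** The group commutator is hyperbolic, but inverses of transfer matrices are not
    transfer matrices of words.  They are replaced by powers that precede a return
    close to the identity. *)
Lemma noncommuting_hyperbolic A B : mdet A = 1 -> mdet B = 1 ->
    `|mtr A| < 2 -> `|mtr B| < 2 -> mmul A B <> mmul B A ->
  exists m n, 2 < `|mtr (mmul (mmul A B) (mmul (mpow A m) (mpow B n)))|.
Proof.
move=> dA dB tA tB nC.
pose iA := Mat2 (e22 A) (- e12 A) (- e21 A) (e11 A).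
pose iB := Mat2 (e22 B) (- e12 B) (- e21 B) (e11 B).
pose k := mtr (mmul (mmul A B) (mmul iA iB)).
have k2 : 2 < k.
  rewrite /k /iA /iB; case: A B dA dB tA nC {tB iA iB k} => a b c d [e f g h].
  by move=> dA dB tA nC; apply: commutator_trace_gt2.
pose C := `|mtr (mmul A B)| + `|mtr A| + `|mtr B| + k + 4.
have C0 : 0 < C by rewrite /C; have := normr_ge0 (mtr (mmul A B)); have := normr_ge0 (mtr A);
  have := normr_ge0 (mtr B); lra.
pose eta := Num.min 1 ((k - 2) / (4 * C)).
have eta0 : 0 < eta by rewrite lt_min ltr01 divr_gt0 ?subr_gt0 // mulr_gt0.
have [m [ma mb]] := elliptic_return_cheb dA tA eta0.
have [n [na nb]] := elliptic_return_cheb dB tB eta0.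
exists m, n.
have inv (X : mat2 R) j : mdet X = 1 ->
  mpow X j = mmul (Mat2 (e22 X) (- e12 X) (- e21 X) (e11 X)) (mpow X j.+1).
  move=> dX; rewrite /mpow iterS -/(mpow X j) mmulA.
  rewrite (_ : mmul _ X = mone _) ?mmul1 //.
  by case: X dX => a b c d; rewrite /mdet /= => dX; apply: mat2P => /=; lra.
rewrite (inv A) // (inv B) // !mpow_cheb // -/iA -/iB.
move: (cheb_al _ _) (cheb_be _ _) ma mb => a a'.
move: (cheb_al _ _) (cheb_be _ _) na nb => b b' nb nb' na na'.
rewrite [mtr _](_ : _ = a * b * mtr (mmul A B) + a * b' * mtr A + a' * b * mtr B + a' * b' * k); last first.
  have -> : a * b * mtr (mmul A B) + a * b' * mtr A + a' * b * mtr B + a' * b' * k =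
    mdet A * mdet B * (a * b * mtr (mmul A B) + a * b' * mtr A + a' * b * mtr B) + a' * b' * k.
    by rewrite dA dB !mul1r.
  rewrite /k /iA /iB; clear; case: A B => e f g h [x y z w].
  by rewrite /mdet /mtr /=; ring.
have e1 : eta <= 1 by rewrite ge_min lexx.
have e2 : eta * (4 * C) <= k - 2 by rewrite -ler_pdivlMr ?mulr_gt0 // ge_min lexx orbT.
apply: lt_le_trans (ler_norm _).
have T1 : `|a * b * mtr (mmul A B)| <= eta * 1 * `|mtr (mmul A B)|.
  by rewrite !normrM; apply: ler_wpM2r => //; apply: ler_pM => //; lra.
have T2 : `|a * b' * mtr A| <= eta * 2 * `|mtr A|.
  rewrite !normrM; apply: ler_wpM2r => //; apply: ler_pM => //.
  by move: nb'; rewrite !ler_norml; lra.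
have T3 : `|a' * b * mtr B| <= 2 * eta * `|mtr B|.
  rewrite !normrM; apply: ler_wpM2r => //; apply: ler_pM => //.
  by move: na'; rewrite !ler_norml; lra.
have T4 : (1 - 2 * eta) * k <= a' * b' * k.
  apply: ler_wpM2r; first by lra.
  have : 1 - eta <= a' by move: na'; rewrite ler_norml; lra.
  have : 1 - eta <= b' by move: nb'; rewrite ler_norml; lra.
  by move=> h1 h2; have := sqr_ge0 eta; nra.
move: T1 T2 T3; rewrite !ler_norml => /andP[T1 _] /andP[T2 _] /andP[T3 _].
have := normr_ge0 (mtr (mmul A B)); have := normr_ge0 (mtr A).
have := normr_ge0 (mtr B) => p1 p2 p3.
have : 0 < k by lra.
move: e2; rewrite /C; move: T1 T2 T3 T4 p1 p2 p3.
move: `|mtr (mmul A B)| `|mtr A| `|mtr B| => u v r; clear -eta0.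
by move=> *; nra.
Qed.
End Elliptic.

(** * Transfer matrices of words *)

Section Words.
Variable K : comNzRingType.
Implicit Types (E : K) (w : seq bool).

Definition transfer E (c : bool) : mat2 K := Mat2 (E - c%:R) (- 1) 1 0.

(** Products run from right to left, since the first letter acts first. *)
Fixpoint wmat E w : mat2 K :=
  if w is c :: w' then mmul (wmat E w') (transfer E c) else mone K.

Lemma wmat_cat E w1 w2 : wmat E (w1 ++ w2) = mmul (wmat E w2) (wmat E w1).
Proof. by elim: w1 => [|c w1 IH] /=; rewrite ?mmulr1 // IH mmulA. Qed.

Lemma mdet_wmat E w : mdet (wmat E w) = 1.
Proof.
elim: w => [|c w IH]; first exact: mdet1.
by rewrite /= mdetM IH mul1r /mdet /=; ring.
Qed.
End Words.

Definition wpow (w : seq bool) n := flatten (nseq n w).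

Lemma wpowD w m n : wpow w (m + n) = wpow w m ++ wpow w n.
Proof. by rewrite /wpow nseqD flatten_cat. Qed.

Lemma size_wpow w n : size (wpow w n) = (n * size w)%N.
Proof. by elim: n => //= n IH; rewrite size_cat IH. Qed.

Lemma wmat_pow (K : comNzRingType) (E : K) w n : wmat E (wpow w n) = mpow (wmat E w) n.
Proof.
by elim: n => // n IH; rewrite -addn1 mpowD -IH mpow1 addnC wpowD wmat_cat /wpow /= cats0.
Qed.

Section TracePolynomials.
Variable R : realType.
Implicit Types (E : R) (w s t z : seq bool).

(** The transfer matrix as a polynomial in the energy: an algebraic relation that
    fails for polynomials holds at finitely many energies only. *)
Definition pmat w : mat2 {poly R} := wmat 'X w.
Definition meval E (A : mat2 {poly R}) : mat2 R :=
  Mat2 (e11 A).[E] (e12 A).[E] (e21 A).[E] (e22 A).[E].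

Lemma mevalM E A B : meval E (mmul A B) = mmul (meval E A) (meval E B).
Proof. by apply: mat2P; rewrite /= !hornerE. Qed.

Lemma meval_pmat E w : meval E (pmat w) = wmat E w.
Proof.
elim: w => [|c w IH]; first by apply: mat2P; rewrite /= ?hornerE.
rewrite /pmat /= mevalM -/(pmat w) IH; congr mmul.
by apply: mat2P; rewrite /= ?hornerE //; case: c; rewrite ?hornerE.
Qed.

Lemma mtr_wmat E w : mtr (wmat E w) = (mtr (pmat w)).[E].
Proof. by rewrite -meval_pmat /mtr /= hornerD. Qed.

Lemma size_mulXsubC (p : {poly R}) (c : R) : p != 0 -> size (p * ('X - c%:P)) = (size p).+1.
Proof. by move=> p0; rewrite size_Mmonic ?monicXsubC // size_XsubC addnS addn1. Qed.

Lemma size_pmat w : [/\ size (e11 (pmat w)) = (size w).+1,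
  (size (e12 (pmat w)) <= size w)%N, (size (e21 (pmat w)) <= size w)%N &
  (size (e22 (pmat w)) <= maxn 1 (size w))%N].
Proof.
elim: w => [|c w [h1 h2 h3 h4]]; first by rewrite /= ?size_poly1 ?size_poly0.
have Xc : 'X - c%:R = 'X - (c%:R : R)%:P :> {poly R} by case: c; rewrite ?polyC1 ?polyC0.
rewrite /= !mulr0 !addr0 !mulr1 !mulrN1 !size_polyN -/(pmat w) Xc h1; split => //.
- have s1 : size (e11 (pmat w) * ('X - (c%:R : R)%:P)) = (size w).+2.
    by rewrite size_mulXsubC ?h1 // -size_poly_eq0 h1.
  by rewrite size_polyDl s1 // ltnS (leq_trans h2).
- apply: leq_trans (size_polyD _ _) _; rewrite geq_max; apply/andP; split.
    have [->|e0] := eqVneq (e21 (pmat w)) 0; first by rewrite mul0r size_poly0.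
    by rewrite size_mulXsubC.
  by apply: leq_trans h4 _; rewrite geq_max leqnSn.
- by rewrite (leq_trans h3) // leq_max leqnSn orbT.
Qed.

Lemma size_mtr_pmat w : w != [::] -> size (mtr (pmat w)) = (size w).+1.
Proof.
move=> w0; have [h1 _ _ h4] := size_pmat w.
rewrite /mtr size_polyDl h1 // ltnS (leq_trans h4) // geq_max leqnn andbT.
by case: w w0 {h1 h4}.
Qed.

Lemma mtr_pmat_neq0 w : mtr (pmat w) != 0.
Proof.
have [->|w0] := eqVneq w [::]; last by rewrite -size_poly_eq0 size_mtr_pmat.
by rewrite /mtr /= -polyC1 -polyCD polyC_eq0 -(natrD _ 1 1) pnatr_eq0.
Qed.

Lemma mtr_pmat_neqC w (c : R) : w != [::] -> mtr (pmat w) - c%:P != 0.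
Proof.
move=> w0; rewrite -size_poly_eq0 size_polyDl size_mtr_pmat //.
by rewrite size_polyN (leq_ltn_trans (size_polyC_leq1 _)) // ltnS lt0n size_eq0.
Qed.

(** If the invariant vanished identically, the discriminant of [z] would be a
    square [h^2] of a polynomial; but then [tr z - h] and [tr z + h] would be
    constants, and so would be their half sum, the trace of a nonempty word. *)
Lemma tquad_pmat_neq0 w z : z != [::] ->
  tquad (mtr (pmat z)) (mtr (pmat w)) (mtr (mmul (pmat w) (pmat z))) != 0.
Proof.
move=> z0; set tz := mtr (pmat z); set tw := mtr (pmat w); set x := mtr _.
apply/eqP; rewrite /tquad => q0.
have sq : (2 * x - tz * tw) ^+ 2 = tw ^+ 2 * (tz ^+ 2 - 4).
  rewrite [RHS](_ : _ = tw ^+ 2 * (tz ^+ 2 - 4) + 4 * (tw ^+ 2 + x ^+ 2 - tz * tw * x)); last by rewrite q0 mulr0 addr0.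
  ring.
have tw0 : tw != 0 := mtr_pmat_neq0 w.
have : tw ^+ 2 %| (2 * x - tz * tw) ^+ 2 by rewrite sq dvdp_mulIl.
rewrite dvdp_pexp2r // => /dvdpP[h hE].
have {sq} h2 : h ^+ 2 = tz ^+ 2 - 4.
  apply: (mulfI (x := tw ^+ 2)); first by rewrite expf_neq0.
  by rewrite -sq hE exprMn mulrC.
have m4 : (tz - h) * (tz + h) = 4%:R%:P.
  by rewrite polyC_natr -[RHS](subKr (tz ^+ 2)) -h2; ring.
have n0 : (tz - h) * (tz + h) != 0 by rewrite m4 polyC_eq0 pnatr_eq0.
have : size ((tz - h) * (tz + h)) = 1%N by rewrite m4 size_polyC pnatr_eq0.
move: n0; rewrite mulf_eq0 negb_or => /andP[m0 p0].
rewrite size_mul // => sz.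
have [sm sp] : (size (tz - h)%R <= 1)%N /\ (size (tz + h)%R <= 1)%N.
  move: m0 p0 sz; rewrite -!size_poly_gt0.
  by move: (size (tz - h)%R) (size (tz + h)%R) => k l; lia.
have : (size ((tz - h) + (tz + h))%R <= 1)%N.
  by rewrite (leq_trans (size_polyD _ _)) // geq_max sm.
rewrite (_ : _ + _ = 2%:R *: tz); last by rewrite scaler_nat; ring.
by rewrite size_scale ?pnatr_eq0 // size_mtr_pmat // ltnS leqn0 size_eq0 (negPf z0).
Qed.

(** The degrees of the entries tell the first letter: only the entry at the upper
    left reaches the length of the word. *)
Lemma pmat_inj s t : size s = size t -> pmat s = pmat t -> s = t.
Proof.
elim: s t => [|c s IH] [|d t] //= [st].
rewrite /pmat /= -/(pmat s) -/(pmat t) => -[].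
rewrite !mulr0 !addr0 !mulrN1 !mulr1 => h11 /oppr_inj e1 h21 /oppr_inj e2.
have cd : c = d.
  have [hs _ _ _] := size_pmat s; have [_ h2 _ _] := size_pmat s.
  have [_ h3 _ _] := size_pmat t.
  have h : (d%:R - c%:R) * e11 (pmat s) = e12 (pmat t) - e12 (pmat s).
    have -> : e12 (pmat t) = e11 (pmat s) * ('X - c%:R) + e12 (pmat s) - e11 (pmat s) * ('X - d%:R).
      by rewrite h11 e1 addrC addKr.
    ring.
  have : (size (e12 (pmat t) - e12 (pmat s))%R <= size s)%N.
    by rewrite (leq_trans (size_polyD _ _)) // geq_max size_polyN h2 st h3.
  by rewrite -h; case: c d {h h11 h21} => -[] //;
    rewrite ?subr0 ?sub0r ?mulN1r ?mul1r ?size_polyN hs ltnn.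
rewrite cd in h11 h21 *; congr (_ :: _); apply: IH => //.
by apply: mat2P => //; [move: h11|move: h21]; rewrite ?e1 ?e2 => /addrI.
Qed.

Lemma pmat_noncomm s t : size s = size t -> s != t ->
  mmul (pmat s) (pmat t) <> mmul (pmat t) (pmat s).
Proof.
move=> st /eqP sNt; rewrite /pmat -!wmat_cat => /pmat_inj.
rewrite !size_cat addnC => /(_ erefl)/eqP; rewrite eqseq_cat ?st // => /andP[/eqP ts _].
exact/sNt/esym.
Qed.

Lemma poly_roots_countable (p : {poly R}) : p != 0 -> countable [set x | p.[x] = 0].
Proof.
move=> p0; apply: finite_set_countable.
have [n] := ubnP (size p); elim: n p p0 => // n IH p p0 pn.
have [[x px]|np] := pselect (exists x, p.[x] = 0); last first.
  by rewrite (_ : [set _ | _] = set0) // -subset0 => x px; apply: np; exists x.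
have /factor_theorem[q pq] : root p x by apply/rootP.
have q0 : q != 0 by apply: contra_neq p0; rewrite pq => ->; rewrite mul0r.
apply: (@sub_finite_set _ _ ([set x] `|` [set y | q.[y] = 0])).
  move=> y /=; rewrite pq !hornerE => /eqP; rewrite mulf_eq0 => /orP[/eqP|]; first by right.
  by rewrite subr_eq0 => /eqP; left.
rewrite finite_setU; split; first exact: finite_set1.
by apply: IH => //; move: pn; rewrite pq size_mulXsubC.
Qed.

Lemma wmat_noncomm_countable s t : size s = size t -> s != t ->
  countable [set E : R | mmul (wmat E s) (wmat E t) = mmul (wmat E t) (wmat E s)].
Proof.
move=> st sNt; have nc := pmat_noncomm st sNt.
pose D f := f (mmul (pmat s) (pmat t)) - f (mmul (pmat t) (pmat s)) : {poly R}.
have [f f0 fE] : exists2 f : forall K, mat2 K -> K, D (f _) != 0 &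
   forall A E, (f _ A).[E] = f _ (meval E A).
  apply: contrapT => no; apply: nc.
  have g (f : forall K, mat2 K -> K) : (forall A E, (f _ A).[E] = f _ (meval E A)) -> f _ (mmul (pmat s) (pmat t)) = f _ (mmul (pmat t) (pmat s)).
    move=> fE; apply/eqP; rewrite -subr_eq0; apply/negPn/negP => h.
    by apply: no; exists f.
  by apply: mat2P; [apply: (g e11)|apply: (g e12)|apply: (g e21)|apply: (g e22)].
apply: (sub_countable _ (poly_roots_countable f0)); apply: subset_card_le => E /= h.
by rewrite /D hornerD hornerN !fE !mevalM !meval_pmat h subrr.
Qed.
End TracePolynomials.

(** * Words hyperbolic off a small set of energies *)

Section SmallSets.
Variable R : realType.
Implicit Types (A B N : set R) (e : R).
Local Notation mu := (@lebesgue_measure R).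

(** An interval that contains the spectra of all the operators considered, which
    have norm at most [3]. *)
Definition energies : set R := `[-5, 5]%classic.

(** A measurable majorant is asked for, so that smallness passes to arbitrary
    subsets. *)
Definition small e A := exists U, [/\ measurable U, A `<=` U & (mu U <= e%:E)%E].

Lemma small_sub e A B : A `<=` B -> small e B -> small e A.
Proof. by move=> AB [U [mU BU Ue]]; exists U; split=> // x /AB/BU. Qed.

Lemma smallU e1 e2 A B : small e1 A -> small e2 B -> small (e1 + e2) (A `|` B).
Proof.
move=> [U [mU AU Ue]] [V [mV BV Ve]]; exists (U `|` V); split.
- exact: measurableU.
- exact: setUSS.
- by rewrite EFinD; apply: le_trans (measureU2 mu mU mV) _; exact: leeD.
Qed.

Lemma measurable_energies : measurable energies.
Proof. exact: measurable_itv. Qed.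

Lemma mu_energies : mu energies = 10%:E.
Proof.
rewrite /energies lebesgue_measure_itv /= lte_fin ifT; last by lra.
by rewrite -EFinB; congr EFin; lra.
Qed.

(** Continuity from above: a countable set is negligible, so pointwise eventual
    avoidance of the sets [X n] makes their tail unions small. *)
Lemma eventually_small (X : nat -> set R) N e : 0 < e ->
    (forall n, measurable (X n)) -> countable N ->
    (forall x, energies x -> ~ N x -> exists n0, forall n, (n0 <= n)%N -> ~ X n x) ->
  exists n0, small e (energies `&` \bigcup_(n in [set n | (n0 <= n)%N]) X n).
Proof.
move=> e0 mX cN ev.
pose F n0 := energies `&` \bigcup_(n in [set n | (n0 <= n)%N]) X n.
have mF n : measurable (F n).
  by apply: measurableI; [exact: measurable_energies | exact: bigcup_measurable].
have mbF : measurable (\bigcap_n F n) by exact: bigcap_measurable.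
have F0 : (mu (F 0%N) < +oo)%E.
  apply: (@le_lt_trans _ _ (mu energies)); last by rewrite mu_energies ltry.
  by apply: le_measure; rewrite ?inE; [exact: mF|exact: measurable_energies|exact: subIsetl].
have dF : nonincreasing_seq F.
  move=> m n mn; apply/subsetPset; apply: setIS => x [k /= nk Xk].
  by exists k => //=; exact: leq_trans nk.
have cap0 : mu (\bigcap_n F n) = 0%E.
  apply: (@subset_measure0 _ _ _ mu _ N) => //; last exact: countable_lebesgue_measure0.
    by apply: countable_measurable => // t; exact: measurable_set1.
  move=> x Fx; apply: contrapT => Nx.
  have [n0 n0P] := ev x (proj1 (Fx 0%N I)) Nx.
  by have [_ [k /= kn0 Xk]] := Fx n0 I; exact: n0P kn0 Xk.
have : (mu \o F) @ \oo --> 0%E by rewrite -cap0; exact: nonincreasing_cvg_mu.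
move=> /fine_cvgP[_ /cvgrPdist_le /(_ e e0)] [n0 _ /(_ n0 (leqnn n0))] /=.
rewrite sub0r normrN ger0_norm ?fine_ge0 ?measure_ge0 // => h.
have fF : mu (F n0) \is a fin_num.
  rewrite ge0_fin_numE ?measure_ge0 //; apply: le_lt_trans F0.
  by apply: le_measure; rewrite ?inE; [exact: mF|exact: mF|exact/subsetPset/dF].
by exists n0, (F n0); split => //; rewrite -(fineK fF) lee_fin.
Qed.

Lemma closed_le_fun (f : R -> R) c : continuous f -> closed [set x | f x <= c].
Proof.
move=> cf; rewrite (_ : [set _ | _] = f @^-1` [set y | y <= c]) //.
by apply: preimage_closed => //; exact: closed_le.
Qed.

Lemma max_bound (P : nat -> nat -> Prop) J :
  (forall j, (j < J)%N -> exists n0, forall n, (n0 <= n)%N -> P j n) ->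
  exists n0, forall n, (n0 <= n)%N -> forall j, (j < J)%N -> P j n.
Proof.
elim: J => [|J IH] h; first by exists 0%N.
have [n1 h1] := IH (fun j jJ => h j (leqW jJ)).
have [n2 h2] := h J (ltnSn J).
exists (maxn n1 n2) => n; rewrite geq_max => /andP[n1n n2n] j.
by rewrite ltnS leq_eqVlt => /orP[/eqP -> |]; [exact: h2 | exact: h1].
Qed.

(** Disjoint subsets of a set of finite measure cannot all be large. *)
Lemma pigeonhole_measure (V : nat -> set R) J e : 10 < e * J.+1%:R ->
    (forall i, measurable (V i)) -> (forall i, V i `<=` energies) ->
    (forall i j, (i < j <= J)%N -> V i `&` V j = set0) ->
  exists2 i, (i <= J)%N & small e (V i).
Proof.
move=> eJ mV VI dV; apply: contrapT => no.
have big i : (i <= J)%N -> (e%:E <= mu (V i))%E.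
  move=> iJ; rewrite leNgt; apply/negP => h; apply: no; exists i => //.
  by exists (V i); split => //; exact: ltW.
have tV : trivIset [set: 'I_J.+1] (fun i : 'I_J.+1 => V i).
  move=> i j _ _; have [ij|ij|/val_inj //] := ltngtP i j.
    by rewrite dV; [move=> -[? []] | rewrite ij -ltnS ltn_ord].
  by rewrite setIC dV; [move=> -[? []] | rewrite ij -ltnS ltn_ord].
have : (mu (\big[setU/set0]_(i < J.+1) V i) <= mu energies)%E.
  apply: le_measure; rewrite ?inE; [by apply: bigsetU_measurable => i _; exact: mV|exact: measurable_energies|].
  by rewrite -bigcup_mkord => x [i _ /VI].
rewrite mu_energies measure_bigsetU_ord; [|by move=> i; exact: mV|exact: tV].
rewrite leNgt => /negP; apply.
apply: (@lt_le_trans _ _ (\sum_(i < J.+1) e%:E)%E).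
  by rewrite sumEFin lte_fin sumr_const card_ord -[X in _ < X]mulr_natr.
by apply: (@lee_sum R _ (fun=> e%:E) (fun i : 'I_J.+1 => mu (V i))) => i _; apply: big; rewrite -ltnS ltn_ord.
Qed.
End SmallSets.

Section JoinWords.
Variable R : realType.
Implicit Types (E e : R) (w z c : seq bool).

(** A matrix of determinant [1] is hyperbolic when its trace lies outside [-2, 2]. *)
Definition nonhyp w : set R := [set E : R | `|mtr (wmat E w)| <= 2].

Lemma continuous_mtr w : continuous (fun E : R => mtr (wmat E w)).
Proof.
rewrite (_ : (fun E : R => _) = horner (mtr (pmat R w))); first exact: continuous_horner.
by apply/funext => E; rewrite mtr_wmat.
Qed.

Lemma continuous_norm_mtr w : continuous (fun E : R => `|mtr (wmat E w)|).
Proof.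
move=> x; apply: (@continuous_comp _ _ _ (fun E : R => mtr (wmat E w)) (fun y : R => `|y|)).
  exact: continuous_mtr.
exact: norm_continuous.
Qed.

Lemma measurable_nonhyp w : measurable (nonhyp w).
Proof. by apply: closed_measurable; apply: closed_le_fun; exact: continuous_norm_mtr. Qed.

Lemma mtr_pow_neq2_countable z : z != [::] ->
  countable [set E : R | exists j, `|mtr (mpow (wmat E z) j.+1)| = 2].
Proof.
move=> z0; have h j : countable [set E : R | `|mtr (mpow (wmat E z) j.+1)| = 2].
  have zj : wpow z j.+1 != [::] by rewrite -size_eq0 size_wpow muln_eq0 /= size_eq0.
  have p0 := mulf_neq0 (@mtr_pmat_neqC R _ 2 zj) (@mtr_pmat_neqC R _ (- 2) zj).
  apply: (sub_countable _ (poly_roots_countable p0)); apply: subset_card_le => E /=.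
  rewrite -wmat_pow mtr_wmat !hornerE => /eqP.
  rewrite eqr_norml => /andP[/orP[]/eqP-> _]; first by rewrite subrr mul0r.
  by rewrite opprK addNr mulr0.
rewrite (_ : [set _ | _] = \bigcup_j [set E : R | `|mtr (mpow (wmat E z) j.+1)| = 2]).
  by apply: bigcup_countable => //; exact: countableP.
by apply/seteqP; split => E [j]; exists j.
Qed.

Lemma tquad_wmat_countable w z : z != [::] ->
  countable [set E : R | tquad (mtr (wmat E z)) (mtr (wmat E w))
                       (mtr (mmul (wmat E w) (wmat E z))) = 0].
Proof.
move=> z0; have p0 := tquad_pmat_neq0 R w z0.
apply: (sub_countable _ (poly_roots_countable p0)); apply: subset_card_le => E /=.
by rewrite -wmat_cat !mtr_wmat /pmat -wmat_cat /tquad !hornerE.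
Qed.

(** Where [z] is hyperbolic, [z^n c^m] is so for all large [n].  Where only [c] is,
    a large [m] makes the trace of [c^m] large; then at most one of the words
    [z^n c^m], for [n] in a long interval of fixed length, fails to be hyperbolic
    at a given energy, and averaging over the interval finds a good [n]. *)
Lemma join_words z c e : z != [::] -> c != [::] -> 0 < e ->
  exists m n, small e (@energies R `&` nonhyp (wpow z n ++ wpow c m.+1) `\`
                       (nonhyp z `&` nonhyp c)).
Proof.
move=> z0 c0 e0.
have dz E := mdet_wmat E z; have dc E := mdet_wmat E c.
have [J JP] : exists J, 10 < e / 3 * J.+1%:R.
  have h : 0 <= 10 / (e / 3) by rewrite divr_ge0 //; lra.
  exists (Num.bound (10 / (e / 3))).
  have := archi_boundP h; rewrite ltr_pdivrMr 1?mulrC; last by lra.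
  by move/lt_le_trans; apply; rewrite ler_pM2l ?ler_nat //; lra.
have e3 : 0 < e / 3 by lra.
pose X0 j m := [set E : R | (1 - `|mtr (wmat E (wpow z j.+1))| / 2) * mtr (wmat E (wpow c m)) ^+ 2 <= 16].
pose X m := (nonhyp z `\` nonhyp c) `&` \bigcup_(j in [set j | (j < J)%N]) X0 j m.
have mX m : measurable (X m).
  apply: measurableI; first by apply: measurableD; exact: measurable_nonhyp.
  apply: bigcup_measurable => j _; apply: closed_measurable; apply: closed_le_fun => x.
  apply: (@continuousM _ _ (fun E => 1 - `|mtr (wmat E (wpow z j.+1))| / 2) (fun E => mtr (wmat E (wpow c m)) ^+ 2)).
    apply: continuousB; first exact: cst_continuous.
    apply: (@continuousM _ _ (fun E => `|mtr (wmat E (wpow z j.+1))|) (fun=> 2^-1)); last exact: cst_continuous.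
    exact: continuous_norm_mtr.
  apply: (@continuous_comp _ _ _ (fun E => mtr (wmat E (wpow c m))) (fun y : R => y ^+ 2)).
    exact: continuous_mtr.
  exact: exprn_continuous.
have [|m0 m0P] := eventually_small e3 mX (mtr_pow_neq2_countable z0).
  move=> x _ nx.
  have [[zx ncx]|nx'] := pselect ((nonhyp z `\` nonhyp c) x); last first.
    by exists 0%N => n _ [].
  move: zx; rewrite /nonhyp /= => zx.
  have cx : 2 < `|mtr (wmat x c)| by rewrite ltNge; apply/negP.
  have [|n0 n0P] := @max_bound (fun j n => ~ X0 j n x) J; last first.
  - by exists n0 => n /n0P h [_ [j /= /h]].
  - move=> j _; have y2 : `|mtr (mpow (wmat x z) j.+1)| < 2.
      rewrite lt_neqAle mtr_pow_le2 // andbT.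
      by apply/eqP => h; apply: nx; exists j.
    pose y := 1 - `|mtr (mpow (wmat x z) j.+1)| / 2.
    have y0 : 0 < y by rewrite /y; lra.
    have q0 : tquad (mtr (wmat x c)) (mtr (mone R)) (mtr (mmul (mone R) (wmat x c))) != 0.
      rewrite mmul1 /tquad (_ : mtr (mone R) = 2); last by rewrite /mtr /=; ring.
      have : 4 - mtr (wmat x c) ^+ 2 < 0 by rewrite ltNge -norm_le2E -ltNge.
      by move=> h; apply/eqP => h'; lra.
    have [n0 n0P] := mtr_pow_unbounded (dc x) cx q0 (1 + 16 / y).
    exists n0 => n /n0P; rewrite mmul1 /X0 /= !wmat_pow -/y => h; apply/negP; rewrite -ltNge.
    rewrite -(real_normK (num_real (mtr _))) -ltr_pdivrMl // mulrC.
    have a0 : 0 <= 16 / y by rewrite divr_ge0 // ltW.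
    by move: h a0; move: (16 / y) `|mtr _| => a u; nra.
pose c' := wpow c m0.+1.
have smallX : small (e / 3) (@energies R `&` X m0.+1).
  by apply: small_sub m0P; apply: setIS => x Xx; exists m0.+1 => //=.
pose Y n := [set E : R | `|mtr (mmul (wmat E c') (mpow (wmat E z) n))| <= 2].
have YE n : Y n = nonhyp (wpow z n ++ c').
  by apply/funext => E; rewrite /Y /nonhyp /= wmat_cat wmat_pow.
have mY n : measurable (Y n) by rewrite YE; exact: measurable_nonhyp.
have mY' n : measurable (Y n `\` nonhyp z) by apply: measurableD => //; exact: measurable_nonhyp.
have [|n0 n0P] := eventually_small e3 mY' (tquad_wmat_countable c' z0).
  move=> x _ /= qx; have [zx|zx] := leP `|mtr (wmat x z)| 2.
    by exists 0%N => n _ [_]; apply.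
  have [n0 n0P] := mtr_pow_unbounded (dz x) zx (introN eqP qx) 2.
  by exists n0 => n /n0P h []; rewrite /Y /= leNgt h.
pose V i := @energies R `&` ((Y (n0 + i)%N `&` (nonhyp z `\` nonhyp c)) `\` X m0.+1).
have mV i : measurable (V i).
  apply: measurableI; first exact: measurable_energies.
  apply: measurableD => //; apply: measurableI => //.
  by apply: measurableD; exact: measurable_nonhyp.
have dV i j : (i < j <= J)%N -> V i `&` V j = set0.
  move=> /andP[ij jJ]; rewrite -subset0 => E [[_ [[Yi zc] Xi]] [_ [[Yj _] _]]].
  apply: Xi; split => //; exists (j - i.+1)%N; first by rewrite /= subnSK // leq_subLR (leq_trans jJ) // leq_addl.
  rewrite /X0 /= !wmat_pow subnSK //.
  have := @small_traces_bound _ (wmat E c') (wmat E z) (n0 + i) (j - i) (dz E) (proj1 zc) Yi.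
  rewrite -addnA subnKC ?(ltnW ij) // => /(_ Yj).
  by rewrite /c' wmat_pow.
have [i iJ smallV] := pigeonhole_measure JP mV (fun i => @subIsetl _ _ _) dV.
exists m0, (n0 + i)%N.
have -> : e = e / 3 + e / 3 + e / 3 by field.
apply: small_sub (smallU (smallU smallX n0P) smallV).
rewrite -/c' -YE => E [[EI Yi] nzc].
have [zE|nzE] := pselect (nonhyp z E); last first.
  left; right; split => //; exists (n0 + i)%N => //=; first by rewrite leq_addr.
have ncE : ~ nonhyp c E by move=> cE; apply: nzc.
have [XE|nXE] := pselect (X m0.+1 E); first by left; left.
by right; split => //; split => //; exact: conj Yi (conj zE ncE).
Qed.

(** The predicate [P] remembers that the word is built from the given ones. *)
Lemma join_finitely_many (c : nat -> seq bool) (P : seq bool -> Prop) n e :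
    (forall i, P (c i) /\ c i != [::]) ->
    (forall w1 w2, P w1 -> P w2 -> P (w1 ++ w2)) -> P [::] -> 0 < e ->
  exists z, [/\ P z, z != [::] &
    small e (@energies R `&` nonhyp z `\` \bigcap_(i in [set i | (i <= n)%N]) nonhyp (c i))].
Proof.
move=> cP Pcat P0; have Ppow w k : P w -> P (wpow w k).
  by move=> Pw; elim: k => //= k IH; exact: Pcat.
elim: n e => [|n IH] e e0.
  exists (c 0%N); split; [exact: (cP 0%N).1 | exact: (cP 0%N).2 |].
  exists set0; split => //; last by rewrite measure0 lee_fin ltW.
  by move=> E [[_ cE] nE]; apply: nE => i /=; rewrite leqn0 => /eqP ->.
have e2 : 0 < e / 2 by lra.
have [z [Pz z0 sz]] := IH _ e2.
have [m [k smk]] := join_words z0 (cP n.+1).2 e2.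
exists (wpow z k ++ wpow (c n.+1) m.+1); split.
- by apply: Pcat; apply: Ppow => //; exact: (cP n.+1).1.
- by rewrite -size_eq0 size_cat !size_wpow addn_eq0 [X in _ && X]muln_eq0 size_eq0 (negPf (cP n.+1).2) andbF.
- have -> : e = e / 2 + e / 2 by field.
  apply: small_sub (smallU smk sz) => E [[EI wE] nE].
  have [[zE cE]|nzc] := pselect ((nonhyp z `&` nonhyp (c n.+1)) E); last by left.
  right; split => // all_n; apply: nE => i /=; rewrite leq_eqVlt => /orP[/eqP -> //|].
  by rewrite ltnS => /all_n.
Qed.
End JoinWords.

(** * Finitely supported sequences and approximate eigenvectors *)

Section FiniteSums.
Variable R : realType.
Implicit Types (f g u v w : int -> R) (x : int -> bool) (E c : R).

(** Approximate eigenvectors can be truncated, so real sequences of finite support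
    are enough until the operators on square summable sequences come in. *)
Definition fsupp f := exists N : nat, forall n : int, (N < `|n|)%N -> f n = 0.
Definition tot f : R := \sum_(n \in [set: int]) f n.
Definition nrm2 v := tot (fun n => v n ^+ 2).
Definition ip u v := tot (fun n => u n * v n).

Lemma fsupp_comb2 f g h : fsupp f -> fsupp g ->
  (forall n, f n = 0 -> g n = 0 -> h n = 0) -> fsupp h.
Proof.
move=> [N fN] [M gM] h0; exists (maxn N M) => n; rewrite gtn_max => /andP[Nn Mn].
by apply: h0; [exact: fN | exact: gM].
Qed.

Lemma fsupp_comb f h : fsupp f -> (forall n, f n = 0 -> h n = 0) -> fsupp h.
Proof. by move=> sf h0; apply: (fsupp_comb2 sf sf) => n fn _; exact: h0. Qed.

Lemma fsupp_shift f (k : int) : fsupp f -> fsupp (fun n => f (n + k)).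
Proof. by move=> [N fN]; exists (N + `|k|)%N => n Nn; apply: fN; lia. Qed.

Lemma tot_window f (p : int) (m : nat) :
  (forall n, f n != 0 -> p <= n < p + m%:Z) -> tot f = \sum_(i < m) f (p + i%:Z).
Proof.
move=> fW; rewrite (fsbig_ord _ m (fun i => f (p + i%:Z))).
rewrite -(@fsbig_image _ _ _ _ _ `I_m (fun i : nat => p + i%:Z) f); last first.
  by move=> i j _ _ h; lia.
rewrite /tot; apply/esym; apply: fsbig_widen => //.
move=> n [_ nim] /=; apply/eqP; apply/negPn/negP => /fW pn; apply: nim.
by exists `|n - p|%N => /=; lia.
Qed.

Lemma tot_ball f N : (forall n : int, (N < `|n|)%N -> f n = 0) ->
  tot f = \sum_(i < N.*2.+1) f (- N%:Z + i%:Z).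
Proof.
move=> fN; apply: tot_window => n fn0; have [h|h] := ltnP N `|n|.
  by rewrite fN ?eqxx in fn0.
lia.
Qed.

Lemma totD f g : fsupp f -> fsupp g -> tot (fun n => f n + g n) = tot f + tot g.
Proof.
move=> [N fN] [M gM]; pose K := maxn N M.
have fK n : (K < `|n|)%N -> f n = 0 by rewrite gtn_max => /andP[/fN].
have gK n : (K < `|n|)%N -> g n = 0 by rewrite gtn_max => /andP[_ /gM].
rewrite (tot_ball fK) (tot_ball gK) -big_split /=.
by apply: tot_ball => n nK; rewrite fK // gK // addr0.
Qed.

Lemma totZ c f : fsupp f -> tot (fun n => c * f n) = c * tot f.
Proof.
move=> [N fN]; rewrite (tot_ball fN) mulr_sumr; apply: tot_ball => n nN.
by rewrite fN // mulr0.
Qed.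

Lemma tot_shift f (k : int) : tot (fun n => f (n + k)) = tot f.
Proof.
rewrite /tot [RHS](@reindex_fsbigT _ _ _ _ _ (fun n => n + k)) //.
by exists (fun n => n - k) => n; [rewrite addrK | rewrite subrK].
Qed.

Lemma eq_tot f g : f =1 g -> tot f = tot g.
Proof. by move=> /funext ->. Qed.

Lemma tot_ge0 f : (forall n, 0 <= f n) -> 0 <= tot f.
Proof. by move=> f0; apply: fsumr_ge0. Qed.

Lemma tot_le f g : fsupp f -> fsupp g -> (forall n, f n <= g n) -> tot f <= tot g.
Proof.
move=> sf sg fg; rewrite -subr_ge0 -mulN1r -totZ // -totD //; last first.
  by apply: fsupp_comb sf _ => n ->; rewrite mulr0.
by apply: tot_ge0 => n; rewrite mulN1r subr_ge0.
Qed.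

Lemma fsupp_sq v : fsupp v -> fsupp (fun n => v n ^+ 2).
Proof. by move=> sv; apply: fsupp_comb sv _ => n ->; rewrite expr0n. Qed.

Lemma fsuppM u v : fsupp u -> fsupp (fun n => u n * v n).
Proof. by move=> su; apply: fsupp_comb su _ => n ->; rewrite mul0r. Qed.

Lemma fsuppD u v : fsupp u -> fsupp v -> fsupp (fun n => u n + v n).
Proof. by move=> su sv; apply: (fsupp_comb2 su sv) => n -> ->; rewrite addr0. Qed.

Lemma fsuppZ c v : fsupp v -> fsupp (fun n => c * v n).
Proof. by move=> sv; apply: fsupp_comb sv _ => n ->; rewrite mulr0. Qed.

Lemma nrm2_ge0 v : 0 <= nrm2 v.
Proof. by apply: tot_ge0 => n; exact: sqr_ge0. Qed.

Lemma nrm2_ge v n : fsupp v -> v n ^+ 2 <= nrm2 v.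
Proof.
move=> sv; pose d m := if m == n then v n ^+ 2 else 0.
have <- : tot d = v n ^+ 2.
  rewrite (@tot_window d n 1%N); first by rewrite big_ord1 /d addr0 eqxx.
  by move=> m; rewrite /d; case: (m =P n) => [->|]; [lia | rewrite eqxx].
apply: tot_le; [|exact: fsupp_sq|].
  by apply: fsupp_comb (fsupp_sq sv) _ => m vm; rewrite /d; case: (m =P n) => [<-|].
by move=> m; rewrite /d; case: (m =P n) => [-> //|_]; exact: sqr_ge0.
Qed.

Lemma nrm2D c d u v : fsupp u -> fsupp v ->
  nrm2 (fun n => c * u n + d * v n) = c ^+ 2 * nrm2 u + 2 * c * d * ip u v + d ^+ 2 * nrm2 v.
Proof.
move=> su sv; have s1 := fsupp_sq su; have s2 := fsupp_sq sv; have s3 := @fsuppM u v su.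
rewrite /nrm2 /ip -!totZ // -!totD //; do ?exact: fsuppZ.
  by apply: eq_tot => n; ring.
by apply: fsuppD; exact: fsuppZ.
Qed.

Lemma nrm2Z c v : fsupp v -> nrm2 (fun n => c * v n) = c ^+ 2 * nrm2 v.
Proof.
move=> sv; rewrite /nrm2 -totZ; last exact: fsupp_sq.
by apply: eq_tot => n; rewrite exprMn.
Qed.

Lemma nrm2D_le u v : fsupp u -> fsupp v ->
  nrm2 (fun n => u n + v n) <= 2 * nrm2 u + 2 * nrm2 v.
Proof.
move=> su sv; have s1 := fsupp_sq su; have s2 := fsupp_sq sv.
rewrite /nrm2 -!totZ // -totD; try exact: fsuppZ.
apply: tot_le => [||n]; first exact/fsupp_sq/fsuppD.
  by apply: fsuppD; exact: fsuppZ.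
by have := sqr_ge0 (u n - v n); lra.
Qed.

(** [hop x E] is the operator with potential [x], minus the energy [E]. *)
Definition hop x E v (n : int) : R := v (n - 1) + v (n + 1) + ((x n)%:R - E) * v n.

Lemma fsupp_hop x E v : fsupp v -> fsupp (hop x E v).
Proof.
move=> sv; have s1 := fsupp_shift (-1) sv; have s2 := fsupp_shift 1 sv.
apply: fsuppD; first exact: fsuppD.
by apply: fsupp_comb sv _ => n ->; rewrite mulr0.
Qed.

Lemma hopE x E E' v n : hop x E' v n = hop x E v n + (E - E') * v n.
Proof. by rewrite /hop; ring. Qed.

Lemma hop_lin x E c d u v n :
  hop x E (fun m => c * u m + d * v m) n = c * hop x E u n + d * hop x E v n.
Proof. by rewrite /hop; ring. Qed.

Lemma ip_hop x E u v : fsupp u -> fsupp v -> ip (hop x E u) v = ip u (hop x E v).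
Proof.
move=> su sv; have s1 := fsupp_shift (-1) su; have s2 := fsupp_shift 1 su.
have s1' := fsupp_shift (-1) sv; have s2' := fsupp_shift 1 sv.
have e1 : ip (hop x E u) v = tot (fun n => u (n - 1) * v n) + (tot (fun n => u (n + 1) * v n) +
    tot (fun n => ((x n)%:R - E) * u n * v n)).
  rewrite -!totD; try (by apply: fsuppM); try (by apply: fsupp_comb su _ => n ->; rewrite mulr0 mul0r).
    by apply: eq_tot => n; rewrite /hop; ring.
  by apply: fsuppD; [exact: fsuppM | apply: fsupp_comb su _ => n ->; rewrite mulr0 mul0r].
have e2 : ip u (hop x E v) = tot (fun n => u n * v (n - 1)) + (tot (fun n => u n * v (n + 1)) +
    tot (fun n => ((x n)%:R - E) * u n * v n)).
  rewrite -!totD; try (by apply: fsuppM); try (by apply: fsupp_comb su _ => n ->; rewrite mulr0 mul0r).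
    by apply: eq_tot => n; rewrite /hop; ring.
  by apply: fsuppD; [exact: fsuppM | apply: fsupp_comb su _ => n ->; rewrite mulr0 mul0r].
rewrite e1 e2 !addrA; congr (_ + _); rewrite addrC; congr (_ + _).
  rewrite -(tot_shift _ (-1)); apply: eq_tot => n.
  by rewrite (_ : n + -1 + 1 = n) //; lia.
rewrite -(tot_shift _ 1); apply: eq_tot => n.
by rewrite addrK.
Qed.

Lemma nrm2_hop_le x E v : fsupp v -> nrm2 (hop x E v) <= 3 * (2 + (1 + `|E|) ^+ 2) * nrm2 v.
Proof.
move=> sv; pose C := 1 + `|E|.
have s1 := fsupp_sq (fsupp_shift (-1) sv); have s2 := fsupp_sq (fsupp_shift 1 sv).
have s3 := fsupp_sq sv.
have -> : 3 * (2 + C ^+ 2) * nrm2 v = tot (fun n => 3 * v (n - 1) ^+ 2) +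
    (tot (fun n => 3 * v (n + 1) ^+ 2) + tot (fun n => 3 * C ^+ 2 * v n ^+ 2)).
  rewrite !totZ // (tot_shift (fun n => v n ^+ 2)) (tot_shift (fun n => v n ^+ 2)) -/(nrm2 v).
  by ring.
have s4 := fsuppD (fsuppZ 3 s2) (fsuppZ (3 * C ^+ 2) s3).
rewrite -!totD; try exact: fsuppZ; last exact: s4.
apply: tot_le; [exact/fsupp_sq/fsupp_hop | apply: fsuppD; [exact: fsuppZ|exact: s4] |] => n.
rewrite /hop; have h : (((x n)%:R - E) * v n) ^+ 2 <= C ^+ 2 * v n ^+ 2.
  rewrite exprMn ler_wpM2r ?sqr_ge0 // -(real_normK (num_real (_ - E))) lerXn2r ?nnegrE //; last first.
    apply: le_trans (ler_normB _ _) _; rewrite /C lerD2r.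
    by case: (x n); rewrite ?normr1 ?normr0.
  by rewrite /C; have := normr_ge0 E; lra.
move: h; set a := v (n - 1); set b := v (n + 1); set d := (_ - E) * v n => h.
have := sqr_ge0 (a - b); have := sqr_ge0 (a - d); have := sqr_ge0 (b - d).
lra.
Qed.
End FiniteSums.

Section ApproximateSpectrum.
Variable R : realType.
Implicit Types (v : int -> R) (x : int -> bool) (E c : R).
Implicit Type F : (int -> bool) -> (int -> R) -> Prop.

(** By Weyl's criterion the spectrum consists of the energies with approximate
    eigenvectors.  A relation between potentials and vectors, instead of a single
    potential, serves to treat at once all potentials that read a concatenation of
    two words near the support of the vector. *)
Definition apspec F : set R := [set E | forall c, 0 < c ->
  exists x v, [/\ F x v, fsupp v & nrm2 (hop x E v) < c * nrm2 v]].

Lemma apspec_nrm2_gt0 c x E v : 0 < c -> nrm2 (hop x E v) < c * nrm2 v -> 0 < nrm2 v.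
Proof.
move=> c0 /(le_lt_trans (nrm2_ge0 _)); by rewrite pmulr_rgt0.
Qed.

Lemma not_apspecP F E : ~ apspec F E ->
  exists2 c, 0 < c & forall x v, F x v -> fsupp v -> c * nrm2 v <= nrm2 (hop x E v).
Proof.
move=> nE; apply: contrapT => no; apply: nE => c c0.
apply: contrapT => no2; apply: no; exists c => // x v Fv sv.
by rewrite leNgt; apply/negP => h; apply: no2; exists x, v.
Qed.

Lemma apspec_sub F G : (forall x v, F x v -> fsupp v ->
    exists2 x', G x' v & forall E, hop x E v =1 hop x' E v) -> apspec F `<=` apspec G.
Proof.
move=> FG E FE c c0; have [x [v [Fv sv lt]]] := FE c c0.
have [x' Gv hE] := FG x v Fv sv; exists x', v; split => //.
by rewrite -(funext (hE E)).
Qed.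

Lemma nrm2_hop_shift x E E' v : fsupp v ->
  nrm2 (hop x E v) <= 2 * nrm2 (hop x E' v) + 2 * (E' - E) ^+ 2 * nrm2 v.
Proof.
move=> sv; have -> : hop x E v = (fun n => hop x E' v n + (E' - E) * v n).
  by apply/funext => n; rewrite -hopE.
apply: le_trans (nrm2D_le _ _) _; [exact: fsupp_hop | exact: fsuppZ |].
by rewrite nrm2Z // -mulrA.
Qed.

Lemma closed_apspec F : closed (apspec F).
Proof.
move=> E clE; apply: contrapT => /not_apspecP[c c0 cP].
pose d := Num.min 1 (c / 8); have d0 : 0 < d by rewrite lt_min ltr01 divr_gt0.
have [E' [FE' /= E'd]] := clE _ (nbhsx_ballx E _ d0).
have c8 : 0 < c / 8 by lra.
have [x [v [Fv sv lt]]] := FE' _ c8.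
have v0 := apspec_nrm2_gt0 c8 lt.
have := cP x v Fv sv; apply/negP; rewrite -ltNge.
apply: le_lt_trans (nrm2_hop_shift x E E' sv) _.
have : (E' - E) ^+ 2 <= c / 8.
  rewrite -(real_normK (num_real _)) distrC.
  have d1 : d <= 1 by rewrite ge_min lexx.
  have d2 : d <= c / 8 by rewrite ge_min lexx orbT.
  by move: E'd; rewrite /ball /=; have := normr_ge0 (E - E'); move: `|E - E'| => e; nra.
by move: lt v0; move: (nrm2 _) (nrm2 v) ((E' - E) ^+ 2) => a b e; nra.
Qed.

Lemma apspec_energies F : apspec F `<=` @energies R.
Proof.
move=> E FE; have [x [v [_ sv lt]]] := FE 1 ltr01.
have v0 := apspec_nrm2_gt0 ltr01 lt.
have h0 := nrm2_hop_le x 0 sv; rewrite normr0 addr0 expr1n in h0.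
have : E ^+ 2 * nrm2 v <= 2 * nrm2 (hop x 0 v) + 2 * nrm2 (hop x E v).
  rewrite -nrm2Z //.
  have -> : (fun n => E * v n) = (fun n => hop x 0 v n + -1 * hop x E v n).
    by apply/funext => n; rewrite [hop x E v n](hopE x 0); ring.
  apply: le_trans (nrm2D_le _ _) _; try apply: fsuppZ; try exact: fsupp_hop.
  by rewrite nrm2Z ?sqrrN ?expr1n ?mul1r //; exact: fsupp_hop.
move=> h; have E2 : E ^+ 2 <= 20.
  by rewrite -(ler_pM2r v0); lra.
by rewrite /energies /= in_itv /=; apply/andP; split; nra.
Qed.
End ApproximateSpectrum.

Section Telescoping.
Variable R : realType.
Implicit Types (u : nat -> R) (w s t b : seq bool) (E : R).

(** Along a word [w] occupying the sites [1 .. size w], the sum of the squares of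
    [(H - E) u] and of [u].  The values of [u] at [0] and [size w + 1] are those of
    the neighbouring words, whence the additivity under concatenation. *)
Fixpoint defect E w u : R :=
  if w is c :: w' then (u 0 + u 2 + (c%:R - E) * u 1) ^+ 2 + defect E w' (fun i => u i.+1)
  else 0.

Fixpoint mass w u : R :=
  if w is c :: w' then u 1 ^+ 2 + mass w' (fun i => u i.+1) else 0.

Lemma defect_ge0 E w u : 0 <= defect E w u.
Proof. by elim: w u => //= c w IH u; rewrite addr_ge0 ?sqr_ge0. Qed.

Lemma mass_ge0 w u : 0 <= mass w u.
Proof. by elim: w u => //= c w IH u; rewrite addr_ge0 ?sqr_ge0. Qed.

Lemma defect_cat E w1 w2 u :
  defect E (w1 ++ w2) u = defect E w1 u + defect E w2 (fun i => u (size w1 + i)%N).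
Proof.
elim: w1 u => [|c w1 IH] u /=; first by rewrite add0r.
by rewrite IH addrA.
Qed.

Lemma mass_cat w1 w2 u : mass (w1 ++ w2) u = mass w1 u + mass w2 (fun i => u (size w1 + i)%N).
Proof.
elim: w1 u => [|c w1 IH] u /=; first by rewrite add0r.
by rewrite IH addrA.
Qed.

(** The deviations from the values that an exact solution with the same initial
    data takes behind the word. *)
Definition err1 E w u :=
  u (size w).+1 - (e11 (wmat E w) * u 1 + e12 (wmat E w) * u 0).
Definition err2 E w u :=
  u (size w) - (e21 (wmat E w) * u 1 + e22 (wmat E w) * u 0).

(** Each letter passes the error on through a fixed matrix and adds a term of the
    defect, so the constants depend on the word and the energy only. *)
Lemma approximate_transfer E w : exists2 C, 0 < C & forall u,
  err1 E w u ^+ 2 + err2 E w u ^+ 2 <= C * defect E w u /\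
  mass w u <= C * (u 1 ^+ 2 + u 0 ^+ 2 + defect E w u).
Proof.
elim: w => [|c w [C C0 CP]].
  exists 1 => // u; rewrite /err1 /err2 /=; split.
    by rewrite (_ : _ + _ = 0) ?mulr0 //; ring.
  by rewrite mul1r addr0 addr_ge0 ?sqr_ge0.
pose a := e11 (wmat E w); pose b := e21 (wmat E w); pose d := c%:R - E.
exists (2 * C + 2 * (a ^+ 2 + b ^+ 2) + 1 + C * (1 + 3 + 3 * d ^+ 2)) => [|u].
  have := sqr_ge0 a; have := sqr_ge0 b; have := sqr_ge0 d.
  have : 0 <= C * (1 + 3 + 3 * d ^+ 2) by rewrite mulr_ge0 ?ltW //; have := sqr_ge0 d; lra.
  lra.
have [h1 h2] := CP (fun i => u i.+1).
pose f := u 0 + u 2 + d * u 1.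
have e1 : err1 E (c :: w) u = err1 E w (fun i => u i.+1) + a * f.
  by rewrite /err1 /= -/a /f /d; ring.
have e2 : err2 E (c :: w) u = err2 E w (fun i => u i.+1) + b * f.
  by rewrite /err2 /= -/b /f /d; ring.
rewrite e1 e2 /= -/d -/f.
move: h1 h2; have D0 := defect_ge0 E w (fun i => u i.+1).
move: (defect _ _ _) (mass _ _) (err1 _ _ _) (err2 _ _ _) D0 => D M p q D0 h1 h2.
have f0 := sqr_ge0 f; have d0 := sqr_ge0 d; have a0 := sqr_ge0 a; have b0 := sqr_ge0 b.
have u0 := sqr_ge0 (u 0); have u1 := sqr_ge0 (u 1).
pose K := C * (1 + 3 + 3 * d ^+ 2).
have K0 : 0 <= K by rewrite mulr_ge0 ?(ltW C0) //; lra.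
split.
  have p1 := sqr_ge0 (p - a * f); have p2 := sqr_ge0 (q - b * f).
  have k1 : 0 <= K * (f ^+ 2 + D) by rewrite mulr_ge0 // addr_ge0.
  have k2 : 0 <= C * f ^+ 2 by rewrite mulr_ge0 // ltW.
  have k3 : 0 <= (a ^+ 2 + b ^+ 2) * D by rewrite mulr_ge0 // addr_ge0.
  rewrite -/K; have -> : (p + a * f) ^+ 2 + (q + b * f) ^+ 2 =
    2 * (p ^+ 2 + q ^+ 2) + 2 * (a ^+ 2 + b ^+ 2) * f ^+ 2 - (p - a * f) ^+ 2 - (q - b * f) ^+ 2 by ring.
  lra.
have v2 : u 2 ^+ 2 <= 3 * (f ^+ 2 + u 0 ^+ 2 + d ^+ 2 * u 1 ^+ 2).
  have -> : u 2 = f - u 0 - d * u 1 by rewrite /f; ring.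
  have := sqr_ge0 (f + u 0); have := sqr_ge0 (f + d * u 1); have := sqr_ge0 (u 0 - d * u 1).
  by move: f0 u0 (sqr_ge0 (d * u 1)) => *; lra.
have g1 : C * u 2 ^+ 2 <= C * (3 * (f ^+ 2 + u 0 ^+ 2 + d ^+ 2 * u 1 ^+ 2)) by rewrite ler_pM2l.
rewrite -/K; apply: (@le_trans _ _ (u 1 ^+ 2 + K * (u 1 ^+ 2 + u 0 ^+ 2 + (f ^+ 2 + D)))).
  rewrite lerD2l; apply: le_trans h2 _; rewrite /K.
  have : 0 <= C * (d ^+ 2 * (u 0 ^+ 2 + f ^+ 2 + D)) by rewrite mulr_ge0 ?(ltW C0) // mulr_ge0 // !addr_ge0.
  have : 0 <= C * u 0 ^+ 2 by rewrite mulr_ge0 // ltW.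
  have : 0 <= C * u 1 ^+ 2 by rewrite mulr_ge0 // ltW.
  have : 0 <= C * f ^+ 2 by rewrite mulr_ge0 // ltW.
  have : 0 <= C * D by rewrite mulr_ge0 // ltW.
  lra.
set Z := _ + _ + (_ + D).
have Z1 : u 1 ^+ 2 <= Z by rewrite /Z; lra.
have : 0 <= C * Z by rewrite mulr_ge0 ?(ltW C0) // /Z; lra.
have : 0 <= (a ^+ 2 + b ^+ 2) * Z by rewrite mulr_ge0 ?addr_ge0 // /Z; lra.
lra.
Qed.
End Telescoping.

(** * Concatenations of hyperbolic words *)

Section Cones.
Variable R : realType.
Implicit Types (A B : mat2 R) (p r : R).

Definition qform (al be ga p r : R) := al * p ^+ 2 + be * (p * r) + ga * r ^+ 2.

(** A common indefinite form increased by several matrices is a substitute for a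
    common invariant cone: all their products are then hyperbolic, uniformly. *)
Definition increases (al be ga k : R) A := forall p r,
  qform al be ga p r + k * (p ^+ 2 + r ^+ 2) <=
  qform al be ga (e11 A * p + e12 A * r) (e21 A * p + e22 A * r).

Lemma left_eigenvector A l : mdet A = 1 -> l ^+ 2 - mtr A * l + 1 = 0 -> l ^+ 2 != 1 ->
  exists x y, [/\ (x != 0) || (y != 0), x * e11 A + y * e21 A = l * x &
                  x * e12 A + y * e22 A = l * y].
Proof.
case: A => a b c d; rewrite /mdet /mtr /= => dA ch l1.
have [h|] := boolP ((c != 0) || (l - a != 0)).
  by exists c, (l - a); split; [exact: h | ring |]; nra.
rewrite negb_or !negbK subr_eq0 => /andP[/eqP c0 /eqP la].
exists (l - d), b; split; [|by rewrite c0 la; ring|by ring].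
apply/orP; left; apply: contra_neq l1 => ld; rewrite c0 mulr0 subr0 -la in dA.
by rewrite -dA expr2; congr (_ * _); lra.
Qed.

Lemma eigenvalue_exists (t : R) : 2 < `|t| -> exists l, l ^+ 2 - t * l + 1 = 0 /\ 1 < `|l|.
Proof.
move=> t2; have D : 0 <= t ^+ 2 - 4.
  by rewrite -(real_normK (num_real t)); nra.
pose d := Num.sqrt (t ^+ 2 - 4); have dd : d ^+ 2 = t ^+ 2 - 4 by rewrite sqr_sqrtr.
have d0 : 0 <= d by rewrite sqrtr_ge0.
have [t0|t0] := leP 0 t.
  exists ((t + d) / 2); split.
    rewrite [LHS](_ : _ = (d ^+ 2 - (t ^+ 2 - 4)) / 4); last by field.
    by rewrite dd subrr mul0r.
  rewrite ger0_norm in t2 => //; rewrite ger0_norm; lra.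
exists ((t - d) / 2); split.
  rewrite [LHS](_ : _ = (d ^+ 2 - (t ^+ 2 - 4)) / 4); last by field.
  by rewrite dd subrr mul0r.
rewrite ltr0_norm in t2 => //; rewrite ler0_norm; lra.
Qed.

Lemma left_eigenvector_pow A l x y n :
  x * e11 A + y * e21 A = l * x -> x * e12 A + y * e22 A = l * y ->
  x * e11 (mpow A n) + y * e21 (mpow A n) = l ^+ n * x /\
  x * e12 (mpow A n) + y * e22 (mpow A n) = l ^+ n * y.
Proof.
move=> h1 h2; elim: n => [|n [IH1 IH2]].
  by rewrite /mpow /= !expr0; split; ring.
rewrite (_ : mpow A n.+1 = mmul A (mpow A n)) // exprS /=.
move: IH1 IH2; move: (mpow A n) => [a b c d] /= IH1 IH2.
split.
  transitivity ((x * e11 A + y * e21 A) * a + (x * e12 A + y * e22 A) * c); first by ring.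
  by rewrite h1 h2 -[in RHS]mulrA -IH1; ring.
transitivity ((x * e11 A + y * e21 A) * b + (x * e12 A + y * e22 A) * d); first by ring.
by rewrite h1 h2 -[in RHS]mulrA -IH2; ring.
Qed.

Lemma left_eigenvectors_indep A l m x y z w : l != m ->
  (x != 0) || (y != 0) -> (z != 0) || (w != 0) ->
  x * e11 A + y * e21 A = l * x -> x * e12 A + y * e22 A = l * y ->
  z * e11 A + w * e21 A = m * z -> z * e12 A + w * e22 A = m * w ->
  x * w - y * z != 0.
Proof.
move=> lm xy zw h1 h2 h3 h4; apply/eqP => D0.
have lm0 : l - m != 0 by rewrite subr_eq0.
have [k k0 [kx ky]] : exists2 k, k != 0 & z = k * x /\ w = k * y.
  case/orP: xy => n0.
    have zE : z = z / x * x by rewrite divfK.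
    have wE : w = z / x * y.
      by apply: (mulfI n0); rewrite mulrCA mulrA divfK // ; lra.
    exists (z / x) => //; apply: contraTneq zw => k0.
    by rewrite zE wE k0 !mul0r eqxx.
  have wE : w = w / y * y by rewrite divfK.
  have zE : z = w / y * x.
    by apply: (mulfI n0); rewrite mulrCA mulrA divfK //; lra.
  exists (w / y) => //; apply: contraTneq zw => k0.
  by rewrite zE wE k0 !mul0r eqxx.
have e1 : k * (l - m) * x = 0.
  by have := h3; rewrite kx ky -!mulrA -mulrDr h1; lra.
have e2 : k * (l - m) * y = 0.
  by have := h4; rewrite kx ky -!mulrA -mulrDr h2; lra.
move: e1 e2 => /eqP; rewrite !mulf_eq0 (negPf k0) (negPf lm0) /= => /eqP x0.
move=> /eqP; rewrite !mulf_eq0 (negPf k0) (negPf lm0) /= => /eqP y0.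
by rewrite x0 y0 eqxx in xy.
Qed.

Lemma eigenbasis A : mdet A = 1 -> 2 < `|mtr A| -> exists l m x1 x2 y1 y2,
  [/\ l * m = 1, 1 < `|l|, mtr A = l + m & x1 * y2 - x2 * y1 != 0] /\
  [/\ x1 * e11 A + x2 * e21 A = l * x1, x1 * e12 A + x2 * e22 A = l * x2,
      y1 * e11 A + y2 * e21 A = m * y1 & y1 * e12 A + y2 * e22 A = m * y2].
Proof.
move=> dA tA; have [l [ch l1]] := eigenvalue_exists tA.
have l0 : l != 0 by rewrite -normr_gt0; lra.
exists l, l^-1; set m := l^-1; have lm : l * m = 1 by rewrite divff.
have tE : mtr A = l + m.
  apply: (mulfI l0); rewrite [in RHS]mulrDr lm -expr2; lra.
have chm : m ^+ 2 - mtr A * m + 1 = 0 by rewrite tE -lm; ring.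
have l21 : 1 < l ^+ 2 by rewrite -(real_normK (num_real l)); nra.
have m21 : m ^+ 2 < 1 by rewrite /m exprVn invf_lt1 // (lt_trans ltr01).
have lNm : l != m by apply: contraTneq m21 => <-; rewrite -leNgt ltW.
have [x1 [x2 [xn0 xa xb]]] := left_eigenvector dA ch (negbT (gt_eqF l21)).
have [y1 [y2 [yn0 ya yb]]] := left_eigenvector dA chm (negbT (lt_eqF m21)).
exists x1, x2, y1, y2; split; split => //.
exact: left_eigenvectors_indep lNm xn0 yn0 xa xb ya yb.
Qed.

(** The matrix [a], [b], [c], [d] of [B] in the coordinates given by an eigenbasis of [A]. *)
Lemma eigenbasis_entries A B l m x1 x2 y1 y2 : x1 * y2 - x2 * y1 != 0 ->
    x1 * e11 A + x2 * e21 A = l * x1 -> x1 * e12 A + x2 * e22 A = l * x2 ->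
    y1 * e11 A + y2 * e21 A = m * y1 -> y1 * e12 A + y2 * e22 A = m * y2 ->
  exists a b c d, [/\ x1 * e11 B + x2 * e21 B = a * x1 + b * y1,
     x1 * e12 B + x2 * e22 B = a * x2 + b * y2, y1 * e11 B + y2 * e21 B = c * x1 + d * y1 &
     y1 * e12 B + y2 * e22 B = c * x2 + d * y2] /\
     mtr B = a + d /\ mtr (mmul B A) = a * l + d * m.
Proof.
set D := x1 * y2 - x2 * y1 => D0 xa xb ya yb.
pose bx1 := x1 * e11 B + x2 * e21 B; pose bx2 := x1 * e12 B + x2 * e22 B.
pose by1 := y1 * e11 B + y2 * e21 B; pose by2 := y1 * e12 B + y2 * e22 B.
pose a := (bx1 * y2 - bx2 * y1) / D; pose b := (x1 * bx2 - x2 * bx1) / D.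
pose c := (by1 * y2 - by2 * y1) / D; pose d := (x1 * by2 - x2 * by1) / D.
have bx1E : bx1 = a * x1 + b * y1 by rewrite /a /b /D; field.
have bx2E : bx2 = a * x2 + b * y2 by rewrite /a /b /D; field.
have by1E : by1 = c * x1 + d * y1 by rewrite /c /d /D; field.
have by2E : by2 = c * x2 + d * y2 by rewrite /c /d /D; field.
exists a, b, c, d; split => //; split.
  by apply: (mulIf D0); rewrite [in RHS]mulrDl /a /d !divfK // /mtr /bx1 /bx2 /by1 /by2 /D; ring.
apply: (mulIf D0); rewrite [in RHS]mulrDl.
transitivity ((bx1 * e11 A + bx2 * e21 A) * y2 - (bx1 * e12 A + bx2 * e22 A) * y1 +
              (x1 * (by1 * e12 A + by2 * e22 A) - x2 * (by1 * e11 A + by2 * e21 A))).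
  by rewrite /mtr /= /bx1 /bx2 /by1 /by2 /D; ring.
rewrite bx1E bx2E by1E by2E.
rewrite (_ : (a * x1 + b * y1) * e11 A + _ = a * (x1 * e11 A + x2 * e21 A) + b * (y1 * e11 A + y2 * e21 A)); last by ring.
rewrite (_ : (a * x1 + b * y1) * e12 A + _ = a * (x1 * e12 A + x2 * e22 A) + b * (y1 * e12 A + y2 * e22 A)); last by ring.
rewrite (_ : (c * x1 + d * y1) * e12 A + _ = c * (x1 * e12 A + x2 * e22 A) + d * (y1 * e12 A + y2 * e22 A)); last by ring.
rewrite (_ : (c * x1 + d * y1) * e11 A + _ = c * (x1 * e11 A + x2 * e21 A) + d * (y1 * e11 A + y2 * e21 A)); last by ring.
by rewrite xa xb ya yb /D; ring.
Qed.

Lemma coordinates_norm (x1 x2 y1 y2 : R) : x1 * y2 - x2 * y1 != 0 ->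
  exists2 C, 0 < C & forall p r,
    p ^+ 2 + r ^+ 2 <= C * ((x1 * p + x2 * r) ^+ 2 + (y1 * p + y2 * r) ^+ 2).
Proof.
set D := x1 * y2 - x2 * y1 => D0; have D20 : 0 < D ^+ 2 by rewrite exprn_even_gt0.
pose S := x1 ^+ 2 + x2 ^+ 2 + y1 ^+ 2 + y2 ^+ 2.
have S0 : 0 <= S by rewrite !addr_ge0 ?sqr_ge0.
exists ((S + 1) / D ^+ 2) => [|p r]; first by rewrite divr_gt0 // ltr_wpDl.
rewrite mulrAC ler_pdivlMr //.
have -> : (p ^+ 2 + r ^+ 2) * D ^+ 2 =
  (y2 * (x1 * p + x2 * r) - x2 * (y1 * p + y2 * r)) ^+ 2 +
  (x1 * (y1 * p + y2 * r) - y1 * (x1 * p + x2 * r)) ^+ 2 by rewrite /D; ring.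
move: (x1 * p + x2 * r) (y1 * p + y2 * r) => x y; rewrite /S; clear.
have := sqr_ge0 (y2 * y + x2 * x); have := sqr_ge0 (x1 * x + y1 * y).
have := sqr_ge0 x; have := sqr_ge0 y; lra.
Qed.

Lemma diagonal_gain (g l m k x y : R) n : 0 < g -> 1 < l ^+ 2 -> m ^+ 2 < 1 ->
    k <= g * (l ^+ 2 - 1) -> k <= 1 - m ^+ 2 ->
  g * x ^+ 2 - y ^+ 2 + k * (x ^+ 2 + y ^+ 2) <=
  g * (l ^+ n.+1 * x) ^+ 2 - (m ^+ n.+1 * y) ^+ 2.
Proof.
move=> g0 l21 m21 k2 k3; rewrite !exprMn -!exprM ![(_ * 2)%N]mulnC !exprM.
have l2 : l ^+ 2 <= (l ^+ 2) ^+ n.+1.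
  by rewrite [(_ ^+ 2) ^+ n.+1]exprS; apply: ler_peMr; [exact: sqr_ge0 | exact/exprn_ege1/ltW].
have m2 : (m ^+ 2) ^+ n.+1 <= m ^+ 2.
  rewrite [(_ ^+ 2) ^+ n.+1]exprS; apply: ler_piMr; first exact: sqr_ge0.
  by apply: exprn_ile1; [exact: sqr_ge0 | exact: ltW].
have x0 := sqr_ge0 x; have y0 := sqr_ge0 y.
move: (x ^+ 2) (y ^+ 2) ((l ^+ 2) ^+ n.+1) ((m ^+ 2) ^+ n.+1) x0 y0 l2 m2.
move: (l ^+ 2) (m ^+ 2) k2 k3 => l' m' k2 k3 x' y' u v x0 y0 l2 m2.
have p1 : 0 <= (g * (u - 1) - k) * x'.
  rewrite mulr_ge0 // subr_ge0; apply: le_trans k2 _.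
  by rewrite ler_pM2l // lerD2r.
have p2 : 0 <= (1 - v - k) * y' by rewrite mulr_ge0 // subr_ge0 (le_trans k3) // lerD2l lerN2.
lra.
Qed.

(** [x], [Y] are small multiples of [X], [y]; the term [X^2] absorbs whatever the
    mixed terms contribute. *)
Lemma expanding_gain (g a b c d eps k x X y Y : R) : 0 < g -> g * a ^+ 2 - c ^+ 2 = 1 ->
    0 <= eps -> eps <= 1 / 4 -> g * eps <= 1 / 4 -> `|g * a * b - c * d| * eps <= 1 / 4 ->
    d ^+ 2 * eps <= 1 / 4 -> 0 <= k <= 1 / 2 -> `|x| = eps * `|X| -> `|Y| = eps * `|y| ->
  g * x ^+ 2 - y ^+ 2 + k * (x ^+ 2 + y ^+ 2) <=
  g * (a * X + b * Y) ^+ 2 - (c * X + d * Y) ^+ 2.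
Proof.
move=> g0 gE eps0 e1 eg eK eL /andP[k0 k1] xX YN.
have -> : g * (a * X + b * Y) ^+ 2 - (c * X + d * Y) ^+ 2 =
   X ^+ 2 + 2 * ((g * a * b - c * d) * (X * Y)) + (g * b ^+ 2 - d ^+ 2) * Y ^+ 2.
  by rewrite -[X in X + _ + _]mul1r -[X in X * _ + _ + _]gE; clear; ring.
have X20 := sqr_ge0 X; have y20 := sqr_ge0 y.
have Y2 : Y ^+ 2 = eps ^+ 2 * y ^+ 2.
  by rewrite -(real_normK (num_real Y)) YN exprMn (real_normK (num_real y)).
have x2E : x ^+ 2 = eps ^+ 2 * X ^+ 2.
  by rewrite -(real_normK (num_real x)) xX exprMn (real_normK (num_real X)).
have t1 : - (1 / 4 * (X ^+ 2 + y ^+ 2)) <= 2 * ((g * a * b - c * d) * (X * Y)).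
  have : `|(g * a * b - c * d) * (X * Y)| <= 1 / 4 * (`|X| * `|y|).
    by rewrite normrM (normrM X Y) YN [`|X| * (eps * _)]mulrCA [leLHS]mulrA ler_wpM2r //.
  rewrite ler_norml => /andP[h _].
  have := sqr_ge0 (`|X| - `|y|); rewrite sqrrB !real_normK ?num_real // => h'.
  move: h h'; move: (_ * (X * Y)) (`|X| * `|y|) (X ^+ 2) (y ^+ 2); clear => *; lra.
have ee : eps ^+ 2 <= eps * (1 / 4) by rewrite expr2 ler_wpM2l.
have quarter z : 0 <= z -> z * eps <= 1 / 4 -> z * eps ^+ 2 <= 1 / 16.
  move=> z0 ze; apply: (@le_trans _ _ (z * eps * (1 / 4))).
    by rewrite -mulrA ler_wpM2l.
  by clear -ze; lra.
have q1 : eps ^+ 2 <= 1 / 16 by rewrite -[eps ^+ 2]mul1r quarter ?(mul1r eps).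
have s2 : g * (eps ^+ 2 * X ^+ 2) <= 1 / 16 * X ^+ 2.
  by rewrite mulrA ler_wpM2r // quarter // ltW.
have s3 : d ^+ 2 * (eps ^+ 2 * y ^+ 2) <= 1 / 16 * y ^+ 2.
  by rewrite mulrA ler_wpM2r // quarter // sqr_ge0.
have s4 : 0 <= g * b ^+ 2 * (eps ^+ 2 * y ^+ 2).
  by rewrite mulr_ge0 // mulr_ge0 ?sqr_ge0 // ltW.
have s5 : k * (eps ^+ 2 * X ^+ 2 + y ^+ 2) <= 1 / 2 * (1 / 16 * X ^+ 2 + y ^+ 2).
  apply: ler_pM => //; first by rewrite addr_ge0 // mulr_ge0 ?sqr_ge0.
  by rewrite lerD2r ler_wpM2r.
clear -t1 s2 s3 s4 s5 X20 y20 Y2 x2E; rewrite Y2 x2E [_ * (eps ^+ 2 * y ^+ 2)]mulrBl.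
set p := g * (eps ^+ 2 * X ^+ 2) in s2 *; set q := d ^+ 2 * _ in s3 *.
set r := g * b ^+ 2 * _ in s4 *; set u := k * _ in s5 *; set v := 2 * _ in t1 *.
by clearbody p q r u v; lra.
Qed.

(** In coordinates [X], [Y] in which [A] is diagonal the form is [g X^2 - Y^2].
    As [a], the expanding-to-expanding coefficient of [B], does not vanish, a
    suitable weight [g] makes the form of [B A^n] dominated by its [X^2] term. *)
Lemma hyperbolic_increases A B : mdet A = 1 -> 2 < `|mtr A| ->
    tquad (mtr A) (mtr B) (mtr (mmul B A)) != 0 ->
  exists n0, forall n, (n0 <= n)%N -> exists al be ga k,
    [/\ 0 < k, increases al be ga k (mpow A n.+1) &
        increases al be ga k (mmul B (mpow A n))].
Proof.
move=> dA tA q0.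
have [l [m [x1 [x2 [y1 [y2 [[lm l1 tE D0] [xa xb ya yb]]]]]]]] := eigenbasis dA tA.
have [a [b [c [d [[bx1 bx2 by1 by2] [trB trBA]]]]]] := eigenbasis_entries B D0 xa xb ya yb.
have [C C0 nv] := coordinates_norm D0.
have l21 : 1 < l ^+ 2 by rewrite -(real_normK (num_real l)) exprn_egt1.
have m21 : m ^+ 2 < 1.
  have : m ^+ 2 * l ^+ 2 = 1 by rewrite -exprMn mulrC lm expr1n.
  by have := sqr_ge0 m; move: (m ^+ 2) (l ^+ 2) l21; clear => *; nra.
have a0 : a != 0.
  apply: contra_neq q0 => a0; rewrite trB trBA a0 tE /tquad mul0r !add0r.
  rewrite (_ : _ - _ = d ^+ 2 * (1 - l * m)); last by ring.
  by rewrite lm subrr mulr0.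
pose g := (c ^+ 2 + 1) / a ^+ 2.
have a20 : 0 < a ^+ 2 by rewrite exprn_even_gt0.
have g0 : 0 < g by rewrite divr_gt0 // ltr_wpDl // sqr_ge0.
have gE : g * a ^+ 2 - c ^+ 2 = 1 by rewrite /g divfK ?gt_eqF // addrC addKr.
pose K := `|g * a * b - c * d|; pose L := d ^+ 2.
have [n0 n0P] := expr_unbounded (4 * (g + K + L + 1)) l1.
exists n0 => n n0n; pose eps := `|m ^+ n|.
have K0 : 0 <= K by exact: normr_ge0.
have L0 : 0 <= L by exact: sqr_ge0.
have eps0 : 0 <= eps by exact: normr_ge0.
have leps : `|l ^+ n| * eps = 1 by rewrite -normrM -exprMn lm expr1n normr1.
have small (z : R) : 0 <= z -> z <= g + K + L + 1 -> z * eps <= 1 / 4.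
  have : 4 * (g + K + L + 1) < `|l ^+ n|.
    by rewrite normrX; apply: lt_le_trans n0P _; apply: ler_weXn2l => //; exact: ltW.
  move: leps eps0; move: `|l ^+ n| (_ + 1) eps; clear => p q e pe e0 qp z0 zq.
  have h1 : 0 <= (p - 4 * q) * e by rewrite mulr_ge0 // subr_ge0 ltW.
  have h2 : 0 <= (q - z) * e by rewrite mulr_ge0 // subr_ge0.
  lra.
have [eg eK eL e1] : [/\ g * eps <= 1 / 4, K * eps <= 1 / 4, L * eps <= 1 / 4 & eps <= 1 / 4].
  move: small g0 K0 L0; clear; clearbody g K L => small g0 K0 L0.
  by split; [| | | rewrite -[eps]mul1r]; apply: small; lra.
pose k := Num.min (1 / 2) (Num.min (g * (l ^+ 2 - 1)) (1 - m ^+ 2)).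
have k1 : k <= 1 / 2 by rewrite ge_min lexx.
have k2 : k <= g * (l ^+ 2 - 1) by rewrite !ge_min lexx orbT.
have k3 : k <= 1 - m ^+ 2 by rewrite !ge_min lexx !orbT.
have k0 : 0 < k.
  by rewrite !lt_min; apply/and3P; split; [exact: divr_gt0 | rewrite mulr_gt0 ?subr_gt0 | rewrite subr_gt0].
exists (g * x1 ^+ 2 - y1 ^+ 2), (2 * (g * x1 * x2 - y1 * y2)), (g * x2 ^+ 2 - y2 ^+ 2), (k / C).
have qE p r : qform (g * x1 ^+ 2 - y1 ^+ 2) (2 * (g * x1 * x2 - y1 * y2)) (g * x2 ^+ 2 - y2 ^+ 2) p r
   = g * (x1 * p + x2 * r) ^+ 2 - (y1 * p + y2 * r) ^+ 2 by rewrite /qform; clear; ring.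
have red (M : mat2 R) : (forall p r x y x' y',
    x = x1 * p + x2 * r -> y = y1 * p + y2 * r ->
    x' = (x1 * e11 M + x2 * e21 M) * p + (x1 * e12 M + x2 * e22 M) * r ->
    y' = (y1 * e11 M + y2 * e21 M) * p + (y1 * e12 M + y2 * e22 M) * r ->
    g * x ^+ 2 - y ^+ 2 + k * (x ^+ 2 + y ^+ 2) <= g * x' ^+ 2 - y' ^+ 2) ->
  increases (g * x1 ^+ 2 - y1 ^+ 2) (2 * (g * x1 * x2 - y1 * y2)) (g * x2 ^+ 2 - y2 ^+ 2) (k / C) M.
  move=> H p r; rewrite !qE.
  set u := x1 * (e11 M * p + _) + _; set v := y1 * (e11 M * p + _) + _.
  have -> : u = (x1 * e11 M + x2 * e21 M) * p + (x1 * e12 M + x2 * e22 M) * r by rewrite /u; clear; ring.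
  have -> : v = (y1 * e11 M + y2 * e21 M) * p + (y1 * e12 M + y2 * e22 M) * r by rewrite /v; clear; ring.
  apply: le_trans (H p r _ _ _ _ erefl erefl erefl erefl); rewrite lerD2l mulrAC ler_pdivrMr // -mulrA ler_pM2l //.
  by rewrite mulrC; exact: nv.
split; first by rewrite divr_gt0.
  apply: red => p r x y x' y' xE yE x'E y'E.
  have [h1 h2] := left_eigenvector_pow n.+1 xa xb.
  have [h3 h4] := left_eigenvector_pow n.+1 ya yb.
  have -> : x' = l ^+ n.+1 * x by rewrite x'E h1 h2 xE -!mulrA -mulrDr.
  have -> : y' = m ^+ n.+1 * y by rewrite y'E h3 h4 yE -!mulrA -mulrDr.
  exact: diagonal_gain.
apply: red => p r x y _ _ xE yE -> ->.
have [h1 h2] := left_eigenvector_pow n xa xb.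
have [h3 h4] := left_eigenvector_pow n ya yb.
pose X := l ^+ n * x; pose Y := m ^+ n * y.
have BA1 z1 z2 e f : z1 * e11 B + z2 * e21 B = e * x1 + f * y1 ->
    z1 * e12 B + z2 * e22 B = e * x2 + f * y2 ->
    (z1 * e11 (mmul B (mpow A n)) + z2 * e21 (mmul B (mpow A n))) * p +
    (z1 * e12 (mmul B (mpow A n)) + z2 * e22 (mmul B (mpow A n))) * r = e * X + f * Y.
  move=> E1 E2; rewrite /X /Y xE yE.
  transitivity (((z1 * e11 B + z2 * e21 B) * e11 (mpow A n) + (z1 * e12 B + z2 * e22 B) * e21 (mpow A n)) * p +
    ((z1 * e11 B + z2 * e21 B) * e12 (mpow A n) + (z1 * e12 B + z2 * e22 B) * e22 (mpow A n)) * r).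
    by rewrite /=; clear; ring.
  rewrite E1 E2.
  transitivity ((e * (x1 * e11 (mpow A n) + x2 * e21 (mpow A n)) + f * (y1 * e11 (mpow A n) + y2 * e21 (mpow A n))) * p +
    (e * (x1 * e12 (mpow A n) + x2 * e22 (mpow A n)) + f * (y1 * e12 (mpow A n) + y2 * e22 (mpow A n))) * r); first by clear; ring.
  by rewrite h1 h2 h3 h4; move: (m ^+ n) (l ^+ n) => mn ln0; clear; ring.
rewrite (BA1 x1 x2 a b) // (BA1 y1 y2 c d) //.
apply: (@expanding_gain g a b c d eps) => //.
- by rewrite (ltW k0).
- by rewrite /X /eps normrM mulrA [_ * `|l ^+ n|]mulrC leps mul1r.
- by rewrite /Y normrM.
Qed.
End Cones.

(** The words [b] over two symbols label the concatenations of copies of [s] and [t];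
    composing such substitutions is what makes the construction hierarchical. *)
Definition csubst (s t : seq bool) (b : seq bool) :=
  flatten [seq if c then t else s | c <- b].

Lemma csubst_cat s t b1 b2 : csubst s t (b1 ++ b2) = csubst s t b1 ++ csubst s t b2.
Proof. by rewrite /csubst map_cat flatten_cat. Qed.

Lemma csubst_comp s t b1 b2 b :
  csubst (csubst s t b1) (csubst s t b2) b = csubst s t (csubst b1 b2 b).
Proof.
elim: b => //= c b IH; rewrite csubst_cat -IH.
by case: c.
Qed.

Lemma csubst_wpow s t b n : csubst s t (wpow b n) = wpow (csubst s t b) n.
Proof. by elim: n => //= n IH; rewrite csubst_cat IH. Qed.

Lemma size_csubst s t b : size s = size t -> size (csubst s t b) = (size b * size s)%N.
Proof.
move=> st; elim: b => //= c b IH; rewrite size_cat IH mulSn.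
by case: c; rewrite ?st.
Qed.

Lemma csubst_inj s t b1 b2 : size s = size t -> s != t -> size b1 = size b2 ->
  csubst s t b1 = csubst s t b2 -> b1 = b2.
Proof.
move=> st sNt; elim: b1 b2 => [|c b1 IH] [|d b2] //= [sb] /eqP.
rewrite eqseq_cat; last by case: c; case: d; rewrite ?st.
move=> /andP[/eqP cd /eqP /(IH _ sb) ->]; congr (_ :: _).
by case: c d cd => -[] // h; move: sNt; rewrite h eqxx.
Qed.

Section Blocks.
Variable R : realType.
Implicit Types (u : nat -> R) (w s t b : seq bool) (E : R).

(** Young's inequality absorbs the mixed terms. *)
Lemma qform_perturb (al be ga d : R) : 0 < d -> exists2 K, 0 <= K & forall p r e f,
  qform al be ga p r - d * (p ^+ 2 + r ^+ 2) - K * (e ^+ 2 + f ^+ 2) <=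
  qform al be ga (p + e) (r + f).
Proof.
move=> d0; pose L := `|al| + `|be| + `|ga|.
have L0 : 0 <= L by rewrite !addr_ge0.
pose h := d / (L + 1); have h0 : 0 < h by rewrite divr_gt0 //; lra.
have hL : L * h <= d.
  by rewrite /h mulrCA ger_pMr // ler_pdivrMr; lra.
exists (L / h + L) => [|p r e f].
  by rewrite addr_ge0 // divr_ge0 // ltW.
have young (x y : R) : 2 * `|x * y| <= h * x ^+ 2 + y ^+ 2 / h.
  rewrite normrM -(real_normK (num_real x)) -(real_normK (num_real y)).
  have -> : h * `|x| ^+ 2 + `|y| ^+ 2 / h = (h * `|x| - `|y|) ^+ 2 / h + 2 * (`|x| * `|y|).
    by field; rewrite gt_eqF.
  by rewrite lerDr divr_ge0 ?sqr_ge0 // ltW.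
have prod (a x y : R) : - (`|a| * `|x * y|) <= a * (x * y).
  by rewrite -normrM; have := ler_norm (- (a * (x * y))); rewrite normrN; lra.
have y1 := young p e; have y2 := young p f; have y3 := young r e; have y4 := young r f.
have q1 := prod al p e; have q2 := prod be p f; have q3 := prod be r e.
have q4 := prod ga r f; have q5 := prod al e e; have q6 := prod be e f; have q7 := prod ga f f.
have a0 := normr_ge0 al; have b0 := normr_ge0 be; have c0 := normr_ge0 ga.
have z1 : `|e * e| = e ^+ 2 by rewrite -expr2 ger0_norm ?sqr_ge0.
have z2 : `|f * f| = f ^+ 2 by rewrite -expr2 ger0_norm ?sqr_ge0.
have z3 : 2 * `|e * f| <= e ^+ 2 + f ^+ 2.
  rewrite normrM -(real_normK (num_real e)) -(real_normK (num_real f)).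
  by have := sqr_ge0 (`|e| - `|f|); lra.
have eh0 : 0 <= e ^+ 2 / h by rewrite divr_ge0 ?sqr_ge0 // ltW.
have fh0 : 0 <= f ^+ 2 / h by rewrite divr_ge0 ?sqr_ge0 // ltW.
have hp0 : 0 <= h * p ^+ 2 by rewrite mulr_ge0 ?sqr_ge0 // ltW.
have hr0 : 0 <= h * r ^+ 2 by rewrite mulr_ge0 ?sqr_ge0 // ltW.
pose S := h * p ^+ 2 + h * r ^+ 2 + (e ^+ 2 / h + f ^+ 2 / h).
have m1 : `|al| * (2 * `|p * e|) <= `|al| * S by rewrite ler_wpM2l // /S; lra.
have m2 : `|be| * (`|p * f| + `|r * e|) <= `|be| * S by rewrite ler_wpM2l // /S; lra.
have m3 : `|ga| * (2 * `|r * f|) <= `|ga| * S by rewrite ler_wpM2l // /S; lra.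
have m4 : `|be| * `|e * f| <= `|be| * (e ^+ 2 + f ^+ 2).
  by rewrite ler_wpM2l //; have := normr_ge0 (e * f); lra.
have m5 : L * (h * (p ^+ 2 + r ^+ 2)) <= d * (p ^+ 2 + r ^+ 2).
  by rewrite mulrA ler_wpM2r // addr_ge0 ?sqr_ge0.
have e20 := sqr_ge0 e; have f20 := sqr_ge0 f.
have m6 : 0 <= `|al| * f ^+ 2 by rewrite mulr_ge0.
have m7 : 0 <= `|ga| * e ^+ 2 by rewrite mulr_ge0.
have -> : qform al be ga (p + e) (r + f) = qform al be ga p r +
  (2 * (al * (p * e)) + be * (p * f) + be * (r * e) + 2 * (ga * (r * f)) +
   (al * (e * e) + be * (e * f) + ga * (f * f))) by rewrite /qform; ring.
have -> : (L / h + L) * (e ^+ 2 + f ^+ 2) = L * (e ^+ 2 / h + f ^+ 2 / h) + L * (e ^+ 2 + f ^+ 2) by ring.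
rewrite z1 z2 in q5 q7.
move: m1 m2 m3 m5; rewrite /S /L.
move: (e ^+ 2 / h) (f ^+ 2 / h) eh0 fh0 => eh fh eh0 fh0 m1 m2 m3 m5.
lra.
Qed.

(** The form is evaluated at the two sites at each end of the word, so that
    inequalities for consecutive words telescope. *)
Definition gains (al be ga k C E : R) w := forall u,
  qform al be ga (u 1) (u 0) + k * mass w u <=
  qform al be ga (u (size w).+1) (u (size w)) + C * defect E w u.

Lemma gains_weaken al be ga k k' C C' E w : k' <= k -> C <= C' ->
  gains al be ga k C E w -> gains al be ga k' C' E w.
Proof.
move=> kk CC g u; have := g u.
have : k' * mass w u <= k * mass w u by rewrite ler_wpM2r // mass_ge0.
have : C * defect E w u <= C' * defect E w u by rewrite ler_wpM2r // defect_ge0.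
lra.
Qed.

Lemma gains_csubst al be ga k C E s t b : gains al be ga k C E s -> gains al be ga k C E t ->
  gains al be ga k C E (csubst s t b).
Proof.
move=> gs gt; elim: b => [|c b IH] u; first by rewrite /= !mulr0.
rewrite /= mass_cat defect_cat size_cat.
have gw : gains al be ga k C E (if c then t else s) by case: c.
set w := if c then t else s in gw *.
have := gw u; have := IH (fun i => u (size w + i)%N).
by rewrite -/(csubst s t b) addn0 addn1 addnS; lra.
Qed.

(** The increase of the form along exact solutions survives for approximate ones,
    at the price of a multiple of the defect. *)
Lemma increases_gains al be ga k E w : 0 < k -> increases al be ga k (wmat E w) ->
  exists k' C, [/\ 0 < k', 0 < C & gains al be ga k' C E w].
Proof.
move=> k0 inc; have [C C0 CP] := approximate_transfer E w.
pose M := wmat E w.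
pose m := e11 M ^+ 2 + e12 M ^+ 2 + (e21 M ^+ 2 + e22 M ^+ 2).
have m0 : 0 <= m by rewrite !addr_ge0 ?sqr_ge0.
pose d := k / (2 * (m + 1)); have d0 : 0 < d by rewrite divr_gt0 //; lra.
have dm : d * m <= k / 2.
  rewrite (_ : k / 2 = d * (m + 1)); last by rewrite /d; field; lra.
  by rewrite ler_pM2l //; lra.
have [K K0 KP] := qform_perturb al be ga d0.
exists (k / (2 * C)), (K * C + k / 2 + 1); split.
- by rewrite divr_gt0 // mulr_gt0.
- by have : 0 <= K * C; [rewrite mulr_ge0 // ltW | lra].
move=> u; have [h1 h2] := CP u.
have h3 := inc (u 1) (u 0).
have := KP (e11 M * u 1 + e12 M * u 0) (e21 M * u 1 + e22 M * u 0) (err1 E w u) (err2 E w u).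
rewrite /err1 /err2 -/M ![_ + (_ - _)]addrC !subrK -/(err1 E w u) -/(err2 E w u).
move: h3; rewrite -/M; set V1 := e11 M * _ + _; set V2 := e21 M * _ + _ => h3 h4.
have D0 := defect_ge0 E w u.
have hV : V1 ^+ 2 + V2 ^+ 2 <= m * (u 1 ^+ 2 + u 0 ^+ 2).
  rewrite /V1 /V2 /m; have := sqr_ge0 (e11 M * u 0 - e12 M * u 1).
  by have := sqr_ge0 (e21 M * u 0 - e22 M * u 1); lra.
have hd : d * (V1 ^+ 2 + V2 ^+ 2) <= k / 2 * (u 1 ^+ 2 + u 0 ^+ 2).
  apply: (@le_trans _ _ (d * m * (u 1 ^+ 2 + u 0 ^+ 2))); first by rewrite -mulrA ler_pM2l.
  by rewrite ler_wpM2r // addr_ge0 ?sqr_ge0.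
have hK : K * (err1 E w u ^+ 2 + err2 E w u ^+ 2) <= K * C * defect E w u.
  by rewrite -mulrA ler_wpM2l.
have hm : k / (2 * C) * mass w u <= k / 2 * (u 1 ^+ 2 + u 0 ^+ 2 + defect E w u).
  rewrite (_ : k / (2 * C) * _ = k / 2 * (mass w u / C)); last by field; rewrite gt_eqF.
  by rewrite ler_pM2l ?divr_gt0 // ler_pdivrMr // mulrC.
lra.
Qed.

(** The support keeps off the ends of the concatenation, so that [(H - E) v] is
    computed inside it and the boundary terms of a telescoping sum vanish. *)
Definition reads_blocks s t (x : int -> bool) (v : int -> R) := exists (p : int) b,
  (forall i, (i < size (csubst s t b))%N -> x (p + i%:Z) = nth false (csubst s t b) i) /\
  (forall n, v n != 0 -> p < n /\ n + 1 < p + (size (csubst s t b))%:Z).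

Lemma mass_sum w u : mass w u = \sum_(i < size w) u i.+1 ^+ 2.
Proof.
elim: w u => [|c w IH] u /=; first by rewrite big_ord0.
by rewrite big_ord_recl IH.
Qed.

Lemma defect_sum E w u : defect E w u =
  \sum_(i < size w) (u i + u i.+2 + ((nth false w i)%:R - E) * u i.+1) ^+ 2.
Proof.
elim: w u => [|c w IH] u /=; first by rewrite big_ord0.
by rewrite big_ord_recl IH.
Qed.

(** Summing the gains over the blocks telescopes to zero on a finitely supported
    vector, so its defect dominates its mass. *)
Lemma gains_not_apspec al be ga k C E s t : 0 < k -> 0 < C ->
  gains al be ga k C E s -> gains al be ga k C E t -> ~ apspec (reads_blocks s t) E.
Proof.
move=> k0 C0 gs gt sp; have kC : 0 < k / C by rewrite divr_gt0.
have [x [v [[p [b [xb vb]]] sv lt]]] := sp _ kC.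
pose w := csubst s t b; pose u (i : nat) := v (p + i%:Z - 1).
have out (n : int) : ~~ ((p < n) && (n + 1 < p + (size w)%:Z)) -> v n = 0.
  move=> nn; apply/eqP; apply/negPn/negP => /vb[h1 h2].
  by rewrite h1 h2 in nn.
have mE : nrm2 v = mass w u.
  rewrite mass_sum /nrm2 (@tot_window _ _ p (size w)).
    by apply: eq_bigr => i _; rewrite /u; congr (v _ ^+ 2); lia.
  by move=> n; rewrite sqrf_eq0 => /vb; rewrite -/w; lia.
have dE : nrm2 (hop x E v) = defect E w u.
  rewrite defect_sum /nrm2 (@tot_window _ _ p (size w)).
    apply: eq_bigr => i _; congr (_ ^+ 2); rewrite /hop xb // /u.
    by congr (v _ + v _ + _ * v _); lia.
  move=> n; rewrite sqrf_eq0 => hn; apply/andP.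
  have [h|] := boolP ((p <= n) && (n < p + (size w)%:Z)); first by apply/andP.
  move=> nn; move/negP: hn; case; rewrite /hop !out ?mulr0 ?addr0 //; lia.
have := gains_csubst b gs gt u; rewrite -/w -mE -dE.
have -> : u 1%N = 0 by rewrite /u out //; lia.
have -> : u 0%N = 0 by rewrite /u out //; lia.
have -> : u (size w).+1 = 0 by rewrite /u out //; lia.
have -> : u (size w) = 0 by rewrite /u out //; lia.
rewrite lerD2l => h; move: lt; apply/negP; rewrite -leNgt.
by rewrite mulrAC ler_pdivrMr // [_ * C]mulrC.
Qed.
End Blocks.

(** * One step of the construction *)

Lemma countable_setU T (A B : set T) : countable A -> countable B -> countable (A `|` B).
Proof.
move=> cA cB; rewrite -bigcup2E; apply: bigcup_countable => // i _.
by case: i => [|[|i]] //=; exact: countable0.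
Qed.

Section Stage.
Variable R : realType.
Implicit Types (s t w z b : seq bool) (E e : R).

Lemma infix_cat_l w1 w2 w : infix w w1 -> infix w (w1 ++ w2).
Proof. by move/infixP => [p [q ->]]; apply/infixP; exists p, (q ++ w2); rewrite !catA. Qed.

Lemma infix_cat_r w1 w2 w : infix w w2 -> infix w (w1 ++ w2).
Proof. by move/infixP => [p [q ->]]; apply/infixP; exists (w1 ++ p), q; rewrite !catA. Qed.

Lemma infix_csubst s t b1 b2 : infix b1 b2 -> infix (csubst s t b1) (csubst s t b2).
Proof.
move/infixP => [p [q ->]]; apply/infixP.
by exists (csubst s t p), (csubst s t q); rewrite !csubst_cat.
Qed.

Lemma word_containing_all N : exists2 d : seq bool, d != [::] &
  forall b, size b = N -> infix b d.
Proof.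
pose l := [seq tval tup | tup <- enum {: N.-tuple bool}].
exists (flatten l ++ [:: false]) => [|b bN]; first by case: (flatten l).
apply: infix_cat_l; have bl : b \in l.
  have bN' : size b == N by rewrite bN.
  by apply/mapP; exists (Tuple bN') => //; rewrite mem_enum.
elim: l bl => //= x l IH; rewrite inE => /orP[/eqP ->|/IH h]; last exact: infix_cat_r.
exact/infix_cat_l/infix_refl.
Qed.

(** If neither [s] nor [t] is hyperbolic, both are elliptic, and a product close to
    their group commutator is hyperbolic. *)
Lemma exists_hyperbolic_word s t E : `|mtr (wmat E s)| != 2 -> `|mtr (wmat E t)| != 2 ->
  mmul (wmat E s) (wmat E t) <> mmul (wmat E t) (wmat E s) ->
  exists2 b, b != [::] & 2 < `|mtr (wmat E (csubst s t b))|.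
Proof.
move=> s2 t2 nc; have [hs|hs] := ltP 2 `|mtr (wmat E s)|.
  by exists [:: false] => //=; rewrite /csubst /= cats0.
have [ht|ht] := ltP 2 `|mtr (wmat E t)|.
  by exists [:: true] => //=; rewrite /csubst /= cats0.
have [||m [n mn]] := noncommuting_hyperbolic (mdet_wmat E s) (mdet_wmat E t) _ _ nc.
- by rewrite lt_neqAle s2.
- by rewrite lt_neqAle t2.
exists (wpow [:: true] n ++ wpow [:: false] m ++ [:: true; false]).
  by rewrite -size_eq0 !size_cat /= !addnS.
have e1 c : csubst s t [:: c] = if c then t else s by rewrite /csubst /= cats0.
rewrite -[[:: true; false]]/([:: true] ++ [:: false]) !csubst_cat !csubst_wpow !e1.
by rewrite !wmat_cat !wmat_pow !mmulA in mn *.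
Qed.

(** Off a countable set of energies some concatenation is hyperbolic; enumerating
    the concatenations, finitely many of them are enough up to small measure. *)
Lemma cover_by_words s t e : size s = size t -> s != t -> 0 < e ->
  exists (c : nat -> seq bool) n0,
   [/\ forall i, exists2 b, b != [::] & c i = csubst s t b &
     small e (@energies R `&` \bigcap_(i in [set i | (i <= n0)%N]) @nonhyp R (c i))].
Proof.
move=> st sNt e0.
pose cb (i : nat) : seq bool := if unpickle i is Some (x :: b) then x :: b else [:: false].
exists (fun i => csubst s t (cb i)).
have s0 : s != [::].
  by apply: contra_neq sNt => s0; move/esym/eqP: st; rewrite s0 size_eq0 => /eqP ->.
have t0 : t != [::] by rewrite -size_eq0 -st size_eq0.
pose X n := \bigcap_(i in [set i | (i <= n)%N]) @nonhyp R (csubst s t (cb i)).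
have mX n : measurable (X n) by apply: bigcap_measurable => [|i _]; [exists 0%N | exact: measurable_nonhyp].
pose N := [set E : R | exists j, `|mtr (mpow (wmat E s) j.+1)| = 2] `|`
  [set E : R | exists j, `|mtr (mpow (wmat E t) j.+1)| = 2] `|`
  [set E : R | mmul (wmat E s) (wmat E t) = mmul (wmat E t) (wmat E s)].
have cN : countable N.
  apply: countable_setU; first apply: countable_setU.
  - exact: mtr_pow_neq2_countable.
  - exact: mtr_pow_neq2_countable.
  - exact: wmat_noncomm_countable.
have [|n0 n0P] := eventually_small e0 mX cN.
  move=> E _ nN; have [|||b b0 bh] := @exists_hyperbolic_word s t E.
  - by apply/eqP => h; apply: nN; left; left; exists 0%N; rewrite mpow1.
  - by apply/eqP => h; apply: nN; left; right; exists 0%N; rewrite mpow1.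
  - by move=> h; apply: nN; right.
  exists (pickle b) => n bn /(_ (pickle b) bn); rewrite /nonhyp /cb pickleK /mkset.
  by case: b b0 bh {bn} => // x b _ bh; rewrite leNgt bh.
exists n0; split.
  by move=> i; exists (cb i) => //; rewrite /cb; case: unpickle => [[]|].
by apply: small_sub n0P; apply: setIS => E XE; exists n0 => /=.
Qed.

(** A concatenation [A] that is hyperbolic at most energies, and contains all short
    concatenations, is repeated many times; the second new word [A^n D] differs
    from the first one, [A^(n+1)], by its last factor only.  Both increase the same
    form, for large [n], at every energy where [A] is hyperbolic and an invariant of
    the pair [D], [A], a nonzero polynomial, does not vanish. *)
Lemma stage s t N e : size s = size t -> s != t -> 0 < e ->
  exists b1 b2, [/\ size b1 = size b2, csubst s t b1 != csubst s t b2,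
    forall b, size b = N -> infix b b1 /\ infix b b2 &
    small e (apspec (reads_blocks (R := R) (csubst s t b1) (csubst s t b2)))].
Proof.
move=> st sNt e0; have e4 : 0 < e / 4 by lra.
have [c [n0 [cP smc]]] := cover_by_words st sNt e4.
have [d d0 dP] := word_containing_all N.
have s0 : s != [::].
  by apply: contra_neq sNt => s0; move/esym/eqP: st; rewrite s0 size_eq0 => /eqP ->.
have cs0 b : b != [::] -> csubst s t b != [::].
  by rewrite -!size_eq0 size_csubst // muln_eq0 !size_eq0 (negPf s0) orbF.
have [||||z [[bz zE] z0 smz]] := @join_finitely_many R c (fun w => exists b, w = csubst s t b) n0 (e / 4).
- move=> i; have [b b0 ->] := cP i; split; last exact: cs0.
  by exists b.
- by move=> _ _ [b1 ->] [b2 ->]; exists (b1 ++ b2); rewrite csubst_cat.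
- by exists [::].
- by [].
have [m [n smD]] := join_words z0 (cs0 d d0) e4.
pose bA := wpow bz n ++ wpow d m.+1; pose A := csubst s t bA.
have AE : wpow z n ++ wpow (csubst s t d) m.+1 = A.
  by rewrite /A csubst_cat !csubst_wpow zE.
have bAd : infix d bA by rewrite /bA; apply: infix_cat_r; apply: infix_cat_l; exact: infix_refl.
have bA0 : bA != [::].
  by rewrite /bA -size_eq0 size_cat size_wpow addn_eq0 [X in _ && X](_ : _ = false) ?andbF // size_wpow muln_eq0 size_eq0 (negPf d0).
have A0 : A != [::] := cs0 _ bA0.
have smA : small (e / 4 + e / 4 + e / 4) (@energies R `&` @nonhyp R A).
  apply: small_sub (smallU (smallU smc smz) smD) => E [EI AE'].
  rewrite AE.
  have [[zn dn]|nn] := pselect ((@nonhyp R z `&` @nonhyp R (csubst s t d)) E); last by right.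
  left; have [h|nh] := pselect ((\bigcap_(i in [set i | (i <= n0)%N]) @nonhyp R (c i)) E).
    by left.
  by right.
have [b2 [sb2 b2N]] : exists b2, size b2 = size bA /\ csubst s t b2 != A.
  have [tE|tN] := eqVneq (csubst s t (nseq (size bA) true)) A; last first.
    by exists (nseq (size bA) true); rewrite size_nseq.
  exists (nseq (size bA) false); rewrite size_nseq; split => //.
  rewrite -tE; apply/eqP => /csubst_inj; rewrite !size_nseq => /(_ st sNt erefl).
  by case: (bA) bA0.
pose D := csubst s t b2.
pose X n : set R := apspec (reads_blocks (wpow A n.+1) (wpow A n ++ D)) `\` @nonhyp R A.
have mX k : measurable (X k).
  apply: measurableD; last exact: measurable_nonhyp.
  by apply: closed_measurable; exact: closed_apspec.
have [|k0 k0P] := eventually_small e4 mX (@tquad_wmat_countable R D A A0).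
  move=> E _ /eqP q0; have [h|h] := leP `|mtr (wmat E A)| 2.
    by exists 0%N => k _ [_]; apply.
  have [k0 k0P] := hyperbolic_increases (mdet_wmat E A) h q0.
  exists k0 => k /k0P[al [be [ga [r [r0]]]]].
  rewrite -!wmat_pow -wmat_cat => /(increases_gains r0)[r1 [C1 [r10 C10 g1]]].
  move=> /(increases_gains r0)[r2 [C2 [r20 C20 g2]]].
  move=> [+ _]; apply: (@gains_not_apspec _ al be ga (Num.min r1 r2) (Num.max C1 C2)).
  - by rewrite lt_min r10.
  - by rewrite lt_max C10.
  - by apply: gains_weaken g1; rewrite ?ge_min ?le_max lexx.
  - by apply: gains_weaken g2; rewrite ?ge_min ?le_max lexx orbT.
exists (wpow bA k0.+2), (wpow bA k0.+1 ++ b2); split.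
- by rewrite size_cat !size_wpow sb2 mulSn addnC.
- rewrite csubst_cat !csubst_wpow -/A -[k0.+2]addn1 wpowD eqseq_cat // eqxx /=.
  by rewrite [wpow A 1](_ : _ = A) 1?eq_sym // /wpow /= cats0.
- move=> b /dP bd; have h : infix b bA := infix_trans bd bAd.
  by split; rewrite /wpow /=; [exact: infix_cat_l | exact: infix_cat_l (infix_cat_l _ h)].
- rewrite csubst_cat !csubst_wpow -/A -/D.
  have -> : e = e / 4 + e / 4 + e / 4 + e / 4 by field.
  apply: small_sub (smallU smA k0P) => E FE.
  have EI := apspec_energies FE.
  have [h|h] := pselect (@nonhyp R A E); first by left.
  by right; split => //; exists k0.+1 => //=.
Qed.
End Stage.

(** * The subshift of a hierarchy of words *)

Lemma ptws_cvg (u : nat -> full_shift) (y : full_shift) :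
  (forall i, \forall n \near \oo, u n i = y i) -> u n @[n --> \oo] --> y.
Proof.
move=> uy; apply/cvg_sup => i; apply/cvg_image.
  by rewrite eqEsubset; split => // b _; exists (fun=> b).
move=> A Ay; exists [set x : full_shift | A (x i)].
  have := uy i; apply: filterS => n /= ->; exact: nbhs_singleton.
rewrite eqEsubset; split => [_ [x Ax <-] //|b Ab].
by exists (fun=> b).
Qed.

Lemma near_eq_coord (x : full_shift) (i : int) : \forall y \near x, y i = x i.
Proof.
have := @proj_continuous _ (fun _ : int => bool) i x [set x i].
by apply; exact: discrete_set1.
Qed.

Lemma infix_split (w w' : seq bool) : infix w w' -> exists l r : seq bool, w' = l ++ w ++ r.
Proof. by move/infixP => [l [r e]]; exists l, r. Qed.

Definition window (x : int -> bool) (p : int) (n : nat) : seq bool :=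
  mkseq (fun i : nat => x (p + i%:Z)) n.

Lemma size_window x p n : size (window x p n) = n.
Proof. exact: size_mkseq. Qed.

Lemma nth_window x p n i : (i < n)%N -> nth false (window x p n) i = x (p + i%:Z).
Proof. by move=> ?; rewrite nth_mkseq. Qed.

Lemma infix_window (x : int -> bool) p n (w : seq bool) : infix w (window x p n) ->
  exists i : nat, window x (p + i%:Z) (size w) = w.
Proof.
move/infix_split => [l [r e]]; exists (size l).
have sz : (size l + size w + size r = n)%N.
  by rewrite -(size_window x p n) e !size_cat addnA.
apply: (@eq_from_nth _ false); rewrite size_window // => i iw.
rewrite nth_window // -addrA -PoszD -(@nth_window x p n); last by lia.
by rewrite e nth_cat ltnNge leq_addr /= addKn nth_cat iw.
Qed.

Lemma take_drop_csubst s t b i : size s = size t -> (i < size b)%N ->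
  take (size s) (drop (i * size s) (csubst s t b)) = if nth false b i then t else s.
Proof.
move=> st; elim: b i => //= c b IH [|i] ib.
  by rewrite mul0n drop0; case: c; rewrite ?st take_size_cat.
rewrite mulSn addnC -drop_drop.
have -> : drop (size s) ((if c then t else s) ++ flatten [seq if c0 then t else s | c0 <- b]) = csubst s t b.
  by case: c; rewrite ?st drop_size_cat.
exact: IH.
Qed.

Lemma infix_block (s t b w : seq bool) : size s = size t -> infix w (csubst s t b) ->
  (2 * size s <= size w)%N -> infix s w \/ infix t w.
Proof.
move=> st /infix_split[l [r e]] sw.
have [s0|s0] := posnP (size s).
  by left; move/eqP: s0; rewrite size_eq0 => /eqP ->; exact: infix0s.
pose i := ((size l + size s).-1 %/ size s)%N.
have i1 : (size l <= i * size s)%N.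
  have := divn_eq (size l + size s).-1 (size s); rewrite -/i.
  by have := ltn_pmod (size l + size s).-1 s0; lia.
have i2 : (i * size s < size l + size s)%N.
  by have := leq_trunc_div (size l + size s).-1 (size s); rewrite -/i; lia.
clearbody i.
have sz : (size b * size s = size l + size w + size r)%N.
  by rewrite -(size_csubst b st) e !size_cat addnA.
have ib : (i < size b)%N.
  by rewrite -(ltn_pmul2r s0) sz; lia.
have blk := take_drop_csubst st ib.
have we : drop (i * size s - size l) w ++ r = drop (i * size s) (csubst s t b).
  rewrite e -[in RHS](subnKC i1) drop_cat ltnNge leq_addr /=.
  rewrite addKn drop_cat ifT // ltn_subLR // (leq_trans i2) // leq_add2l.
  by apply: leq_trans sw; rewrite leq_pmull.
have {}blk : take (size s) (drop (i * size s - size l) w) = if nth false b i then t else s.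
  rewrite -blk -we takel_cat // size_drop.
  have : (i * size s - size l < size s)%N by rewrite ltn_subLR.
  by move: sw; move: (i * size s - size l)%N => k; lia.
have h : infix (if nth false b i then t else s) w.
  apply/infixP; exists (take (i * size s - size l) w), (drop (size s) (drop (i * size s - size l) w)).
  by rewrite -blk !cat_take_drop.
by move: h; case: ifP; [right | left].
Qed.

Section Hierarchy.
Variables (s t : nat -> seq bool) (N : nat -> nat).
Hypothesis size_st : forall k, size (s k) = size (t k).
Hypothesis neq_st : forall k, s k != t k.
Hypothesis N_ge3 : forall k, (3 <= N k)%N.
Hypothesis next : forall k, exists b1 b2,
  [/\ s k.+1 = csubst (s k) (t k) b1, t k.+1 = csubst (s k) (t k) b2 &
      forall b, size b = N k -> infix b b1 /\ infix b b2].

Definition language (w : seq bool) := exists k, infix w (s k).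
Definition hierarchy_shift : set full_shift :=
  [set x | forall p n, language (window x p n)].

Lemma size_s_gt0 k : (0 < size (s k))%N.
Proof.
rewrite lt0n size_eq0; apply: contra_neq (neq_st k) => s0.
by have /esym/eqP := size_st k; rewrite s0 size_eq0 => /eqP ->.
Qed.

Lemma contains_blocks k (b : seq bool) : size b = N k ->
  infix (csubst (s k) (t k) b) (s k.+1) /\ infix (csubst (s k) (t k) b) (t k.+1).
Proof.
by move=> bN; have [b1 [b2 [-> -> /(_ b bN)[h1 h2]]]] := next k; split; exact: infix_csubst.
Qed.

(** Three copies of [s k] in a row are among the concatenations of [N k] blocks, and
    the middle one has a neighbour on either side. *)
Lemma triple_infix k : infix (s k ++ s k ++ s k) (s k.+1) /\ infix (s k) (t k.+1).
Proof.
have [|h1 h2] := @contains_blocks k (nseq 3 false ++ nseq (N k - 3) false).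
  by rewrite size_cat !size_nseq subnKC.
rewrite csubst_cat in h1 h2.
have e3 : csubst (s k) (t k) (nseq 3 false) = s k ++ s k ++ s k by rewrite /csubst /= cats0.
rewrite e3 in h1 h2; split.
  by apply: infix_trans h1; apply: infix_cat_l; exact: infix_refl.
by apply: infix_trans h2; apply: infix_cat_l; apply: infix_cat_l; exact: infix_refl.
Qed.

Lemma infix_s_mono k j : (k <= j)%N -> infix (s k) (s j).
Proof.
move/subnKC => <-; elim: (j - k)%N => [|m IH]; first by rewrite addn0 infix_refl.
rewrite addnS; apply: infix_trans IH _; apply: infix_trans (proj1 (triple_infix _)).
by apply: infix_cat_l; exact: infix_refl.
Qed.

Lemma language_above w k : language w -> exists2 j, (k <= j)%N & infix w (s j).
Proof.
move=> [i wi]; exists (maxn i k); first exact: leq_maxr.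
by apply: infix_trans wi _; apply: infix_s_mono; exact: leq_maxl.
Qed.

Lemma blocks_above k j : (k <= j)%N ->
  exists b1 b2, s j = csubst (s k) (t k) b1 /\ t j = csubst (s k) (t k) b2.
Proof.
move/subnKC => <-; elim: (j - k)%N => [|m [b1 [b2 [e1 e2]]]].
  by rewrite addn0; exists [:: false], [:: true]; rewrite /csubst /= !cats0.
have [c1 [c2 [f1 f2 _]]] := next (k + m).
rewrite addnS f1 f2 e1 e2; exists (csubst b1 b2 c1), (csubst b1 b2 c2).
by rewrite !csubst_comp.
Qed.

Lemma language_long_factor k w : language w -> (2 * size (s k) <= size w)%N ->
  infix (s k) w \/ infix (t k) w.
Proof.
move=> /(language_above k)[j kj wj].
have [b [_ [e _]]] := blocks_above kj; rewrite e in wj.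
exact: infix_block (size_st k) wj.
Qed.

(** Long words contain a whole block of a given level, and both blocks of that
    level contain a block [s k] of the preceding one. *)
Lemma language_recurrent w : language w -> exists n, forall w', language w' ->
  (n <= size w')%N -> infix w w'.
Proof.
move=> [k wk]; exists (2 * size (s k.+1))%N => w' w'L nw'.
apply: infix_trans wk _; have [h|h] := language_long_factor w'L nw'.
  exact: infix_trans (infix_s_mono (leqnSn k)) h.
exact: infix_trans (proj2 (triple_infix k)) h.
Qed.

(** Each level occurs in the next one with room on both sides; following such
    occurrences gives a bi-infinite sequence through any given word. *)
Lemma language_extends w : language w ->
  exists2 x, hierarchy_shift x & window x 0 (size w) = w.
Proof.
move=> [k0 /infix_split[l0 [r0 e0]]].
have occ k : exists o : nat, [/\ (0 < o)%N, (o + size (s k) < size (s k.+1))%N &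
    forall i, (i < size (s k))%N -> nth false (s k.+1) (o + i) = nth false (s k) i].
  have /infix_split[l [r e]] := proj1 (triple_infix k); have L0 := size_s_gt0 k.
  exists (size l + size (s k))%N; split; first by lia.
    by rewrite e !size_cat; lia.
  move=> i ik; rewrite e nth_cat ifF; last by lia.
  rewrite (_ : _ - _ = size (s k) + i)%N; last by lia.
  rewrite -!catA nth_cat ifF; last by lia.
  by rewrite addKn nth_cat ik.
have [step stepP] := choice occ.
pose off := nat_rect (fun=> nat) (size l0) (fun m f => f + step (k0 + m)%N)%N.
have offS m : off m.+1 = (off m + step (k0 + m)%N)%N by [].
pose L m := size (s (k0 + m)%N).
have Lo m : (step (k0 + m)%N + L m < L m.+1)%N by rewrite /L addnS; have [] := stepP (k0 + m)%N.
have bounds m : (m <= off m)%N /\ (off m + m <= L m)%N /\ (L 0%N - off 0%N <= L m - off m)%N.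
  elim: m => [|m [h1 [h2 h3]]].
    by rewrite addn0 /L addn0 e0 !size_cat /=; lia.
  have [st0 _ _] := stepP (k0 + m)%N; move: h1 h2 h3 st0 (Lo m); rewrite offS.
  by move: (off 0%N) (L 0%N) (L m.+1) (L m) (off m) (step _); lia.
pose g m (i : int) := nth false (s (k0 + m)%N) (absz ((off m)%:Z + i)%R).
pose ok m (i : int) := (0 <= (off m)%:Z + i) && ((off m)%:Z + i < (L m)%:Z).
have gS m i : ok m i -> ok m.+1 i /\ g m.+1 i = g m i.
  move=> /andP[h1 h2]; have [st0 st1 st2] := stepP (k0 + m)%N; have l1 := Lo m.
  split; first by rewrite /ok offS; lia.
  rewrite /g offS addnS -st2; last by rewrite -/(L m); lia.
  by congr nth; lia.
have gk m j i : (m <= j)%N -> ok m i -> ok j i /\ g j i = g m i.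
  move/subnKC => <-; elim: (j - m)%N => [|d IH] h; first by rewrite addn0.
  rewrite addnS; have [h1 h2] := IH h; have [h3 h4] := gS _ _ h1.
  by split => //; rewrite h4.
have okb (i : int) : ok `|i|.+1 i.
  have [h1 [h2 _]] := bounds `|i|.+1; rewrite /ok; lia.
pose x : full_shift := fun i => g `|i|.+1 i.
have xE m i : ok m i -> x i = g m i.
  move=> h; have [_ h1] := gk m (maxn m `|i|.+1) i (leq_maxl _ _) h.
  have [_ h2] := gk `|i|.+1 (maxn m `|i|.+1) i (leq_maxr _ _) (okb i).
  by rewrite /x -h2 h1.
exists x.
  move=> p n; pose m := (`|p| + n).+1; exists (k0 + m)%N.
  have [b1 [b2 _]] := bounds m.
  have pm : (0 <= (off m)%:Z + p) && ((off m)%:Z + p + n%:Z <= (L m)%:Z).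
    by rewrite /m in b1 b2 *; lia.
  apply/infixP; pose q := absz ((off m)%:Z + p)%R.
  exists (take q (s (k0 + m)%N)), (drop n (drop q (s (k0 + m)%N))).
  rewrite -[LHS](cat_take_drop q) -[in LHS](cat_take_drop n (drop q (s (k0 + m)%N))); congr (_ ++ (_ ++ _)).
  apply: (@eq_from_nth _ false).
    by rewrite size_take size_drop size_window -/(L m) /q; case: ifP; lia.
  move=> i; rewrite size_take size_drop -/(L m) => iq.
  have i_n : (i < n)%N by move: iq; case: ifP; lia.
  rewrite nth_take // nth_drop nth_window // (xE m); last by rewrite /ok; lia.
  by rewrite /g; congr nth; rewrite /q; lia.
apply: (@eq_from_nth _ false); rewrite size_window // => i iw.
have Lw : L 0%N = (size l0 + (size w + size r0))%N by rewrite /L addn0 e0 !size_cat.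
rewrite nth_window // (xE 0%N); last by rewrite /ok Lw /=; lia.
rewrite /g addn0 e0 (_ : absz _ = size l0 + i)%N; last by rewrite /=; lia.
by rewrite nth_cat ifF ?addKn ?nth_cat ?iw //; lia.
Qed.

Lemma shift_window (x : full_shift) p n : window (shift x) p n = window x (p + 1) n.
Proof. by apply: eq_mkseq => i; rewrite /shift addrAC. Qed.

Lemma hierarchy_subshift : subshift hierarchy_shift.
Proof.
split.
  move=> x clx p n.
  have : \forall y \near x, forall i, (i < n)%N -> y (p + i%:Z) = x (p + i%:Z).
    elim: n => [|n IH]; first by near=> y.
    have := near_eq_coord x (p + n%:Z); apply: filterS2 IH => y h1 h2 i.
    by rewrite ltnS leq_eqVlt => /orP[/eqP ->|/h1].
  move=> /clx[y [Yy yx]]; rewrite (_ : window x p n = window y p n) //.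
  apply: (@eq_from_nth _ false); rewrite !size_window // => i i_n.
  by rewrite !nth_window // yx.
rewrite eqEsubset; split => [_ [x Yx <-] p n|x Yx].
  by rewrite shift_window.
exists (fun n => x (n - 1)); last by apply/funext => n; rewrite /shift addrK.
move=> p n; rewrite (_ : window _ p n = window x (p - 1) n) //.
by apply: eq_mkseq => i; rewrite addrAC.
Unshelve. all: by end_near.
Qed.

Lemma subshift_shift_mem Z x (k : int) : subshift Z -> Z x ->
  Z (fun n => x (n + k)).
Proof.
move=> [_ ZZ] Zx.
have fwd (m : nat) z : Z z -> Z (fun n => z (n + m%:Z)).
  elim: m z => [|m IH] z Zz; first by rewrite (_ : (fun _ => _) = z) //; apply/funext => n; rewrite addr0.
  rewrite (_ : (fun _ => _) = shift (fun n => z (n + m%:Z))); last first.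
    by apply/funext => n; rewrite /shift; congr z; lia.
  by rewrite -ZZ; exists (fun n => z (n + m%:Z)) => //; exact: IH.
have bwd (m : nat) z : Z z -> Z (fun n => z (n - m%:Z)).
  elim: m z => [|m IH] z Zz; first by rewrite (_ : (fun _ => _) = z) //; apply/funext => n; rewrite subr0.
  have := IH z Zz; rewrite -{1}ZZ => -[y Zy yz].
  rewrite (_ : (fun _ => _) = y) //; apply/funext => n.
  have /(congr1 (fun f => f (n - 1))) := yz; rewrite /shift subrK => ->.
  by congr z; lia.
case: k => m; first exact: fwd.
by rewrite NegzE; exact: bwd.
Qed.

Lemma recurrent_window x y p n q : hierarchy_shift x -> hierarchy_shift y ->
  exists2 q', q <= q' & window y q' n = window x p n.
Proof.
move=> Yx Yy; have [m mP] := language_recurrent (Yx p n).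
have [|i <-] := infix_window (mP (window y q m) (Yy _ _) _); first by rewrite size_window.
by rewrite size_window; exists (q + i%:Z) => //; lia.
Qed.

(** Uniform recurrence makes the orbit of every point come close, on any window, to
    every other point. *)
Lemma hierarchy_minimal : minimal_subshift hierarchy_shift.
Proof.
split; first exact: hierarchy_subshift.
  have [x Yx _] := @language_extends [::] (ex_intro _ 0%N (infix0s _)).
  by exists x.
move=> Z sZ [z Zz] ZY; rewrite eqEsubset; split => // y Yy.
have Yz := ZY _ Zz.
have /choice[q qP] : forall n : nat, exists q, window z q n.*2 = window y (- n%:Z) n.*2.
  by move=> n; have [q _ ?] := recurrent_window (- n%:Z) n.*2 0 Yy Yz; exists q.
pose u (n : nat) : full_shift := fun i => z (i + (q n + n%:Z)).
have cvu : u n @[n --> \oo] --> y.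
  apply: ptws_cvg => i; exists `|i|.+1 => // n /= ni.
  have := congr1 (fun w => nth false w `|n%:Z + i|) (qP n).
  rewrite !nth_window; [|lia|lia]; rewrite /u => e.
  by rewrite (_ : i + (q n + n) = q n + `|n%:Z + i|%:Z) ?e; [congr y; lia | lia].
apply: (closed_cvg _ (proj1 sZ) _ _ cvu).
by apply: nearW => n; exact: subshift_shift_mem sZ Zz.
Qed.

(** Distinct labels of length [N k] give distinct words, as the blocks have equal
    lengths, and all of them occur at the next level. *)
Lemma hierarchy_complexity k : (2 ^ N k <= complexity hierarchy_shift (N k * size (s k)))%N.
Proof.
set n := (N k * size (s k))%N.
have szb (b : (N k).-tuple bool) : size (csubst (s k) (t k) b) == n.
  by rewrite size_csubst // size_tuple.
pose f (b : (N k).-tuple bool) : n.-tuple bool := Tuple (szb b).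
have finj : injective f.
  move=> b1 b2 /(congr1 val) /= e; apply: val_inj => /=.
  by apply: csubst_inj e => //; rewrite !size_tuple.
rewrite -[2%N]card_bool -card_tuple -(card_imset _ finj) /complexity.
apply: subset_leq_card; apply/fintype.subsetP => _ /imsetP[b _ ->]; rewrite inE.
have [|x Yx xw] := @language_extends (csubst (s k) (t k) b).
  by exists k.+1; exact: (contains_blocks (size_tuple b)).1.
apply: (ex_intro2 _ _ x Yx) => j; rewrite (tnth_nth false) /= -xw nth_window ?add0r //.
by rewrite (eqP (szb b)).
Qed.
End Hierarchy.

(** * Square summable sequences *)

Section SquareSummable.
Variable R : realType.
Implicit Types (f g u v w : int -> R) (x : int -> bool) (E c m M r : R) (N : nat).

Lemma nrm2_eq0 v : fsupp v -> nrm2 v = 0 -> forall n, v n = 0.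
Proof.
move=> sv v0 n; have := nrm2_ge n sv; rewrite v0 => h.
by apply/eqP; rewrite -sqrf_eq0 eq_le h sqr_ge0.
Qed.

Lemma cauchy_schwarz u v : fsupp u -> fsupp v -> ip u v ^+ 2 <= nrm2 u * nrm2 v.
Proof.
move=> su sv; have := nrm2_ge0 v; rewrite le_eqVlt => /orP[/eqP v0|v0].
  rewrite -v0 mulr0 (_ : ip u v = 0) ?expr0n //.
  have z := nrm2_eq0 sv (esym v0).
  rewrite /ip (@eq_tot _ _ (fun n => 0 * v n)); last by move=> n; rewrite z !mulr0.
  by rewrite totZ // mul0r.
have := nrm2_ge0 (fun n => nrm2 v * u n + - ip u v * v n).
rewrite nrm2D //.
have -> : nrm2 v ^+ 2 * nrm2 u + 2 * nrm2 v * - ip u v * ip u v + (- ip u v) ^+ 2 * nrm2 v =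
  nrm2 v * (nrm2 u * nrm2 v - ip u v ^+ 2) by ring.
by rewrite pmulr_rge0 // subr_ge0.
Qed.

Lemma nrm2D_sq a b u v : 0 <= a -> 0 <= b -> fsupp u -> fsupp v ->
  nrm2 u <= a ^+ 2 -> nrm2 v <= b ^+ 2 -> nrm2 (fun n => u n + v n) <= (a + b) ^+ 2.
Proof.
move=> a0 b0 su sv ua vb.
rewrite (_ : (fun n => _) = (fun n => 1 * u n + 1 * v n)); last by apply/funext => n; rewrite !mul1r.
rewrite nrm2D // !expr1n !mul1r !mulr1.
have : ip u v <= a * b.
  apply: le_trans (ler_norm _) _.
  rewrite -ler_sqr ?nnegrE ?mulr_ge0 // real_normK ?num_real // exprMn.
  apply: le_trans (cauchy_schwarz su sv) _.
  by apply: ler_pM; rewrite ?nrm2_ge0.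
by move=> h; rewrite sqrrD; lra.
Qed.

Definition cut N v (n : int) : R := if (`|n| <= N)%N then v n else 0.

Lemma fsupp_cut N v : fsupp (cut N v).
Proof. by exists N => n nN; rewrite /cut leqNgt nN. Qed.

Lemma nrm2_cut_le N v : fsupp v -> nrm2 (cut N v) <= nrm2 v.
Proof.
move=> sv; apply: tot_le; [exact/fsupp_sq/fsupp_cut | exact: fsupp_sq |] => n.
by rewrite /cut; case: ifP => // _; rewrite expr0n sqr_ge0.
Qed.

Lemma cutD N u v : cut N (fun n => u n + v n) = (fun n => cut N u n + cut N v n).
Proof. by apply/funext => n; rewrite /cut; case: ifP => // _; rewrite addr0. Qed.

Lemma cutZ N c v : cut N (fun n => c * v n) = (fun n => c * cut N v n).
Proof. by apply/funext => n; rewrite /cut; case: ifP => // _; rewrite mulr0. Qed.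

(** The squared norm of [v] is at most [M]; quantifying over finite windows spares
    any infinite sum. *)
Definition bd v M := forall N, nrm2 (cut N v) <= M.

Lemma bd_fsupp v : fsupp v -> bd v (nrm2 v).
Proof. by move=> sv N; exact: nrm2_cut_le. Qed.

Lemma bd_le v M M' : M <= M' -> bd v M -> bd v M'.
Proof. by move=> MM b N; exact: le_trans MM. Qed.

Lemma bd_ge0 v M : bd v M -> 0 <= M.
Proof. by move=> /(_ 0%N); apply: le_trans; exact: nrm2_ge0. Qed.

Lemma bd_coord v M n : bd v M -> v n ^+ 2 <= M.
Proof.
move=> /(_ `|n|%N); apply: le_trans.
by have := nrm2_ge n (fsupp_cut `|n|%N v); rewrite /cut leqnn.
Qed.

Lemma bdD a b u v : 0 <= a -> 0 <= b -> bd u (a ^+ 2) -> bd v (b ^+ 2) ->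
  bd (fun n => u n + v n) ((a + b) ^+ 2).
Proof. by move=> a0 b0 bu bv N; rewrite cutD; apply: nrm2D_sq => //; exact: fsupp_cut. Qed.

Lemma bdZ c v M : bd v M -> bd (fun n => c * v n) (c ^+ 2 * M).
Proof.
move=> bv N; rewrite cutZ nrm2Z; last exact: fsupp_cut.
by rewrite ler_wpM2l ?sqr_ge0.
Qed.

Lemma cut_hop N x E v : cut N (hop x E v) = cut N (hop x E (cut N.+1 v)).
Proof.
apply/funext => n; rewrite {1 2}/cut; case: ifP => // nN; rewrite /hop /cut.
by rewrite !ifT //; lia.
Qed.

(** A window of [T v] only depends on a larger window of [v]. *)
Lemma bd_local (T : (int -> R) -> int -> R) d k v M :
  (forall N u, cut N (T u) = cut N (T (cut (N + d) u))) -> 0 <= k ->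
  (forall u, fsupp u -> fsupp (T u) /\ nrm2 (T u) <= k * nrm2 u) ->
  bd v M -> bd (T v) (k * M).
Proof.
move=> loc k0 Tk bv N; rewrite loc.
have [s1 s2] := Tk _ (fsupp_cut (N + d) v).
apply: le_trans (nrm2_cut_le _ s1) _; apply: le_trans s2 _.
by rewrite ler_wpM2l.
Qed.

Definition hop_bound E : R := 3 * (2 + (1 + `|E|) ^+ 2).

Lemma hop_bound_gt0 E : 0 < hop_bound E.
Proof. by rewrite /hop_bound; have := sqr_ge0 (1 + `|E|); lra. Qed.

Lemma bd_hop x E v M : bd v M -> bd (hop x E v) (hop_bound E * M).
Proof.
apply: (@bd_local (hop x E) 1).
- by move=> N u; rewrite addn1; exact: cut_hop.
- exact/ltW/hop_bound_gt0.
- by move=> u su; split; [exact: fsupp_hop | exact: nrm2_hop_le].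
Qed.

Lemma tot_cut_sq N v : nrm2 (cut N v) = \sum_(i < N.*2.+1) v (- N%:Z + i%:Z) ^+ 2.
Proof.
rewrite /nrm2 (@tot_ball _ _ N).
  by apply: eq_bigr => i _; rewrite /cut ifT //; have := ltn_ord i; lia.
by move=> n nN; rewrite /cut leqNgt nN expr0n.
Qed.

Lemma cvg_sum_sq (p : nat -> nat -> R) (l : nat -> R) n :
  (forall i, p k i @[k --> \oo] --> l i) ->
  (\sum_(i < n) p k i ^+ 2) @[k --> \oo] --> \sum_(i < n) l i ^+ 2.
Proof.
move=> pl; elim: n => [|n IH].
  rewrite big_ord0 (_ : (fun k => _) = fun=> 0); first exact: cvg_cst.
  by apply/funext => k; rewrite big_ord0.
rewrite big_ord_recr /= (_ : (fun k => _) = fun k => \sum_(i < n) p k i ^+ 2 + p k n * p k n).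
  by apply: cvgD => //; apply: cvgM.
by apply/funext => k; rewrite big_ord_recr.
Qed.

Lemma bd_lim (p : nat -> int -> R) u M : (forall k, bd (p k) M) ->
  (forall n, p k n @[k --> \oo] --> u n) -> bd u M.
Proof.
move=> bp pu N; rewrite tot_cut_sq.
have := @cvg_sum_sq (fun k i => p k (- N%:Z + i%:Z)) (fun i => u (- N%:Z + i%:Z)) N.*2.+1 (fun i => pu _).
move/cvgr_to_le; apply; apply: nearW => k.
by rewrite -tot_cut_sq; exact: bp.
Qed.

Lemma cvg_geometric0 r c : 0 <= r < 1 -> (c * r ^+ k) @[k --> \oo] --> (0 : R).
Proof.
move=> /andP[r0 r1]; rewrite -(mulr0 c); apply: cvgMr.
by apply: cvg_expr; rewrite ger0_norm.
Qed.

Lemma cvg_dominated0 (p : nat -> R) r c : 0 <= r < 1 -> (forall k, p k ^+ 2 <= (c * r ^+ k) ^+ 2) ->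
  0 <= c -> p k @[k --> \oo] --> (0 : R).
Proof.
move=> r01 pc c0.
have b k : - (c * r ^+ k) <= p k <= c * r ^+ k.
  rewrite -ler_norml -ler_sqr ?nnegrE ?normr_ge0 //; last first.
    by rewrite mulr_ge0 // exprn_ge0 //; case/andP: r01.
  by rewrite real_normK ?num_real.
apply: (@squeeze_cvgr _ _ _ _ (fun k => - (c * r ^+ k)) (fun k => c * r ^+ k)).
- by apply: nearW.
- by rewrite -(oppr0 R); apply: cvgN; exact: cvg_geometric0.
- exact: cvg_geometric0.
Qed.

(** Completeness of the space of square summable sequences, for series with
    geometrically decaying terms. *)
Lemma geometric_series_bd (h : nat -> int -> R) r m : 0 <= r < 1 -> 0 <= m ->
  (forall j, bd (h j) ((m * r ^+ j) ^+ 2)) ->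
  exists2 u, bd u ((m / (1 - r)) ^+ 2) &
    forall n, (\sum_(j < k) h j n) @[k --> \oo] --> u n.
Proof.
move=> r01 m0 bh; have /andP[r0 r1] := r01.
have cv n : cvgn (fun k => \sum_(j < k) h j n).
  have -> : (fun k => \sum_(j < k) h j n) = series (fun j => h j n).
    by apply/funext => k; rewrite /series /= big_mkord.
  apply: normed_cvg; apply: series_le_cvg (is_cvg_geometric_series (a := m) (z := r) _).
  - by move=> j; exact: normr_ge0.
  - by move=> j; rewrite /geometric /= mulr_ge0 // exprn_ge0.
  - move=> j; rewrite /geometric /= -ler_sqr ?nnegrE ?normr_ge0 ?mulr_ge0 ?exprn_ge0 //.
    by rewrite real_normK ?num_real //; exact: bd_coord.
  - by rewrite ger0_norm.
exists (fun n => limn (fun k => \sum_(j < k) h j n)); last by move=> n; exact: cv.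
apply: bd_lim => [k|n]; last exact: cv.
have r1' : 0 < 1 - r by rewrite subr_gt0.
have gs j : \sum_(i < j) r ^+ i <= (1 - r)^-1.
  rewrite -(ler_pM2l r1') divff ?gt_eqF //.
  have -> : (1 - r) * \sum_(i < j) r ^+ i = 1 - r ^+ j.
    by rewrite -[RHS]opprB subrX1 -mulNr opprB.
  by rewrite gerBl exprn_ge0.
have s0 j : 0 <= \sum_(i < j) r ^+ i by apply: sumr_ge0 => i _; rewrite exprn_ge0.
apply: (@bd_le _ ((m * \sum_(i < k) r ^+ i) ^+ 2)).
  rewrite ler_sqr; [by rewrite ler_wpM2l | by rewrite nnegrE mulr_ge0 ?s0 |].
  by rewrite nnegrE divr_ge0 // ltW.
elim: k => [|k IH].
  move=> N; rewrite big_ord0 mulr0 expr0n /=.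
  rewrite (_ : cut N _ = fun n => 0 * cut N (h 0%N) n); last first.
    by apply/funext => n; rewrite /cut big_ord0 mul0r; case: ifP.
  by rewrite nrm2Z ?expr0n ?mul0r //; exact: fsupp_cut.
rewrite big_ord_recr /= mulrDr.
rewrite (_ : (fun n => _) = fun n => \sum_(j < k) h j n + h k n).
  by apply: bdD => //; apply: mulr_ge0; rewrite ?exprn_ge0 ?s0.
by apply/funext => n; rewrite big_ord_recr.
Qed.

Lemma cvg_hop x E (p : nat -> int -> R) u : (forall n, p k n @[k --> \oo] --> u n) ->
  forall n, hop x E (p k) n @[k --> \oo] --> hop x E u n.
Proof.
move=> pu n; rewrite /hop; apply: cvgD; first exact: cvgD.
by apply: cvgMr; exact: pu.
Qed.

(** The operator [(H - E)^2 + eta^2], that is [(H - z)(H - conj z)] at [z = E + i eta]. *)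
Definition sqop x E eta v (n : int) : R := hop x E (hop x E v) n + eta ^+ 2 * v n.
Definition relax_bound E eta : R := hop_bound E + 2 * eta ^+ 2.
(** One step of Richardson's iteration for the operator [sqop].  The step size is
    the inverse of a bound for its norm, so it contracts every vector on which the
    operator is bounded below. *)
Definition relax x E eta v (n : int) : R := v n - (relax_bound E eta)^-1 * sqop x E eta v n.

Lemma relax_bound_gt0 E eta : 0 < relax_bound E eta.
Proof. by rewrite /relax_bound; have := hop_bound_gt0 E; have := sqr_ge0 eta; lra. Qed.

Lemma fsupp_sqop x E eta v : fsupp v -> fsupp (sqop x E eta v).
Proof. by move=> sv; apply: fsuppD; [exact/fsupp_hop/fsupp_hop | exact: fsuppZ]. Qed.

Lemma fsupp_relax x E eta v : fsupp v -> fsupp (relax x E eta v).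
Proof.
move=> sv; apply: (fsupp_comb2 sv (@fsupp_sqop x E eta v sv)) => n.
by rewrite /relax => -> ->; rewrite mulr0 subr0.
Qed.

Lemma nrm2_relax x E eta c v : fsupp v ->
  c * nrm2 v <= nrm2 (hop x E v) + eta ^+ 2 * nrm2 v ->
  nrm2 (relax x E eta v) <= (1 - c / relax_bound E eta) * nrm2 v.
Proof.
move=> sv low; set C := relax_bound E eta; have C0 : 0 < C := relax_bound_gt0 E eta.
have sB := fsupp_hop x E sv; have sBB := fsupp_hop x E sB.
have sK := @fsupp_sqop x E eta v sv.
have e1 : ip v (sqop x E eta v) = nrm2 (hop x E v) + eta ^+ 2 * nrm2 v.
  have -> : nrm2 (hop x E v) = ip v (hop x E (hop x E v)).
    by rewrite -ip_hop // /nrm2 /ip; exact: eq_tot.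
  rewrite /ip /nrm2 -totZ; last exact: fsupp_sq.
  rewrite -totD; [|exact: fsuppM|exact/fsuppZ/fsupp_sq].
  by apply: eq_tot => n; rewrite /sqop; ring.
have e2 : nrm2 (sqop x E eta v) <= C * (nrm2 (hop x E v) + eta ^+ 2 * nrm2 v).
  rewrite /sqop (_ : (fun n => _) = fun n => 1 * hop x E (hop x E v) n + eta ^+ 2 * v n); last first.
    by apply/funext => n; rewrite mul1r.
  rewrite nrm2D // ip_hop // (_ : ip (hop x E v) (hop x E v) = nrm2 (hop x E v)); last first.
    exact: eq_tot.
  have h1 := nrm2_hop_le x E sB; have B0 := nrm2_ge0 (hop x E v); have v0 := nrm2_ge0 v.
  rewrite /C /relax_bound -/(hop_bound E) in h1 *.
  have h2 : 0 <= hop_bound E * (eta ^+ 2 * nrm2 v).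
    by rewrite mulr_ge0 ?(ltW (hop_bound_gt0 E)) // mulr_ge0 ?sqr_ge0.
  have h3 : 0 <= eta ^+ 2 * (eta ^+ 2 * nrm2 v).
    by rewrite mulr_ge0 ?sqr_ge0 // mulr_ge0 ?sqr_ge0.
  lra.
rewrite /relax (_ : (fun n => _) = fun n => 1 * v n + - C^-1 * sqop x E eta v n); last first.
  by apply/funext => n; rewrite mul1r mulNr.
rewrite nrm2D // e1.
have i0 : 0 < C^-1 by rewrite invr_gt0.
have h : C^-1 ^+ 2 * nrm2 (sqop x E eta v) <= C^-1 * (nrm2 (hop x E v) + eta ^+ 2 * nrm2 v).
  rewrite expr2 -mulrA ler_pM2l // -[X in _ <= X]mul1r -(mulVf (lt0r_neq0 C0)) -mulrA.
  by rewrite ler_pM2l.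
have h' : C^-1 * (c * nrm2 v) <= C^-1 * (nrm2 (hop x E v) + eta ^+ 2 * nrm2 v) by rewrite ler_pM2l.
rewrite sqrrN; lra.
Qed.

Lemma bd_relax x E eta k v M : 0 <= k ->
  (forall u, fsupp u -> nrm2 (relax x E eta u) <= k * nrm2 u) ->
  bd v M -> bd (relax x E eta v) (k * M).
Proof.
move=> k0 H; apply: (@bd_local (relax x E eta) 2) => //.
  move=> N u; apply/funext => n; rewrite {1 2}/cut; case: ifP => // nN.
  rewrite /relax /sqop /hop /cut.
  by rewrite !ifT //; lia.
by move=> u su; split; [exact: fsupp_relax | exact: H].
Qed.
End SquareSummable.

Section Solving.
Variable R : realType.
Implicit Types (f g u v w : int -> R) (x : int -> bool) (E eta c m M r : R).

Lemma cvg_sqop x E eta (p : nat -> int -> R) u : (forall n, p k n @[k --> \oo] --> u n) ->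
  forall n, sqop x E eta (p k) n @[k --> \oo] --> sqop x E eta u n.
Proof.
move=> pu n; apply: cvgD; first by apply: cvg_hop; exact: cvg_hop.
by apply: cvgMr; exact: pu.
Qed.

Lemma cvg_unique_real (f : nat -> R) (a b : R) : f k @[k --> \oo] --> a -> f k @[k --> \oo] --> b -> a = b.
Proof. by move=> fa fb; rewrite -(cvg_lim _ fa) // -(cvg_lim _ fb). Qed.

Lemma relax_rate E eta c : 0 < c -> exists r, [/\ 0 <= r < 1 &
  forall x v, fsupp v -> c * nrm2 v <= nrm2 (hop x E v) + eta ^+ 2 * nrm2 v ->
    nrm2 (relax x E eta v) <= r ^+ 2 * nrm2 v].
Proof.
move=> c0; pose C := relax_bound E eta; have C0 : 0 < C := relax_bound_gt0 E eta.
pose c' := Num.min c (C / 2); have c'0 : 0 < c' by rewrite lt_min c0 divr_gt0.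
have cC : c' / C <= 1 / 2 by rewrite ler_pdivrMr // mul1r mulrC ge_min lexx orbT.
have q0 : 0 <= 1 - c' / C by lra.
have q1 : 1 - c' / C < 1 by rewrite gtrBl divr_gt0.
exists (Num.sqrt (1 - c' / C)); split.
  by rewrite sqrtr_ge0 -[X in _ < X]sqrtr1 ltr_sqrt.
move=> x v sv low; rewrite sqr_sqrtr //; apply: nrm2_relax => //.
by apply: le_trans low; rewrite ler_wpM2r ?nrm2_ge0 // ge_min lexx.
Qed.

Lemma bd_iter_relax x E eta r g M j : 0 <= r ->
  (forall u, fsupp u -> nrm2 (relax x E eta u) <= r ^+ 2 * nrm2 u) ->
  bd g M -> bd (iter j (relax x E eta) g) ((r ^+ j) ^+ 2 * M).
Proof.
move=> r0 H bg; elim: j => [|j IH]; first by rewrite expr0 expr1n mul1r.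
rewrite iterS [r ^+ j.+1]exprS exprMn -mulrA; apply: bd_relax => //; exact: sqr_ge0.
Qed.

(** The Neumann series: the iterates of [relax] decay geometrically and their sum
    inverts the operator. *)
Lemma sqop_solvable x E eta c : 0 < c ->
    (forall v, fsupp v -> c * nrm2 v <= nrm2 (hop x E v) + eta ^+ 2 * nrm2 v) ->
  exists2 k, 0 <= k & forall g m, 0 <= m -> bd g (m ^+ 2) ->
    exists2 u, bd u ((k * m) ^+ 2) & sqop x E eta u =1 g.
Proof.
move=> c0 low; have [r [r01 H]] := relax_rate E eta c0.
have {}H u : fsupp u -> nrm2 (relax x E eta u) <= r ^+ 2 * nrm2 u.
  by move=> su; apply: H => //; exact: low.
have /andP[r0 r1] := r01.
pose C := relax_bound E eta; have C0 : 0 < C := relax_bound_gt0 E eta.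
exists (C^-1 / (1 - r)) => [|g m m0 bg].
  by rewrite divr_ge0 ?invr_ge0 ?(ltW C0) // subr_ge0 ltW.
pose h j := iter j (relax x E eta) (fun n => C^-1 * g n).
have bh j : bd (h j) ((C^-1 * m * r ^+ j) ^+ 2).
  rewrite exprMn mulrC; apply: bd_iter_relax => //.
  by rewrite exprMn; exact: bdZ.
have Cm0 : 0 <= C^-1 * m by rewrite mulr_ge0 // invr_ge0 ltW.
have [u bu cu] := geometric_series_bd r01 Cm0 bh.
exists u; first by rewrite mulrAC.
move=> n; have cK := @cvg_sqop x E eta _ _ cu n.
have eK k : sqop x E eta (fun n => \sum_(j < k) h j n) n = C * (h 0%N n - h k n).
  elim: k => [|k IH].
    by rewrite /sqop /hop !big_ord0; ring.
  have -> : (fun n => \sum_(j < k.+1) h j n) = (fun n => \sum_(j < k) h j n + h k n).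
    by apply/funext => i; rewrite big_ord_recr.
  have -> : sqop x E eta (fun n => \sum_(j < k) h j n + h k n) n =
     sqop x E eta (fun n => \sum_(j < k) h j n) n + sqop x E eta (h k) n.
    by rewrite /sqop /hop; ring.
  rewrite IH; have -> : h k.+1 n = h k n - C^-1 * sqop x E eta (h k) n by [].
  rewrite [RHS](_ : _ = C * (h 0%N n - h k n) + C * C^-1 * sqop x E eta (h k) n); last by ring.
  by rewrite mulfV ?gt_eqF // mul1r.
apply: (cvg_unique_real cK); under eq_fun do rewrite eK.
have -> : g n = C * (h 0%N n - 0) by rewrite subr0 /h /= mulrA mulfV ?gt_eqF // mul1r.
apply: cvgMr; apply: cvgB; first exact: cvg_cst.
apply: (@cvg_dominated0 _ _ r (C^-1 * m)) => // k.
by apply: le_trans (bd_coord n (bh k)) _.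
Qed.

Lemma sqop_injective x E eta c u M : 0 < c ->
    (forall v, fsupp v -> c * nrm2 v <= nrm2 (hop x E v) + eta ^+ 2 * nrm2 v) ->
  bd u M -> (forall n, sqop x E eta u n = 0) -> forall n, u n = 0.
Proof.
move=> c0 low bu Ku; have [r [r01 H]] := relax_rate E eta c0.
have {}H v : fsupp v -> nrm2 (relax x E eta v) <= r ^+ 2 * nrm2 v.
  by move=> sv; apply: H => //; exact: low.
have /andP[r0 r1] := r01.
have fix_u j : iter j (relax x E eta) u = u.
  elim: j => // j IH; rewrite iterS IH; apply/funext => n.
  by rewrite /relax Ku mulr0 subr0.
move=> n; have M0 := bd_ge0 bu.
apply: (@cvg_unique_real (fun=> u n)); first exact: cvg_cst.
apply: (@cvg_dominated0 _ _ r (Num.sqrt M)) => // k.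
rewrite exprMn sqr_sqrtr // mulrC -{1}(fix_u k).
exact/bd_coord/bd_iter_relax.
Qed.

(** If the range of [H - E] is bounded below, by [d], then an approximate
    eigenvector is close to an exact one: the iteration only changes it by
    elements of the range, on which it contracts. *)
Lemma kernel_near x E d : 0 < d ->
    (forall v, fsupp v -> d * nrm2 (hop x E v) <= nrm2 (hop x E (hop x E v))) ->
  exists2 k, 0 <= k & forall u, fsupp u -> exists w,
    [/\ forall n, hop x E w n = 0,
        bd (fun n => w n - u n) (k * nrm2 (hop x E u)) & exists M, bd w M].
Proof.
move=> d0 low; have [r [r01 H]] := relax_rate E 0 d0; have /andP[r0 r1] := r01.
pose C := relax_bound E 0; have C0 : 0 < C := relax_bound_gt0 E 0.
pose b := Num.sqrt (hop_bound E); have bb : b ^+ 2 = hop_bound E.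
  by rewrite sqr_sqrtr // ltW // hop_bound_gt0.
pose K := C^-1 * b / (1 - r).
exists (K ^+ 2) => [|u su]; first exact: sqr_ge0.
pose h j := iter j (relax x E 0) u.
have sh j : fsupp (h j) by elim: j => // j IH; exact: fsupp_relax.
pose A := nrm2 (hop x E u); have A0 : 0 <= A := nrm2_ge0 _.
have hA j : nrm2 (hop x E (h j)) <= (r ^+ j) ^+ 2 * A.
  elim: j => [|j IH]; first by rewrite expr0 expr1n mul1r.
  have -> : hop x E (h j.+1) = relax x E 0 (hop x E (h j)).
    by apply/funext => n; rewrite /h iterS -/(h j) /relax /sqop /hop; ring.
  apply: le_trans (H x _ (fsupp_hop x E (sh j)) _) _.
    by rewrite expr0n /= mul0r addr0; exact: low.
  rewrite [r ^+ j.+1]exprS exprMn -[X in _ <= X]mulrA; apply: ler_wpM2l; [exact: sqr_ge0 | exact: IH].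
pose sq := Num.sqrt A; have sqA : sq ^+ 2 = A by rewrite sqr_sqrtr.
pose st j n := - C^-1 * hop x E (hop x E (h j)) n.
have bst j : bd (st j) ((C^-1 * b * sq * r ^+ j) ^+ 2).
  have -> : (C^-1 * b * sq * r ^+ j) ^+ 2 = (- C^-1) ^+ 2 * (hop_bound E * ((r ^+ j) ^+ 2 * A)).
    by rewrite !exprMn bb sqA sqrrN; ring.
  apply: bdZ; apply: bd_hop; apply: bd_le (hA j) _.
  by apply: bd_fsupp; exact: fsupp_hop.
have m0 : 0 <= C^-1 * b * sq by rewrite !mulr_ge0 ?invr_ge0 ?sqrtr_ge0 // ltW.
have [s bs cs] := geometric_series_bd r01 m0 bst.
have hE k n : h k n = u n + \sum_(j < k) st j n.
  elim: k => [|k IH]; first by rewrite big_ord0 addr0.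
  have -> : h k.+1 n = h k n - C^-1 * sqop x E 0 (h k) n by [].
  by rewrite big_ord_recr /= addrA -IH /sqop expr0n /= mul0r addr0 /st mulNr.
have ch n : h k n @[k --> \oo] --> u n + s n.
  under eq_fun do rewrite hE.
  by apply: cvgD; [exact: cvg_cst | exact: cs].
exists (fun n => u n + s n); split.
- move=> n; apply: (@cvg_unique_real (fun k => hop x E (h k) n)); first exact: cvg_hop.
  apply: (@cvg_dominated0 _ _ r sq) => // [k|]; last exact: sqrtr_ge0.
  rewrite exprMn sqA mulrC; apply: le_trans (hA k).
  exact/nrm2_ge/fsupp_hop.
- have -> : (fun n => u n + s n - u n) = s by apply/funext => n; rewrite addrC addKr.
  by apply: bd_le bs; rewrite /K -/A -sqA -exprMn mulrAC.
- have nu0 := nrm2_ge0 u; exists ((Num.sqrt (nrm2 u) + C^-1 * b * sq / (1 - r)) ^+ 2).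
  apply: bdD => //.
    by rewrite divr_ge0 // subr_ge0 ltW.
  by rewrite sqr_sqrtr //; exact: bd_fsupp.
Qed.

(** The spectrum of the operator with potential [x]; Weyl's criterion is the
    definition here, and becomes a theorem at the end. *)
Definition spec x : set R := apspec (fun x' _ => x' = x).

Lemma not_specP x E : ~ spec x E ->
  exists2 c, 0 < c & forall v, fsupp v -> c * nrm2 v <= nrm2 (hop x E v).
Proof. by move=> /not_apspecP[c c0 cP]; exists c => // v; exact: cP. Qed.

(** The infimum [m] of the quotients of [|(H - E) v|^2] by [|v|^2] is a value of
    [(t - E)^2] on the spectrum, because on near minimizers [(H - E)^2 - m], the product of
    [H - E - sqrt m] and [H - E + sqrt m], is small by Cauchy and Schwarz. *)
Lemma gap_lower_bound x E r : 0 < r -> (forall e, `|e - E| < r -> ~ spec x e) ->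
  forall v, fsupp v -> r ^+ 2 * nrm2 v <= nrm2 (hop x E v).
Proof.
move=> r0 gap v0 sv0; rewrite leNgt; apply/negP => lt0.
have v00 : 0 < nrm2 v0 by apply: apspec_nrm2_gt0 lt0; rewrite exprn_gt0.
pose Q := [set q | exists v, [/\ fsupp v, 0 < nrm2 v & q = nrm2 (hop x E v) / nrm2 v]].
have Qv v : fsupp v -> 0 < nrm2 v -> Q (nrm2 (hop x E v) / nrm2 v) by move=> *; exists v.
have Q0 : lbound Q 0 by move=> _ [v [_ h ->]]; rewrite divr_ge0 ?nrm2_ge0.
have infQ : has_inf Q by split; [exists (nrm2 (hop x E v0) / nrm2 v0); exact: Qv | exists 0].
pose m := inf Q.
have m0 : 0 <= m by apply: lb_le_inf => //; exact: infQ.1.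
have mlt : m < r ^+ 2.
  apply: le_lt_trans (ge_inf infQ.2 (Qv v0 sv0 v00)) _.
  by rewrite ltr_pdivrMr.
have mP v : fsupp v -> m * nrm2 v <= nrm2 (hop x E v).
  move=> sv; have := nrm2_ge0 v; rewrite le_eqVlt => /orP[/eqP <-|h].
    by rewrite mulr0 nrm2_ge0.
  rewrite -ler_pdivlMr //; apply: (ge_inf infQ.2); exact: Qv.
pose mu := Num.sqrt m; have mumu : mu ^+ 2 = m by rewrite sqr_sqrtr.
have mu0 : 0 <= mu := sqrtr_ge0 _.
have mur : mu < r by rewrite -ltr_sqr ?nnegrE ?(ltW r0) // mumu.
have [|c1 c10 c1P] := @not_specP x (E + mu).
  by apply: gap; rewrite addrC addKr ger0_norm.
have [|c2 c20 c2P] := @not_specP x (E - mu).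
  by apply: gap; rewrite addrC addKr normrN ger0_norm.
pose T v n := hop x E (hop x E v) n - m * v n.
have TE v : T v = hop x (E + mu) (hop x (E - mu) v).
  by apply/funext => n; rewrite /T -mumu /hop; ring.
have sT v : fsupp v -> fsupp (T v) by move=> sv; rewrite TE; exact/fsupp_hop/fsupp_hop.
have low v : fsupp v -> c1 * c2 * nrm2 v <= nrm2 (T v).
  move=> sv; rewrite TE; apply: le_trans (c1P _ (fsupp_hop x _ sv)).
  by rewrite -mulrA ler_pM2l //; exact: c2P.
pose b := hop_bound E; have b0 : 0 < b := hop_bound_gt0 E.
have up v : fsupp v -> nrm2 (T v) <= b * (nrm2 (hop x E v) - m * nrm2 v).
  move=> sv; have st := sT v sv; pose w n := 1 * v n + - b^-1 * T v n.
  have sw : fsupp w by apply: fsuppD; exact: fsuppZ.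
  have := mP w sw.
  have -> : hop x E w = fun n => 1 * hop x E v n + - b^-1 * hop x E (T v) n.
    by apply/funext => n; exact: hop_lin.
  rewrite !nrm2D //; try exact: fsupp_hop.
  have e : ip (hop x E v) (hop x E (T v)) - m * ip v (T v) = nrm2 (T v).
    rewrite -ip_hop //; last exact: fsupp_hop.
    rewrite -mulNr /ip -totZ; last exact: fsuppM.
    rewrite -totD; [|exact/fsuppM/fsupp_hop/fsupp_hop|exact/fsuppZ/fsuppM].
    by apply: eq_tot => n; rewrite /T; ring.
  have h1 := nrm2_hop_le x E st; rewrite -/(hop_bound E) -/b in h1.
  have h2 : b^-1 ^+ 2 * nrm2 (hop x E (T v)) <= b^-1 * nrm2 (T v).
    rewrite expr2 -mulrA ler_pM2l ?invr_gt0 //.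
    by rewrite ler_pdivrMl.
  have h3 : 0 <= m * (b^-1 ^+ 2 * nrm2 (T v)).
    by apply: mulr_ge0 => //; apply: mulr_ge0; [exact: sqr_ge0 | exact: nrm2_ge0].
  have e' : b^-1 * ip (hop x E v) (hop x E (T v)) - m * (b^-1 * ip v (T v)) = b^-1 * nrm2 (T v).
    by rewrite -e; ring.
  rewrite -ler_pdivrMl //; move: e' h2 h3; rewrite !sqrrN expr1n; lra.
have eps0 : 0 < c1 * c2 / (2 * b) by rewrite divr_gt0 ?mulr_gt0.
have [_ [v [sv vp ->]] near_min] := inf_adherent eps0 infQ.
rewrite -/m ltr_pdivrMr // in near_min.
have := le_trans (low v sv) (up v sv); apply/negP; rewrite -ltNge.
apply: (@lt_trans _ _ (b * (c1 * c2 / (2 * b) * nrm2 v))).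
  by rewrite ltr_pM2l //; lra.
rewrite [X in X < _](_ : _ = c1 * c2 * nrm2 v / 2); last by field; rewrite gt_eqF.
by have : 0 < c1 * c2 * nrm2 v; [rewrite !mulr_gt0 | lra].
Qed.

(** With an empty spectrum the gap could be as wide as wanted, and would contradict
    the boundedness of the operator. *)
Lemma spec_nonempty x : spec x !=set0.
Proof.
apply: contrapT => no; pose v (n : int) : R := if n == 0 then 1 else 0.
have sv : fsupp v by exists 0%N => n n0; rewrite /v ifF //; apply/eqP; lia.
have v0 : 0 < nrm2 v.
  have := @nrm2_ge _ v 0 sv; rewrite /v eqxx expr1n; lra.
pose r := hop_bound (0 : R) + 1; have h0 := hop_bound_gt0 (0 : R).
have := @gap_lower_bound x 0 r; rewrite /r => /(_ _ _ v sv).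
have h := nrm2_hop_le x 0 sv; rewrite -/(hop_bound 0) in h.
move=> /(_ _ _)/le_trans /(_ h) H.
have : (hop_bound 0 + 1) ^+ 2 * nrm2 v <= hop_bound 0 * nrm2 v.
  apply: H; first by lra.
  by move=> e _ es; apply: no; exists e.
rewrite ler_pM2r // => {}H; have := sqr_ge0 (hop_bound (0 : R)).
by move: H h0; move: (hop_bound _) => z; nra.
Qed.

(** Around an isolated point [E] of the spectrum, both [E + d] and [E - d] are at
    distance [d] of the spectrum, which makes [|<(H - E) v, v>|] at most
    [|(H - E) v|^2 / 2d]; polarization turns this into a lower bound on the range. *)
Lemma isolated_range_bound x E d : 0 < d ->
    (forall e, `|e - E| < 2 * d -> spec x e -> e = E) ->
  forall v, fsupp v -> d ^+ 2 * nrm2 (hop x E v) <= nrm2 (hop x E (hop x E v)).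
Proof.
move=> d0 iso; have form (s : R) v : s ^+ 2 = 1 -> fsupp v ->
    2 * d * (s * ip (hop x E v) v) <= nrm2 (hop x E v).
  move=> s1 sv; have := @gap_lower_bound x (E + s * d) d d0 _ v sv.
  have -> : hop x (E + s * d) v = fun n => 1 * hop x E v n + - (s * d) * v n.
    by apply/funext => n; rewrite (hopE x E); ring.
  rewrite nrm2D //; last exact: fsupp_hop.
  rewrite sqrrN exprMn s1 expr1n => /(_ _) h.
  suff : d ^+ 2 * nrm2 v <= 1 * nrm2 (hop x E v) + 2 * 1 * - (s * d) * ip (hop x E v) v + 1 * d ^+ 2 * nrm2 v by lra.
  apply: h => e ed es; have sgn : `|s| = 1 by apply/eqP; rewrite -sqrp_eq1 // real_normK ?num_real // s1.
  have eE : e = E.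
    apply: iso es; rewrite (_ : e - E = e - (E + s * d) + s * d); last by ring.
    apply: le_lt_trans (ler_normD _ _) _.
    by rewrite normrM sgn mul1r (gtr0_norm d0); lra.
  move: ed; rewrite eE opprD addNKr normrN normrM sgn mul1r gtr0_norm // ltxx.
  by [].
move=> v sv; pose B := hop x E; have sB := fsupp_hop x E sv; have sBB := fsupp_hop x E sB.
pose w1 n := 1 * v n + d^-1 * B v n; pose w2 n := 1 * v n + - d^-1 * B v n.
have s1 : fsupp w1 by apply: fsuppD; exact: fsuppZ.
have s2 : fsupp w2 by apply: fsuppD; exact: fsuppZ.
have m11 : (-1 : R) ^+ 2 = 1 by rewrite sqrrN expr1n.
have F1 := form 1 w1 (expr1n _ _) s1; have F2 := form (-1) w2 m11 s2.
have Bw1 : hop x E w1 = fun n => 1 * B v n + d^-1 * B (B v) n by apply/funext => n; exact: hop_lin.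
have Bw2 : hop x E w2 = fun n => 1 * B v n + - d^-1 * B (B v) n by apply/funext => n; exact: hop_lin.
have ipw (c : R) : ip (fun n => 1 * B v n + c * B (B v) n) (fun n => 1 * v n + c * B v n) =
   ip (B v) v + 2 * c * nrm2 (B v) + c ^+ 2 * ip (B (B v)) (B v).
  have e : ip (B (B v)) v = nrm2 (B v) by rewrite /B ip_hop //; exact: eq_tot.
  have -> : 2 * c * nrm2 (B v) = c * ip (B v) (B v) + c * ip (B (B v)) v.
    by rewrite e (_ : ip (B v) (B v) = nrm2 (B v)); [ring | exact: eq_tot].
  have t1 : fsupp (fun n => B v n * v n) := fsuppM v sB.
  have t2 : fsupp (fun n => B v n * B v n) := fsuppM (B v) sB.
  have t3 : fsupp (fun n => B (B v) n * v n) := fsuppM v sBB.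
  have t4 : fsupp (fun n => B (B v) n * B v n) := fsuppM (B v) sBB.
  rewrite /ip -(totZ c t2) -(totZ c t3) -(totZ (c ^+ 2) t4).
  have u23 := fsuppD (fsuppZ c t2) (fsuppZ c t3).
  rewrite -(totD (fsuppZ c t2) (fsuppZ c t3)) -(totD t1 u23).
  rewrite -(totD (fsuppD t1 u23) (fsuppZ (c ^+ 2) t4)).
  by apply: eq_tot => n; ring.
rewrite Bw1 /w1 !ipw !nrm2D // in F1; rewrite Bw2 /w2 !ipw !nrm2D // in F2.
have d1 : d * d^-1 = 1 by rewrite divff ?gt_eqF.
have := nrm2_ge0 (B (B v)); rewrite -/B; move: F1 F2; rewrite !sqrrN !expr1n.
move: (ip (B v) v) (ip (B (B v)) (B v)) (ip (B v) (B (B v))) (nrm2 (B v)) (nrm2 (B (B v))) => p q s n1 n2 F1 F2 n20.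
have G : 8 * (d * d^-1) * n1 <= 2 * n1 + 2 * d^-1 ^+ 2 * n2 by lra.
have : d ^+ 2 * (6 * n1) <= d ^+ 2 * (2 * d^-1 ^+ 2 * n2).
  by rewrite ler_pM2l ?exprn_gt0 //; move: G; rewrite d1; lra.
rewrite (_ : d ^+ 2 * (2 * d^-1 ^+ 2 * n2) = 2 * (d * d^-1) ^+ 2 * n2); last by ring.
by rewrite d1 expr1n mulr1; lra.
Qed.
End Solving.

(** * Recurrent potentials *)

Section Recurrence.
Variable R : realType.
Implicit Types (f u v w : int -> R) (x y : int -> bool) (E d M : R).

(** Occurrences arbitrarily far to the right are asked for, so that a recurrent
    sequence has disjoint copies of the same window. *)
Definition recurs x y := forall p n q, exists2 q', q <= q' & window y q' n = window x p n.

Lemma hop_translate x y v k E : (forall m, v m != 0 -> y (m + k) = x m) ->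
  hop y E (fun m => v (m - k)) =1 (fun n => hop x E v (n - k)).
Proof.
move=> xy n; rewrite /hop.
have -> : n - 1 - k = n - k - 1 by lia.
have -> : n + 1 - k = n - k + 1 by lia.
have [v0|v0] := eqVneq (v (n - k)) 0; first by rewrite v0 !mulr0.
by have := xy _ v0; rewrite subrK => ->.
Qed.

Lemma nrm2_translate v k : nrm2 (fun m => v (m - k)) = nrm2 v.
Proof. exact: (tot_shift (fun m => v m ^+ 2) (- k)). Qed.

Lemma recurs_translate x y v (N : nat) q : recurs x y ->
  (forall m : int, (N < `|m|)%N -> v m = 0) ->
  exists2 k, q <= k - N%:Z & forall m, v m != 0 -> y (m + k) = x m.
Proof.
move=> rxy vN; have [q' qq' e] := rxy (- N%:Z) N.*2.+1 q.
exists (q' + N%:Z); first by lia.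
move=> m vm; have mN : (`|m| <= N)%N.
  by rewrite leqNgt; apply/negP => /vN h; rewrite h eqxx in vm.
have := congr1 (fun s => nth false s (absz (m + N%:Z)%R)) e.
rewrite !nth_window; [|lia|lia] => h.
rewrite [LHS](_ : _ = y (q' + (absz (m + N%:Z)%R)%:Z)); last by congr y; lia.
by rewrite h; congr x; lia.
Qed.

Lemma spec_recurs x y : recurs x y -> @spec R x `<=` @spec R y.
Proof.
move=> rxy E xE c c0; have [_ [v [-> sv lt]]] := xE c c0.
have [N vN] := sv; have [k _ vk] := recurs_translate 0 rxy vN.
exists y, (fun m => v (m - k)); split => //; first exact: fsupp_shift.
by rewrite (funext (hop_translate E vk)) !nrm2_translate.
Qed.

Lemma bd_window f M (p : int) n : bd f M -> \sum_(i < n) f (p + i%:Z) ^+ 2 <= M.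
Proof.
move=> bf; pose g m := if (p <= m) && (m < p + n%:Z) then f m ^+ 2 else 0.
pose K := (`|p| + n)%N; apply: le_trans (bf K).
rewrite (_ : \sum_(i < n) _ = tot g).
  apply: tot_le; [|exact/fsupp_sq/fsupp_cut|].
    by exists K => m mK; rewrite /g ifF //; rewrite /K in mK; lia.
  move=> m; rewrite /g /cut; case: ifP => [h|_]; last exact: sqr_ge0.
  by rewrite ifT // /K; lia.
rewrite (@tot_window _ g p n) => [|m].
  by apply: eq_bigr => i _; rewrite /g ifT //; have := ltn_ord i; lia.
by rewrite /g; case: ifP => // _; rewrite eqxx.
Qed.

Lemma kernel_zero x E f m : (forall n, hop x E f n = 0) -> f m = 0 -> f (m + 1) = 0 ->
  forall n, f n = 0.
Proof.
move=> hf f0 f1.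
have fwd (j : nat) : f (m + j%:Z) = 0 /\ f (m + j%:Z + 1) = 0.
  elim: j => [|j [h1 h2]]; first by rewrite addr0.
  have e : m + j.+1%:Z = m + j%:Z + 1 by lia.
  rewrite e; split => //; have := hf (m + j%:Z + 1).
  by rewrite /hop addrK h1 h2 mulr0 addr0 add0r.
have bwd (j : nat) : f (m - j%:Z) = 0 /\ f (m - j%:Z + 1) = 0.
  elim: j => [|j [h1 h2]]; first by rewrite subr0.
  have e : m - j.+1%:Z = m - j%:Z - 1 by lia.
  rewrite e subrK; split => //; have := hf (m - j%:Z).
  by rewrite /hop h1 h2 mulr0 !addr0.
move=> n; have [h|h] := leP m n.
  by have [e _] := fwd (absz (n - m)%R); rewrite -e; congr f; lia.
by have [e _] := bwd (absz (m - n)%R); rewrite -e; congr f; lia.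
Qed.

(** The Wronskian of two solutions is constant, and summable when both are square
    summable; hence it is zero. *)
Lemma kernel_parallel x E w1 w2 M1 M2 : (forall n, hop x E w1 n = 0) ->
  (forall n, hop x E w2 n = 0) -> bd w1 M1 -> bd w2 M2 ->
  forall n m, w1 n * w2 m = w1 m * w2 n.
Proof.
move=> h1 h2 b1 b2; pose W n := w1 n * w2 (n + 1) - w1 (n + 1) * w2 n.
have Wc n : W n = W (n - 1).
  have := h1 n; have := h2 n; rewrite /hop /W subrK.
  move: (w1 (n - 1)) (w1 n) (w1 (n + 1)) => a b c.
  move: (w2 (n - 1)) (w2 n) (w2 (n + 1)) => a' b' c' e' e.
  have -> : c = - a - ((x n)%:R - E) * b by lra.
  have -> : c' = - a' - ((x n)%:R - E) * b' by lra.
  by ring.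
have W0 n : W n = W 0.
  have fwd (j : nat) : W j%:Z = W 0.
    by elim: j => // j <-; rewrite Wc; congr W; lia.
  have bwd (j : nat) : W (- j%:Z) = W 0.
    elim: j => [|j <-]; first by rewrite oppr0.
    by rewrite [RHS]Wc; congr W; lia.
  by case: n => j; [exact: fwd | rewrite NegzE; exact: bwd].
have bound (K : nat) : K%:R * (2 * `|W 0|) <= 2 * M1 + 2 * M2.
  have s1 := bd_window 0 K b1; have s2 := bd_window 1 K b1.
  have s3 := bd_window 0 K b2; have s4 := bd_window 1 K b2.
  apply: (@le_trans _ _ (\sum_(i < K) (w1 (0 + i%:Z) ^+ 2 + w1 (1 + i%:Z) ^+ 2 +
      (w2 (0 + i%:Z) ^+ 2 + w2 (1 + i%:Z) ^+ 2)))); last first.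
    by rewrite !big_split /=; lra.
  rewrite mulr_natl -[K in X in X <= _]card_ord -sumr_const; apply: ler_sum => i _.
  rewrite -(W0 i%:Z) /W add0r [1 + _]addrC.
  move: (w1 i%:Z) (w1 (i%:Z + 1)) (w2 i%:Z) (w2 (i%:Z + 1)) => a b c e.
  apply: (@le_trans _ _ (2 * (`|a * e| + `|b * c|))); first by rewrite ler_pM2l // ler_normB.
  rewrite !normrM -(real_normK (num_real a)) -(real_normK (num_real b))
    -(real_normK (num_real c)) -(real_normK (num_real e)).
  by have := sqr_ge0 (`|a| - `|e|); have := sqr_ge0 (`|b| - `|c|); lra.
have W00 : W 0 = 0.
  apply/eqP; rewrite -normr_eq0; apply/eqP/le_anti; rewrite normr_ge0 andbT leNgt; apply/negP => W0p.
  have q0 : 0 <= (2 * M1 + 2 * M2) / (2 * `|W 0|).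
    by rewrite divr_ge0 ?addr_ge0 ?mulr_ge0 ?(bd_ge0 b1) ?(bd_ge0 b2).
  have := archi_boundP q0; rewrite ltr_pdivrMr ?mulr_gt0 //.
  by apply/negP; rewrite -leNgt.
move=> n m; apply/eqP; rewrite -subr_eq0; apply/eqP.
apply: (@kernel_zero x E (fun n => w1 n * w2 m - w1 m * w2 n) m).
- move=> k; transitivity (w2 m * hop x E w1 k - w1 m * hop x E w2 k).
    by rewrite /hop; ring.
  by rewrite h1 h2 !mulr0 subrr.
- by rewrite subrr.
- by have := W0 m; rewrite W00 /W => h; lra.
Qed.

(** An isolated point of the spectrum would be an eigenvalue, with eigenvectors
    concentrated near each of two distant copies of the support of the same approximate
    eigenvector; they could not be parallel. *)
Lemma spec_no_isolated x E d : recurs x x -> @spec R x E -> 0 < d ->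
  exists e, [/\ @spec R x e, e != E & `|e - E| < d].
Proof.
move=> rxx xE d0; apply: contrapT => no.
have d2 : 0 < d / 2 by rewrite divr_gt0.
have iso e : `|e - E| < 2 * (d / 2) -> @spec R x e -> e = E.
  rewrite mulrC divfK // => ed ee; apply/eqP; apply/negPn/negP => ne.
  by apply: no; exists e.
have low := isolated_range_bound d2 iso.
have [k k0 near_k] := @kernel_near _ x E _ (exprn_gt0 2 d2) low.
pose c : R := (16 * (k + 1))^-1.
have c0 : 0 < c by rewrite invr_gt0 mulr_gt0 //; lra.
have [_ [u [-> su lt]]] := xE c c0.
pose U := nrm2 u; have U0 : 0 < U := apspec_nrm2_gt0 c0 lt.
have kc : k * nrm2 (hop x E u) <= U / 16.
  apply: (@le_trans _ _ (k * (c * U))); first by rewrite ler_wpM2l // ltW.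
  rewrite mulrA [U / 16]mulrC ler_wpM2r ?(ltW U0) // /c invfM mulrCA ger_pMr ?invr_gt0 //.
  by rewrite ler_pdivrMr; lra.
have [N uN] := su.
have [q qN xq] := recurs_translate N.+1%:Z rxx uN.
pose u2 m := u (m - q); have su2 : fsupp u2 by exact: fsupp_shift.
have B2 : nrm2 (hop x E u2) = nrm2 (hop x E u).
  by rewrite (funext (hop_translate E xq)) nrm2_translate.
have [w1 [hw1 bw1 [M1 bM1]]] := near_k u su.
have [w2 [hw2 bw2 [M2 bM2]]] := near_k u2 su2.
rewrite B2 in bw2; have {bw1 bw2} [bw1 bw2] := (bd_le kc bw1, bd_le kc bw2).
pose S f p := \sum_(i < N.*2.+1) f (p + i%:Z) ^+ 2.
pose p1 := - N%:Z; pose p2 := q - N%:Z.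
have S1 : S u p1 = U by rewrite /S /U /nrm2 (@tot_ball _ _ N) // => n nN; rewrite uN // expr0n.
have S2 : S u2 p2 = U.
  by rewrite -S1; apply: eq_bigr => i _; rewrite /u2 /p2 /p1; congr (u _ ^+ 2); lia.
have big w v p : S v p = U -> bd (fun n => w n - v n) (U / 16) -> 7 / 16 * U <= S w p.
  move=> Sv bw; have h := bd_window p N.*2.+1 bw.
  have : U / 2 - U / 16 <= S w p; last by lra.
  apply: (@le_trans _ _ (U / 2 - \sum_(i < N.*2.+1) (w (p + i%:Z) - v (p + i%:Z)) ^+ 2)).
    by rewrite lerD2l lerN2.
  rewrite -Sv /S mulr_suml -sumrB; apply: ler_sum => i _.
  have := sqr_ge0 (2 * (w (p + i%:Z) - v (p + i%:Z)) + v (p + i%:Z)).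
  by move: (w _) (v _) => a b; lra.
have little w v p : (forall i : nat, (i < N.*2.+1)%N -> v (p + i%:Z) = 0) ->
    bd (fun n => w n - v n) (U / 16) -> S w p <= U / 16.
  move=> v0 bw; apply: le_trans (bd_window p N.*2.+1 bw).
  by rewrite le_eqVlt; apply/orP; left; apply/eqP; apply: eq_bigr => i _; rewrite v0 ?subr0.
have b11 := big _ _ _ S1 bw1; have b22 := big _ _ _ S2 bw2.
have b12 : S w1 p2 <= U / 16.
  by apply: little bw1 => i iN; apply: uN; rewrite /p2; clear -qN iN; lia.
have b21 : S w2 p1 <= U / 16.
  by apply: little bw2 => i iN; apply: uN; rewrite /p1; clear -qN iN; lia.
have par := kernel_parallel hw1 hw2 bM1 bM2.
have det : S w1 p1 * S w2 p2 = S w1 p2 * S w2 p1.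
  rewrite {1}/S mulr_suml [RHS]mulrC {1}/S mulr_suml; apply: eq_bigr => i _.
  rewrite /S !mulr_sumr; apply: eq_bigr => j _.
  by rewrite -!exprMn; congr (_ ^+ 2); rewrite par mulrC.
have h1 : (7 / 16 * U) * (7 / 16 * U) <= S w1 p1 * S w2 p2 by apply: ler_pM => //; lra.
have S0 f p : 0 <= S f p by apply: sumr_ge0 => i _; exact: sqr_ge0.
have h2 : S w1 p2 * S w2 p1 <= (U / 16) * (U / 16) by apply: ler_pM.
by have := mulr_gt0 U0 U0; move: h1; rewrite det; move: h2; lra.
Qed.
End Recurrence.

(** * The spectrum of the operator on square summable sequences *)

Section Resolvent.
Variable R : realType.
Implicit Types (E eta c M : R) (x : full_shift).

Definition cre (u : int -> R[i]^o) (n : int) : R := complex.Re (u n).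
Definition cim (u : int -> R[i]^o) (n : int) : R := complex.Im (u n).

Definition ell2_nrm2 (u : ell2 R) : R :=
  fine (\esum_(n in [set: int]) (Normc.normc (u n) ^+ 2)%:E).

Lemma normc_sq (z : R[i]) : Normc.normc z ^+ 2 = complex.Re z ^+ 2 + complex.Im z ^+ 2.
Proof. by case: z => a b /=; rewrite sqr_sqrtr // addr_ge0 ?sqr_ge0. Qed.

Definition partial_nrm2 N (u : int -> R[i]^o) : R := nrm2 (cut N (cre u)) + nrm2 (cut N (cim u)).

Lemma partial_nrm2E N u :
  partial_nrm2 N u = \sum_(n \in [set n : int | (`|n| <= N)%N]) Normc.normc (u n) ^+ 2.
Proof.
rewrite /partial_nrm2 /nrm2 -totD; try exact/fsupp_sq/fsupp_cut.
rewrite /tot -(@fsbig_widen _ _ _ _ [set n : int | (`|n| <= N)%N]) //.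
  by apply: eq_fsbigr => n; rewrite inE /= => nN; rewrite /cut nN normc_sq.
by move=> n [_ /= /negP/negbTE nN]; rewrite /cut nN !expr0n addr0.
Qed.

Lemma finite_ball N : finite_set [set n : int | (`|n| <= N)%N].
Proof.
apply: (@sub_finite_set _ _ [set (i%:Z - N%:Z) | i in `I_N.*2.+1]).
  by move=> n /= nN; exists (absz (n + N%:Z)%R) => /=; lia.
exact/finite_image/finite_II.
Qed.

Lemma normc_sq_ge0 (z : R[i]) : 0 <= Normc.normc z ^+ 2.
Proof. exact: sqr_ge0. Qed.

Lemma ell2_summable (u : ell2 R) :
  (\esum_(n in [set: int]) (Normc.normc (u n) ^+ 2)%:E < +oo)%E.
Proof.
have /asboolP := valP u; rewrite /summable; apply: le_lt_trans.
by apply: le_esum => n _; exact: lee_abs.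
Qed.

Lemma ell2_nrm2E (u : ell2 R) :
  (ell2_nrm2 u)%:E = \esum_(n in [set: int]) (Normc.normc (u n) ^+ 2)%:E.
Proof.
rewrite fineK // ge0_fin_numE ?ell2_summable //.
by apply: esum_ge0 => n _; rewrite lee_fin normc_sq_ge0.
Qed.

Lemma partial_le (u : ell2 R) N : partial_nrm2 N u <= ell2_nrm2 u.
Proof.
rewrite -lee_fin ell2_nrm2E partial_nrm2E; apply: esum_ge.
exists [set n : int | (`|n| <= N)%N]; first by split; [exact: finite_ball | ].
by rewrite fsumEFin //; exact: finite_ball.
Qed.

Lemma esum_le_partial (u : int -> R[i]^o) M : (forall N, partial_nrm2 N u <= M) ->
  (\esum_(n in [set: int]) (Normc.normc (u n) ^+ 2)%:E <= M%:E)%E.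
Proof.
move=> uM; apply: ge_ereal_sup => _ [X [finX _] <-].
have [N XN] : exists N : nat, X `<=` [set n : int | (`|n| <= N)%N].
  have /finite_seqP[l ->] := finX; exists (\max_(i <- l) `|i|)%N => n /= nl.
  exact: (@leq_bigmax_seq _ _ _ (fun i : int => `|i|%N) _ nl).
rewrite fsumEFin // lee_fin; apply: le_trans (uM N); rewrite partial_nrm2E.
have finN := finite_ball N.
rewrite [leRHS](fsbigID X) //= (setIidr XN).
by rewrite lerDl; apply: fsumr_ge0 => n _; exact: normc_sq_ge0.
Qed.

Lemma ell2_of_partial (u : int -> R[i]^o) M : (forall N, partial_nrm2 N u <= M) ->
  exists2 w : ell2 R, (w : int -> R[i]^o) = u & ell2_nrm2 w <= M.
Proof.
move=> /esum_le_partial uM.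
have su : u \in square_summable (R := R).
  apply/asboolP; rewrite /summable; apply: le_lt_trans (ltry M); apply: le_trans uM.
  by apply: le_esum => n _; rewrite gee0_abs // lee_fin normc_sq_ge0.
exists (Ell2 su) => //.
by rewrite -lee_fin ell2_nrm2E.
Qed.

Lemma bd_cre (u : ell2 R) : bd (cre u) (ell2_nrm2 u).
Proof.
by move=> N; apply: le_trans (partial_le u N); rewrite /partial_nrm2 lerDl nrm2_ge0.
Qed.

Lemma bd_cim (u : ell2 R) : bd (cim u) (ell2_nrm2 u).
Proof.
by move=> N; apply: le_trans (partial_le u N); rewrite /partial_nrm2 lerDr nrm2_ge0.
Qed.

Lemma cre_schrodinger x E eta (u : ell2 R) n :
  cre (schrodinger R x u - (E +i* eta)%C *: u) n = hop x E (cre u) n + eta * cim u n.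
Proof.
rewrite /cre /cim /hop.
have -> : (schrodinger R x u - (E +i* eta)%C *: u) n =
  (u (n - 1) : R[i]) + u (n + 1) + (x n)%:R * u n - (E +i* eta)%C * u n by [].
move: (u (n - 1)) (u (n + 1)) (u n) => [a a'] [b b'] [c c'].
by case: (x n) => /=; ring.
Qed.

Lemma cim_schrodinger x E eta (u : ell2 R) n :
  cim (schrodinger R x u - (E +i* eta)%C *: u) n = hop x E (cim u) n - eta * cre u n.
Proof.
rewrite /cre /cim /hop.
have -> : (schrodinger R x u - (E +i* eta)%C *: u) n =
  (u (n - 1) : R[i]) + u (n + 1) + (x n)%:R * u n - (E +i* eta)%C * u n by [].
move: (u (n - 1)) (u (n + 1)) (u n) => [a a'] [b b'] [c c'].
by case: (x n) => /=; ring.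
Qed.

Lemma ell2_ext (u v : ell2 R) : cre u =1 cre v -> cim u =1 cim v -> u = v.
Proof.
move=> re im; apply/val_inj/funext => n; move: (re n) (im n); rewrite /cre /cim /=.
by case: (ell2_fun u n) => a b; case: (ell2_fun v n) => c d /= -> ->.
Qed.

(** Where [(H - E)^2 + eta^2] is bounded below, a solution of [(H - z) w = f] with
    [z = E + i eta] is [(H - conj z) u], where [u] solves the equation of the positive operator
    [(H - z)(H - conj z)], which is real. *)
Lemma resolvent_of_lower_bound x E eta c : 0 < c ->
    (forall v, fsupp v -> c * nrm2 v <= nrm2 (hop x E v) + eta ^+ 2 * nrm2 v) ->
  resolvent_set (schrodinger R x) (E +i* eta)%C.
Proof.
move=> c0 low; set z := (E +i* eta)%C.
have inj (w : ell2 R) : schrodinger R x w - z *: w = 0 -> w = 0.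
  move=> w0.
  have h1 n : hop x E (cre w) n = - eta * cim w n.
    by have := cre_schrodinger x E eta w n; rewrite -/z w0 /cre /= => h; lra.
  have h2 n : hop x E (cim w) n = eta * cre w n.
    by have := cim_schrodinger x E eta w n; rewrite -/z w0 /cim /= => h; lra.
  apply: ell2_ext => n.
    rewrite [RHS](_ : _ = 0) //; apply: (sqop_injective c0 low (bd_cre w)) => k.
    rewrite /sqop (funext h1) {1}/hop.
    have := h2 k; rewrite {1}/hop => h; rewrite -[LHS]addr0.
    by rewrite (_ : eta ^+ 2 * cre w k = eta * (eta * cre w k)); [rewrite -h; ring | ring].
  rewrite [RHS](_ : _ = 0) //; apply: (sqop_injective c0 low (bd_cim w)) => k.
  rewrite /sqop (funext h2) {1}/hop.
  have := h1 k; rewrite {1}/hop => h.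
  by rewrite (_ : eta ^+ 2 * cim w k = - eta * (- eta * cim w k)); [rewrite -h; ring | ring].
have [k k0 solve] := sqop_solvable c0 low.
pose K := Num.sqrt (hop_bound E) * k + `|eta| * k.
have K0 : 0 <= K by rewrite addr_ge0 // mulr_ge0 ?sqrtr_ge0.
have ex (f : ell2 R) : exists w : ell2 R, schrodinger R x w - z *: w = f /\
    ell2_nrm2 w <= (2 * K ^+ 2) * ell2_nrm2 f.
  pose m := Num.sqrt (ell2_nrm2 f).
  have m0 : 0 <= m := sqrtr_ge0 _.
  have mm : m ^+ 2 = ell2_nrm2 f by rewrite sqr_sqrtr // (bd_ge0 (bd_cre f)).
  have bre := bd_cre f; have bim := bd_cim f; rewrite -mm in bre bim.
  have [u1 bu1 e1] := solve _ _ m0 bre; have [u2 bu2 e2] := solve _ _ m0 bim.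
  have bhop u : bd u ((k * m) ^+ 2) -> bd (hop x E u) ((Num.sqrt (hop_bound E) * k * m) ^+ 2).
    move=> bu; rewrite -mulrA exprMn sqr_sqrtr ?(ltW (hop_bound_gt0 E)) //; exact: bd_hop.
  have beta u (s : R) : `|s| = `|eta| -> bd u ((k * m) ^+ 2) -> bd (fun n => s * u n) ((`|eta| * k * m) ^+ 2).
    move=> <- bu; rewrite -mulrA [X in bd _ X]exprMn real_normK ?num_real //; exact: bdZ.
  pose w1 n := hop x E u1 n + - eta * u2 n; pose w2 n := hop x E u2 n + eta * u1 n.
  have c1 : 0 <= Num.sqrt (hop_bound E) * k * m by rewrite !mulr_ge0 ?sqrtr_ge0.
  have c2 : 0 <= `|eta| * k * m by rewrite !mulr_ge0.
  have bw1 : bd w1 ((K * m) ^+ 2).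
    rewrite mulrDl; apply: bdD => //; first exact: bhop.
    by apply: beta => //; rewrite normrN.
  have bw2 : bd w2 ((K * m) ^+ 2).
    by rewrite mulrDl; apply: bdD => //; [exact: bhop | exact: beta].
  pose w n : R[i]^o := (w1 n +i* w2 n)%C.
  have [|W Ww nW] := @ell2_of_partial w (2 * K ^+ 2 * ell2_nrm2 f).
    move=> N; have h1 := bw1 N; have h2 := bw2 N; rewrite /partial_nrm2.
    rewrite (_ : cre w = w1) // (_ : cim w = w2) // -mm.
    by move: h1 h2; rewrite exprMn; lra.
  exists W; split => //.
  have r1 : cre W = w1 by rewrite Ww.
  have r2 : cim W = w2 by rewrite Ww.
  apply: ell2_ext => n.
    by rewrite cre_schrodinger r1 r2 -e1 /w1 /w2 /sqop /hop; ring.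
  by rewrite cim_schrodinger r1 r2 -e2 /w1 /w2 /sqop /hop; ring.
have [S SP] := choice ex.
have TZ (a : R[i]) (u v : ell2 R) : schrodinger R x (a *: u + v) - z *: (a *: u + v) =
    a *: (schrodinger R x u - z *: u) + (schrodinger R x v - z *: v).
  rewrite linearP scalerDr opprD scalerBr !scalerA [z * a]mulrC addrACA.
  by [].
have uniq (u v : ell2 R) : schrodinger R x u - z *: u = schrodinger R x v - z *: v -> u = v.
  move=> uv; apply/eqP; rewrite -subr_eq0; apply/eqP; apply: inj.
  have := TZ (-1) v u; rewrite !scaleN1r [- v + u]addrC => ->.
  by rewrite uv addNr.
have linS : linear S.
  move=> a f g; apply: uniq; rewrite TZ.
  by rewrite (SP _).1 (SP f).1 (SP g).1.
pose S' : {linear ell2 R -> ell2 R} := HB.pack S (GRing.isLinear.Build _ _ _ _ S linS).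
exists S'; split.
- exists (Num.sqrt (2 * K ^+ 2)) => u; rewrite /ell2_norm -!/(ell2_nrm2 _).
  rewrite -sqrtrM; last by rewrite mulr_ge0 ?sqr_ge0.
  by rewrite ler_wsqrtr //; exact: (SP u).2.
- by move=> u; apply: uniq; exact: (SP _).1.
- by move=> u; exact: (SP u).1.
Qed.

(** A bounded inverse would bound [|v|] by a multiple of [|(H - E) v|]. *)
Lemma spec_not_resolvent x E : @spec R x E -> ~ resolvent_set (schrodinger R x) E%:C.
Proof.
move=> xE [S [[M bM] ST _]].
pose c : R := (M ^+ 2 + 1)^-1; have c0 : 0 < c.
  by rewrite invr_gt0; have := sqr_ge0 M; lra.
have [_ [v [-> sv lt]]] := xE c c0; have v0 := apspec_nrm2_gt0 c0 lt.
pose u n : R[i]^o := (v n)%:C.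
have re0 : cre u = v by [].
have im0 : cim u = fun=> 0 by [].
have nrm0 : nrm2 (fun=> 0 : R) = 0.
  rewrite /nrm2 (@eq_tot _ _ (fun n => 0 * v n)) ?totZ ?mul0r // => n.
  by rewrite mul0r expr0n.
have cut0 N : cut N (fun=> 0 : R) = fun=> 0 by apply/funext => n; rewrite /cut if_same.
have [|U Uu nU] := @ell2_of_partial u (nrm2 v).
  by move=> N; rewrite /partial_nrm2 re0 im0 cut0 nrm0 addr0; exact: nrm2_cut_le.
pose F := schrodinger R x U - E%:C *: U.
have reF : cre F = hop x E v.
  apply/funext => n; rewrite (cre_schrodinger x E 0) mul0r addr0.
  by rewrite (_ : cre U = v) // Uu.
have imF : cim F = fun=> 0.
  apply/funext => n; rewrite (cim_schrodinger x E 0) mul0r subr0.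
  by rewrite (_ : cim U = fun=> 0) ?Uu // /hop !mulr0 !addr0.
have [|F' F'F nF] := @ell2_of_partial F (nrm2 (hop x E v)).
  move=> N; rewrite /partial_nrm2 reF imF cut0 nrm0 addr0.
  exact/nrm2_cut_le/fsupp_hop.
have {F'F} F'E : F' = F by apply: val_inj.
rewrite F'E in nF.
have lowU : nrm2 v <= ell2_nrm2 U.
  have [N vN] := sv; apply: le_trans (partial_le U N).
  rewrite /partial_nrm2 (_ : cre U = v) ?Uu // (_ : cut N v = v) ?lerDl ?nrm2_ge0 //.
  by apply/funext => n; rewrite /cut; case: ifPn => //; rewrite -ltnNge => /vN.
have := bM F; rewrite ST /ell2_norm -!/(ell2_nrm2 _) => h.
have h2 : ell2_nrm2 U <= M ^+ 2 * ell2_nrm2 F.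
  have U0 : 0 <= ell2_nrm2 U := bd_ge0 (bd_cre U).
  have F0 : 0 <= ell2_nrm2 F := bd_ge0 (bd_cre F).
  rewrite -(sqr_sqrtr U0) -(sqr_sqrtr F0) -exprMn ler_sqr ?nnegrE ?sqrtr_ge0 //.
  exact: le_trans (sqrtr_ge0 _) h.
have h3 : nrm2 v <= M ^+ 2 * (c * nrm2 v).
  apply: le_trans lowU _; apply: le_trans h2 _; apply: ler_wpM2l; first exact: sqr_ge0.
  exact: le_trans nF (ltW lt).
move: h3; rewrite mulrA -[X in X <= _]mul1r ler_pM2r //.
rewrite /c ler_pdivlMr; last by have := sqr_ge0 M; lra.
by rewrite mul1r; lra.
Qed.

(** Off the real axis [(H - E)^2 + eta^2] is bounded below by [eta^2]; on it, the
    lower bound is the negation of the existence of approximate eigenvectors. *)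
Lemma spectrum_spec x : spectrum (schrodinger R x) = [set e%:C | e in @spec R x].
Proof.
rewrite eqEsubset; split => [[E eta] nres | _ [e xe <-]]; last exact: spec_not_resolvent.
have [eta0|eta0] := eqVneq eta 0.
  exists E; last by rewrite eta0.
  apply: contrapT => /not_specP[c c0 cP]; apply: nres.
  apply: (resolvent_of_lower_bound c0) => v sv.
  by rewrite eta0 expr0n /= mul0r addr0; exact: cP.
exfalso; apply: nres; apply: (@resolvent_of_lower_bound x E eta (eta ^+ 2)).
  by rewrite exprn_even_gt0.
by move=> v sv; rewrite lerDr nrm2_ge0.
Qed.
End Resolvent.

(** * The hierarchy and its spectrum *)

(** Connected sets of reals are intervals, and a null set contains no segment. *)
Lemma null_totally_disconnected (R : realType) (A : set R) : measurable A -> lebesgue_measure A = 0%E ->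
  totally_disconnected A.
Proof.
move=> mA A0 x Ax; rewrite eqEsubset; split => [y [C [Cx CA cC] Cy]|_ ->]; last first.
  exists [set x] => //=; split => // [_ -> //|]; exact: connected1.
have iC := proj1 (connected_intervalP C) cC.
have no u v : C u -> C v -> ~ u < v.
  move=> Cu Cv uv; have : (lebesgue_measure (`[u, v]%classic : set R) <= lebesgue_measure A)%E.
    apply: le_measure; rewrite ?inE //.
    by move=> z; rewrite /= in_itv /= => /(iC _ _ Cu Cv)/CA.
  rewrite A0 lebesgue_measure_itv /= lte_fin uv -EFinB lee_fin subr_le0.
  by rewrite leNgt uv.
by have [/(no _ _ Cy Cx)|/(no _ _ Cx Cy)|] := ltgtP y x.
Qed.

Lemma limn_esup_pinfty (R : realType) (u : nat -> \bar R) :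
  (forall k : nat, exists2 n, (k <= n)%N & (k%:R%:E <= u n)%E) -> limn_esup u = +oo%E.
Proof.
move=> h; apply/eqP; rewrite eq_le leey /limn_esup /limf_esup /=; apply: le_ereal_inf_tmp => _ [V [n0 _ Vn0] <-].
rewrite leye_eq; apply/eqP/eqyP => A A0.
have [n kn un] := h (maxn n0 (Num.bound A)).
apply: (@le_trans _ _ (u n)); last first.
  by apply: ereal_sup_ubound; exists n => //; apply: Vn0 => /=; apply: leq_trans kn; exact: leq_maxl.
apply: le_trans un; rewrite lee_fin; apply: le_trans (ltW (archi_boundP (ltW A0))) _.
by rewrite ler_nat leq_maxr.
Qed.
Section Construction.
Variable R : realType.
Implicit Types (a : nat -> nat) (s t : nat -> seq bool).

(** With [ln (a n) <= eta * n] for large [n] and [eta = ln 2 / (2 L)], the square of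
    [a (N * L)] is at most [2 ^ N]; the other half of [2 ^ (2 * N)] absorbs the square of [M]. *)
Lemma subexp_scale a L M : (forall n, (0 < n)%N -> (0 < a n)%N) ->
    limn_esup (fun n => (n%:R^-1 * ln ((a n)%:R : R))%:E) = 0%E -> (0 < L)%N ->
  exists2 N, (M + 3 <= N)%N & (M * a (N * L) <= 2 ^ N)%N.
Proof.
move=> a0 sub L0; have ln2 : 0 < ln (2 : R) by rewrite ln_gt0 //; lra.
pose eta : R := ln 2 / (2 * L%:R).
have LR : 0 < L%:R :> R by rewrite ltr0n.
have eta0 : 0 < eta by rewrite divr_gt0 // mulr_gt0.
have lt : (limn_esup (fun n => (n%:R^-1 * ln ((a n)%:R : R))%:E) < eta%:E)%E.
  by rewrite sub lte_fin.
have [_ [V [n0 _ Vn0] <-] supV] := ereal_inf_lt lt.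
pose N := (maxn n0 (2 * M + 3))%N; exists N; first by rewrite /N; lia.
have NL : (N <= N * L)%N by rewrite leq_pmulr.
have NL0 : (0 < N * L)%N by rewrite muln_gt0 L0 /N; lia.
have A0 := a0 _ NL0; set A := a (N * L)%N in A0 *.
have AR : 0 < A%:R :> R by rewrite ltr0n.
have : (((N * L)%N%:R^-1 * ln (A%:R : R))%:E < eta%:E)%E.
  apply: le_lt_trans supV; apply: ereal_sup_ubound.
  by exists (N * L)%N => //; apply: Vn0 => /=; apply: leq_trans NL; exact: leq_maxl.
rewrite lte_fin ltr_pdivrMl ?ltr0n // => lnA.
have A2 : (A ^ 2 <= 2 ^ N)%N.
  rewrite -(ler_nat R) !natrX -ler_ln ?posrE ?exprn_gt0 // !lnXn //.
  move: lnA; rewrite /eta natrM (_ : _ * _ * _ = N%:R * ln 2 / 2); last first.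
    by field; rewrite gt_eqF.
  by rewrite -[X in X <= _]mulr_natl -[X in _ <= X]mulr_natl; lra.
have M2 : (M ^ 2 <= 2 ^ N)%N.
  apply: (@leq_trans (2 ^ (M * 2))); first by rewrite expnM leq_exp2r // ltnW // ltn_expl.
  by rewrite leq_exp2l // /N; lia.
by rewrite -(@leq_exp2r _ _ 2) // expnMn expnS expn1 leq_mul.
Qed.

(** The bound [1 / (k + 1)] tends to zero, which makes the limiting spectrum null. *)
Definition refines k (p q : seq bool * seq bool) N := exists b1 b2,
  [/\ q.1 = csubst p.1 p.2 b1, q.2 = csubst p.1 p.2 b2 &
      forall b, size b = N -> infix b b1 /\ infix b b2] /\
  small k.+1%:R^-1 (apspec (reads_blocks (R := R) q.1 q.2)).

(** The lengths of the blocks are known before the number of concatenated blocks is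
    chosen, so that number can beat the subexponential growth of [a] at the scale
    where the complexity is estimated. *)
Lemma hierarchy_exists a : (forall n, (0 < n)%N -> (0 < a n)%N) ->
    limn_esup (fun n => (n%:R^-1 * ln ((a n)%:R : R))%:E) = 0%E ->
  exists s t (N : nat -> nat), forall k,
    [/\ size (s k) = size (t k), s k != t k, (k + 3 <= N k)%N,
        (k * a (N k * size (s k)) <= 2 ^ N k)%N &
        refines k (s k, t k) (s k.+1, t k.+1) (N k)].
Proof.
move=> a0 sub.
pose pair := {p : seq bool * seq bool | size p.1 = size p.2 /\ p.1 != p.2}.
have step (kp : nat * pair) : exists qN : pair * nat,
    [/\ (kp.1 + 3 <= qN.2)%N, (kp.1 * a (qN.2 * size (sval kp.2).1) <= 2 ^ qN.2)%N &
        refines kp.1 (sval kp.2) (sval qN.1) qN.2].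
  case: kp => k [[u v] /= [uv uNv]].
  have u0 : (0 < size u)%N.
    rewrite lt0n; apply: contra_neq uNv => u0.
    by rewrite (size0nil u0) (size0nil (esym (etrans (esym u0) uv))).
  have [N kN NP] := subexp_scale k a0 sub u0.
  have k1 : 0 < k.+1%:R^-1 :> R by rewrite invr_gt0.
  have [b1 [b2 [b12 cN bN sm]]] := @stage R u v N _ uv uNv k1.
  have h : size (csubst u v b1) = size (csubst u v b2) /\ csubst u v b1 != csubst u v b2.
    by rewrite !size_csubst // b12.
  by exists (exist _ (csubst u v b1, csubst u v b2) h, N); split => //=; exists b1, b2.
have [f fP] := choice step.
have p0P : size [:: false] = size [:: true] /\ [:: false] != [:: true] by [].
pose P := nat_rect (fun=> pair) (exist _ ([:: false], [:: true]) p0P) (fun k p => (f (k, p)).1).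
exists (fun k => (sval (P k)).1), (fun k => (sval (P k)).2), (fun k => (f (k, P k)).2) => k.
by have [h1 h2] := svalP (P k); have [h3 h4 h5] := fP (k, P k).
Qed.
End Construction.

Section Limit.
Variable R : realType.
Variables (s t : nat -> seq bool) (N : nat -> nat).
Hypothesis size_st : forall k, size (s k) = size (t k).
Hypothesis neq_st : forall k, s k != t k.
Hypothesis N_ge3 : forall k, (3 <= N k)%N.
Hypothesis next : forall k, exists b1 b2,
  [/\ s k.+1 = csubst (s k) (t k) b1, t k.+1 = csubst (s k) (t k) b2 &
      forall b, size b = N k -> infix b b1 /\ infix b b2].

(** An approximate eigenvector only sees a finite window of the sequence, and
    the window sits inside a concatenation of the blocks of each level. *)
Lemma spec_sub_blocks y k : hierarchy_shift s y ->
  @spec R y `<=` apspec (reads_blocks (R := R) (s k) (t k)).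
Proof.
move=> Yy; apply: apspec_sub => _ v -> [n vn].
have [j kj wj] := language_above N_ge3 next k (Yy (- n%:Z - 2) (n.*2 + 5)%N).
have [b [_ [sj _]]] := blocks_above next kj.
have [l [r e]] := infix_split wj.
pose p : int := - n%:Z - 2 - (size l)%:Z.
have sz : size (s j) = (size l + (n.*2 + 5 + size r))%N by rewrite e !size_cat size_window.
exists (fun i => nth false (s j) (absz (i - p)%R)).
  exists p, b; rewrite -sj; split => [i _|i vi].
    by congr nth; rewrite /p; lia.
  have {vi} : ~ (n < `|i|)%N by move=> /vn i0; rewrite i0 eqxx in vi.
  by rewrite sz /p; lia.
move=> E i; rewrite /hop; have [/vn -> |ni] := ltnP n `|i|; first by rewrite !mulr0.
congr (_ + (_ - _) * _).
rewrite e nth_cat ifF; last by rewrite /p; lia.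
rewrite nth_cat size_window ifT; last by rewrite /p; lia.
rewrite nth_window; last by rewrite /p; lia.
by congr (y _)%:R; rewrite /p; lia.
Qed.

(** All sequences of the subshift have the same windows, recurrently. *)
Lemma spec_hierarchy_constant x y : hierarchy_shift s x -> hierarchy_shift s y ->
  @spec R x = @spec R y.
Proof.
move=> Yx Yy; rewrite eqEsubset; split; apply: spec_recurs => p n q;
  exact: (recurrent_window size_st N_ge3 next).
Qed.

Lemma spec_null y : hierarchy_shift s y ->
    (forall k, small k.+1%:R^-1 (apspec (reads_blocks (R := R) (s k.+1) (t k.+1)))) ->
  lebesgue_measure (@spec R y) = 0%E.
Proof.
move=> Yy sm; apply/eqP; rewrite eq_le measure_ge0 andbT.
apply/lee_addgt0Pr => e e0; rewrite add0e.
have [k _ ke] := near_infty_natSinv_lt (PosNum e0).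
have [U [mU sU Ue]] := sm k.
have mS : measurable (@spec R y) by apply: closed_measurable; exact: closed_apspec.
apply: (@le_trans _ _ (lebesgue_measure U)).
  by apply: le_measure; rewrite ?inE // => E /(spec_sub_blocks k.+1 Yy)/sU.
by apply: le_trans Ue _; rewrite lee_fin ltW //; apply: ke => /=.
Qed.

Lemma spec_cantor y : hierarchy_shift s y -> lebesgue_measure (@spec R y) = 0%E ->
  cantor_set (@spec R y).
Proof.
move=> Yy S0; have clS : closed (@spec R y) by exact: closed_apspec.
split; first exact: spec_nonempty.
- by apply: (subclosed_compact clS (@segment_compact R (-5) 5)); exact: apspec_energies.
- split => //; rewrite eqEsubset; split => [E limE|E SE U /nbhs_ballP[d d0 dU]].
    by apply: clS => U /limE[z [_ Sz Uz]]; exists z.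
  have [|z [Sz zE zd]] := spec_no_isolated _ SE d0.
    by move=> p n q; exact: (recurrent_window size_st N_ge3 next).
  by exists z; split => //; apply: dU; rewrite /ball /= distrC.
- by apply: null_totally_disconnected => //; exact: closed_measurable.
Qed.

End Limit.

Theorem corollary1p2 (R : realType) (a : nat -> nat)
    (a_gt0 : forall n, (0 < n)%N -> (0 < a n)%N)
    (a_subexp : limn_esup (fun n => (n%:R^-1 * ln ((a n)%:R : R))%:E) = 0%E) :
  exists (Sigma : set R) (Y : set full_shift),
    [/\ cantor_set Sigma,
        lebesgue_measure Sigma = 0%E,
        minimal_subshift Y,
        limn_esup (fun n => ((complexity Y n)%:R / (a n)%:R : R)%:E) = +oo%E &
        forall y, Y y ->
          spectrum (schrodinger R y) = [set x%:C | x in Sigma]].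
Proof.
have [s [t [N P]]] := hierarchy_exists a_gt0 a_subexp.
have size_st k : size (s k) = size (t k) by have [] := P k.
have neq_st k : s k != t k by have [] := P k.
have N_ge3 k : (3 <= N k)%N by have [_ _ h _ _] := P k; apply: leq_trans h; exact: leq_addl.
have next k : exists b1 b2,
    [/\ s k.+1 = csubst (s k) (t k) b1, t k.+1 = csubst (s k) (t k) b2 &
        forall b, size b = N k -> infix b b1 /\ infix b b2].
  by have [_ _ _ _ [b1 [b2 [h _]]]] := P k; exists b1, b2.
have small_st k : small k.+1%:R^-1 (apspec (reads_blocks (R := R) (s k.+1) (t k.+1))).
  by have [_ _ _ _ [b1 [b2 []]]] := P k.
have minY := hierarchy_minimal size_st neq_st N_ge3 next.
have [_ [y0 Yy0] _] := minY.
have null := spec_null N_ge3 next Yy0 small_st.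
exists (@spec R y0), (hierarchy_shift s); split => //.
- exact: (spec_cantor size_st N_ge3 next).
- apply: limn_esup_pinfty => k; have [_ _ kN aN _] := P k.
  set n := (N k * size (s k))%N in aN.
  have n0 : (k + 3 <= n)%N.
    by apply: leq_trans kN _; rewrite leq_pmulr // (size_s_gt0 size_st neq_st).
  exists n; first by apply: leq_trans n0; exact: leq_addr.
  rewrite lee_fin ler_pdivlMr ?ltr0n; last by apply: a_gt0; apply: leq_trans n0; rewrite addnS.
  rewrite -natrM ler_nat; apply: leq_trans aN _.
  exact: (hierarchy_complexity size_st neq_st N_ge3 next).
- move=> y Yy; rewrite spectrum_spec.
  by rewrite (spec_hierarchy_constant R size_st N_ge3 next Yy Yy0).
Qed.
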